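(* Let $S=(S_t)_{t\ge0}$ be a subordinator with no drift and infinite Lévy measure $\Pi$. Let $k:\mathbb{R}_+\to\mathbb{R}$ be a function with bounded variations, i.e. which can be expressed as the difference of two bounded non-decreasing right-continuous functions. Then $k$ belongs to the domain $\mathcal{D}_e$ of the extended generator of $S$, and $$G_ek(x)=\int_{(0,\infty)}\bigl(k(x+y)-k(x)\bigr)\,\Pi(\mathrm{d}y),\qquad x\ge0,$$ with the convention that $G_ek(x)=0$ when the integral is not well-defined.
   Context: $\mathbb{R}_+=[0,\infty)$. $S$ is a process with values in $\mathbb{R}_+$, $S_0=0$, with independent and stationary increments, whose sample paths are right-continuous, strictly increasing and have no continuous component; thus $S_t=\sum_{0<s\le t}\Delta S_s$ with $\Delta S_s=S_s-S_{s-}$, and the jump process $\Delta S$ is a Poisson point process with intensity $\Pi$ (the Lévy measure of $S$), where $\Pi((0,\infty))=\infty$ and $\int_{(0,\infty)}(1\wedge y)\,\Pi(\mathrm{d}y)<\infty$. Martingales are with respect to the natural filtration of $S$, augmented to satisfy the usual conditions. A measurable function $h:\mathbb{R}_+\to\mathbb{R}$ belongs to the domain $\mathcal{D}_e$ of the extended generator of $S$ if there exists a measurable function $b$ on $\mathbb{R}_+$ such that for every $x\ge0$ and $t\ge0$, $\int_0^t|b(x+S_s)|\,\mathrm{d}s<\infty$ a.s., and for every $x\ge0$ the process $$h(x+S_t)-\int_0^t b(x+S_s)\,\mathrm{d}s,\qquad t\ge0,$$ is a martingale. One then writes $G_eh=b$ (a slight abuse of notation, since $b$ is not unique): the assertion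 $G_eh=b$ means that, for this $b$, $\int_0^t|b(x+S_s)|\,\mathrm{d}s<\infty$ a.s. for every $x\ge0$ and $t\ge0$, and the process $h(x+S_t)-\int_0^t b(x+S_s)\,\mathrm{d}s$, $t\ge0$, is a martingale for every $x\ge0$. Here $b$ is allowed to take values in $[-\infty,\infty]$. The integral in the claim is well-defined (in $[-\infty,\infty]$) when the positive part or the negative part of $y\mapsto k(x+y)-k(x)$ is $\Pi$-integrable. *)

(* Defs.v *)
From HB Require Import structures.
From mathcomp Require Import all_boot all_order all_algebra.
From mathcomp Require Import all_classical all_reals all_analysis.
From mathcomp Require Import measurable_realfun.
Set Implicit Arguments.
Unset Strict Implicit.
Unset Printing Implicit Defensive.
Import Order.TTheory GRing.Theory Num.Theory.
Import numFieldNormedType.Exports.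
Local Open Scope classical_set_scope.
Local Open Scope ring_scope.

(* Processes and functions on [0, +oo) are encoded as functions on R; only
   their values at nonnegative arguments are ever constrained or used. *)

(* The finite family X is mutually independent. Subfamilies are covered by
   taking some of the A i to be the full set. *)
Definition mutually_independent (d d' : measure_display)
    (T : measurableType d) (E : measurableType d') (R : realType)
    (P : probability T R) (n : nat) (X : 'I_n -> T -> E) : Prop :=
  forall A : 'I_n -> set E, (forall i, measurable (A i)) ->
    P (\bigcap_(i in [set: 'I_n]) (X i @^-1` A i)) =
    (\prod_(i < n) P (X i @^-1` A i))%E.

Section subordinator.
Context (d : measure_display) (T : measurableType d) (R : realType).
Implicit Types (P : probability T R) (S : R -> T -> R).
Implicit Type Pi : {measure set R -> \bar R}.

Definition jump S (s : R) (w : T) : R :=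
  S s w - lim (S u w @[u --> s^'-]).

Definition driftless_subordinator P S : Prop :=
  [/\ (forall t, 0 <= t -> measurable_fun setT (S t)),
      (forall t w, 0 <= t -> 0 <= S t w) /\ (forall w, S 0 w = 0),
      (forall t : nat -> R, 0 <= t 0%N -> nondecreasing_seq t ->
         forall n, mutually_independent P
           (fun (i : 'I_n) w => S (t i.+1) w - S (t i) w)) /\
      (forall s t, 0 <= s -> 0 <= t ->
         forall A : set R, measurable A ->
         P ((fun w => S (s + t) w - S s w) @^-1` A) = P (S t @^-1` A)),
      (forall w t, 0 <= t -> S u w @[u --> t^'+] --> S t w) /\
      (forall w s t, 0 <= s -> s < t -> S s w < S t w) &
      forall w t, 0 <= t ->
        (S t w)%:E = \esum_(s in `]0, t]%classic) (jump S s w)%:E].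

(* Number of points (s, jump S s) of the jump process lying in B. *)
Definition jump_count S (B : set (R * R)) (w : T) : \bar R :=
  counting [set s : R | [/\ 0 < s, 0 < jump S s w & B (s, jump S s w)]].

(* (Lebesgue (x) Pi)(B restricted to (0,+oo)^2), as an iterated integral because
   Pi need not be sigma-finite outside (0,+oo). *)
Definition jump_intensity Pi (B : set (R * R)) : \bar R :=
  (\int[lebesgue_measure]_(s in `]0%R, +oo[)
     Pi [set y | (0 < y)%R /\ B (s, y)])%E.

Definition poisson_distributed P (N : T -> \bar R) (mean : \bar R) : Prop :=
  (forall r : R, mean = r%:E ->
     forall n : nat, P [set w | N w = n%:R%:E] = (r ^+ n / n`!%:R * expR (- r))%:E) /\
  (mean = +oo%E -> P [set w | N w = +oo%E] = 1%E).

(* The jump process of S is a Poisson point process with intensity Pi: the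
   counts of its points form a Poisson random measure on (0,+oo)^2. *)
Definition jumps_poisson_point_process P S Pi : Prop :=
  [/\ (forall B : set (R * R), measurable B ->
         measurable_fun setT (jump_count S B)),
      (forall B : set (R * R), measurable B ->
         poisson_distributed P (jump_count S B) (jump_intensity Pi B)) &
      (forall n (B : 'I_n -> set (R * R)), (forall i, measurable (B i)) ->
         trivIset setT B ->
         mutually_independent P (fun i => jump_count S (B i)))].

(* Only the restriction of Pi to (0,+oo) matters. *)
Definition levy_measure_of P S Pi : Prop :=
  jumps_poisson_point_process P S Pi /\
  (\int[Pi]_(y in `]0%R, +oo[) (Num.min 1 y)%:E < +oo)%E.

Definition natural_filtration S (t : R) : set (set T) :=
  <<s [set A | exists s (B : set R),
         [/\ 0 <= s, s <= t, measurable B & A = S s @^-1` B]] >>.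

(* Usual augmentation: null events are added, then the filtration is made
   right-continuous. When P is complete, the null events are exactly the
   P-negligible sets; completeness is not required of P. *)
Definition augmented_filtration P S (t : R) : set (set T) :=
  \bigcap_(u in `]t, +oo[%classic)
    <<s natural_filtration S u `|` [set A | measurable A /\ P A = 0%E] >>.

(* Y is a version of the conditional expectation of X given G. *)
Definition is_cond_expectation P (G : set (set T)) (X Y : T -> \bar R) : Prop :=
  [/\ (forall B : set (\bar R), measurable B -> G (Y @^-1` B)),
      P.-integrable setT X, P.-integrable setT Y &
      forall A, G A -> (\int[P]_(w in A) Y w = \int[P]_(w in A) X w)%E].

(* The case s = t gives adaptedness and integrability. The process takes values
   in \bar R because the compensator below may be infinite on a null event. *)
Definition martingale P (F : R -> set (set T)) (M : R -> T -> \bar R) : Prop :=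
  forall s t, 0 <= s -> s <= t -> is_cond_expectation P (F s) (M t) (M s).

(* The assertion "G_e h = b". *)
Definition extended_generator P S (h : R -> R) (b : R -> \bar R) : Prop :=
  [/\ measurable_fun (`[0, +oo[%classic : set R) b,
      (forall x t, 0 <= x -> 0 <= t ->
         {ae P, forall w,
           (\int[lebesgue_measure]_(s in `[0%R, t]) `|b (x + S s w)%R|
              < +oo)%E}) &
      (forall x, 0 <= x ->
         martingale P (augmented_filtration P S)
           (fun t w => ((h (x + S t w)%R)%:E -
              \int[lebesgue_measure]_(s in `[0%R, t]) b (x + S s w)%R)%E))].

Definition extended_domain P S (h : R -> R) : Prop :=
  measurable_fun (`[0, +oo[%classic : set R) h /\ exists b, extended_generator P S h b.

End subordinator.

Section levy_generator.
Context (R : realType).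

Definition bounded_nondecreasing_rc (f : R -> R) : Prop :=
  [/\ [bounded f x | x in `[0, +oo[%classic],
      (forall x y, 0 <= x -> x <= y -> f x <= f y) &
      (forall x, 0 <= x -> f u @[u --> x^'+] --> f x)].

Definition bounded_variations (k : R -> R) : Prop :=
  exists k1 k2 : R -> R,
    [/\ bounded_nondecreasing_rc k1, bounded_nondecreasing_rc k2 &
        forall x, 0 <= x -> k x = k1 x - k2 x].

Definition levy_generator (Pi : {measure set R -> \bar R}) (k : R -> R)
    (x : R) : \bar R :=
  let f := fun y : R => (k (x + y) - k x)%:E in
  if `[< Pi.-integrable `]0, +oo[%classic (f^\+)%E \/
         Pi.-integrable `]0, +oo[%classic (f^\-)%E >]
  then (\int[Pi]_(y in `]0%R, +oo[) f y)%E
  else 0%E.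

End levy_generator.

(* Main.v *)
Require Import Defs.
From HB Require Import structures.
From mathcomp Require Import all_boot all_order all_algebra finmap.
From mathcomp Require Import all_classical all_reals all_analysis.
From mathcomp Require Import measurable_realfun ring lra.
Set Implicit Arguments.
Unset Strict Implicit.
Unset Printing Implicit Defensive.
Import Order.TTheory GRing.Theory Num.Theory.
Import numFieldNormedType.Exports.
Local Open Scope classical_set_scope.
Local Open Scope ring_scope.

(** Write $k=k_1-k_2$ with $k_1,k_2$ bounded, nondecreasing and right-continuous.
    The point is Dynkin's formula for one such function, [generator_formula]:
    $$E[k(x+S_t)]-k(x)=E\int_0^t G k(x+S_s)\,ds,\qquad
      Gk(z)=\int_{]0,\infty[}(k(z+y)-k(z))\,\Pi(dy)\in[0,\infty].$$
    No regularity of $k$ is available, so it cannot come from Itô's formula.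
    Instead $k$ is written as an integral of indicators of half-lines against
    its Stieltjes measure. For the half-line $[a,\infty[$, with $a>0$, the formula
    reads $P(S_t\ge a)=E\int_0^t\Pi([a-S_s,\infty[)1_{S_s<a}\,ds$, which is
    [level_crossing]: a level is crossed by a jump, and the right-hand side is the
    expected number of jumps that cross it before $t$.

    That every level is almost surely crossed by a jump, and never hit
    continuously, is Kesten's theorem [no_creeping]. It is proved analytically.
    With $U$ the potential measure, $\psi(a)=\int U(dz)\,\Pi([a-z,\infty[)$
    ([overshoot]) is the probability of crossing $a$ by a jump. Its Laplace
    transform is $1/q$, because $\hat U(q)\Phi(q)=1$, so that $\psi=1$ almost
    everywhere. The renewal equation [renewal] above a level then bounds
    $p=1-\psi$ by $p(u)p(v)\le p(u+v)\le 1-p(u)(1-p(v))$ ([creepM], [creep_le]).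
    If $p$ were positive at one level it would be close to $1$ at arbitrarily
    small ones, and the two inequalities would propagate this to a whole interval,
    which the almost everywhere statement forbids.

    The relation $\hat U\Phi=1$ is the Lévy-Khintchine formula
    [laplace_subordinator]. It follows from the Poisson point process of the
    jumps: with jump sizes rounded to a finite grid, $S_t$ is a finite combination
    of independent Poisson variables. Then [level_crossing] follows from the
    theorem by splitting $U$ at time $t$ with the Markov property.

    The Markov property also conditions Dynkin's formula on the past at a time
    $u$. Null events do not matter, and letting $u$ decrease to $s$ extends it to
    the events of the right-continuous filtration at time $s$
    ([generator_formula_right]). So $k_i(x+S_t)-\int_0^tGk_i(x+S_s)\,ds$ satisfies
    the martingale identity for $i=1,2$. Since $E\int_0^tGk_i(x+S_s)\,ds$ is
    finite, almost surely both $Gk_i(x+S_s)$ are finite for almost every $s$; there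
    the generator of $k$ is $Gk_1-Gk_2$, and the difference of the two processes is
    the required martingale. It is adapted, because up to time $t$ the
    right-continuous process is jointly measurable with respect to time and the
    past at $t$. *)

(** * Uniqueness of Laplace transforms *)
Section threshold.
Context {R : realType}.
Implicit Types (s t u : R) (n : nat).

Lemma expRN_le u : 0 < u -> expR (- u) <= 2 / u ^+ 2 :> R.
Proof.
move=> u0; rewrite expRN -[2 / _]invf_div lef_pV2 ?posrE ?expR_gt0 ?divr_gt0 ?exprn_gt0//.
have := expR_ge1Dxn 1 (ltW u0); have -> : (2`! = 2)%N by [].
by apply: le_trans; rewrite lerDr.
Qed.

Lemma mul_expr_cvg0 t : 0 <= t < 1 -> n.+1%:R * t ^+ n.+1 @[n --> \oo] --> (0 : R).
Proof.
move=> /andP[t0 t1]; set d := 1 - t.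
have d0 : 0 < d by rewrite subr_gt0.
have td : t <= expR (- d).
  by rewrite (le_trans _ (expR_ge1Dx _))// /d opprB addrC subrK.
apply: (@squeeze_cvgr _ _ _ _ (cst 0) (fun n => 2 / d ^+ 2 * harmonic n)).
- near=> n; rewrite mulr_ge0 ?exprn_ge0//=.
  have n0 : 0 < n.+1%:R :> R by [].
  rewrite (@le_trans _ _ (n.+1%:R * expR (- (n.+1%:R * d))))//.
    rewrite ler_wpM2l// -mulrN mulrC expRM_natr.
    by rewrite lerXn2r// nnegrE ?expR_ge0.
  rewrite (le_trans (ler_wpM2l (ltW n0) (expRN_le (mulr_gt0 n0 d0))))//.
  rewrite le_eqVlt; apply/orP; left; apply/eqP; field.
  by move: n0; rewrite -natr1 addrC => n0; rewrite (gt_eqF d0) !(gt_eqF n0).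
- exact: cvg_cst.
- rewrite -[X in _ --> X](mulr0 (2 / d ^+ 2)); apply: cvgMr.
  exact: cvg_harmonic.
Unshelve. all: by end_near. Qed.

(** Bernoulli's inequality, up to $x=1$. *)
Lemma bernoulli_ineq (x : R) m : 0 <= x <= 1 -> 1 - m%:R * x <= (1 - x) ^+ m.
Proof.
move=> /andP[x0 x1]; elim: m => [|m IH]; first by rewrite mul0r subr0 expr0.
rewrite exprS; apply: (@le_trans _ _ ((1 - x) * (1 - m%:R * x))).
  rewrite -[m.+1]addn1 natrD; have : 0 <= m%:R * x ^+ 2 by rewrite mulr_ge0 ?exprn_ge0.
  lra.
by rewrite ler_wpM2l// subr_ge0.
Qed.

(** $(1-s^n)^{n2^n}$ detects whether $s<1/2$. *)
Lemma threshold_cvg s : 0 <= s <= 1 ->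
  (1 - s ^+ n.+1) ^+ (n.+1 * 2 ^ n.+1) @[n --> \oo] --> ((s < 2^-1)%R%:R : R).
Proof.
move=> /andP[s0 s1].
have sn n : 0 <= s ^+ n.+1 <= 1 by rewrite exprn_ge0// exprn_ile1.
have [sh|sh] := ltP s 2^-1.
- apply: (@squeeze_cvgr _ _ _ _ (fun n : nat => 1 - n.+1%:R * ((2 * s)%R ^+ n.+1)) (cst 1)).
  + near=> n; apply/andP; split; last first.
      have /andP[a b] := sn n.
      by rewrite exprn_ile1// ?subr_ge0// gerBl.
    apply: le_trans (bernoulli_ineq (n.+1 * 2 ^ n.+1) (sn n)).
    by rewrite natrM natrX exprMn mulrA.
  + rewrite -[X in _ --> X]subr0; apply: cvgB; first exact: cvg_cst.
    apply: mul_expr_cvg0; lra.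
  + exact: cvg_cst.
- apply: (@squeeze_cvgr _ _ _ _ (cst 0) (fun n => 2 * harmonic n)).
  + near=> n; have /andP[a b] := sn n.
    rewrite exprn_ge0 ?subr_ge0//=.
    rewrite (@le_trans _ _ (expR (- n.+1%:R)))//.
      rewrite (@le_trans _ _ (expR (- s ^+ n.+1) ^+ (n.+1 * 2 ^ n.+1)))//.
        rewrite lerXn2r// ?nnegrE ?subr_ge0 ?expR_ge0//.
        exact: expR_ge1Dx.
      rewrite -expRM_natr ler_expR mulNr lerN2 natrM natrX mulrCA -exprMn.
      by rewrite ler_peMr// exprn_ege1//; lra.
    rewrite (le_trans (expRN_le _))//= /harmonic/= expr2 invfM mulrA.
    by rewrite ler_piMr// invf_le1// ler1n.
  + exact: cvg_cst.
  + rewrite -[X in _ --> X](mulr0 2); apply: cvgMr.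
    exact: cvg_harmonic.
Unshelve. all: by end_near. Qed.
End threshold.

Section laplace_uniqueness.
Context {R : realType}.
Local Open Scope ereal_scope.
Implicit Types (mu nu : {measure set R -> \bar R}) (q r a b : R).

Local Notation D0 := (`[0%R, +oo[%classic : set R).

Let mD0 : measurable D0. Proof. exact: measurable_itv. Qed.

Lemma measurable_expRM q : measurable_fun [set: R] (fun x : R => expR (q * x)).
Proof. by apply: measurableT_comp => //; exact: mulrl_measurable. Qed.

(** Finiteness for every $q>0$ leaves room for an infinite total mass, as for a
    potential measure. *)
Definition finite_laplace mu :=
  forall q, (0 < q)%R -> \int[mu]_(x in D0) (expR (- q * x))%:E < +oo.

Lemma finite_laplace_integrable mu (h : R -> R) q : finite_laplace mu ->
  (0 < q)%R -> measurable_fun [set: R] h ->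
  (forall x, (0 <= x)%R -> (0 <= h x <= 1)%R) ->
  mu.-integrable D0 (fun x => (expR (- q * x) * h x)%:E).
Proof.
move=> fmu q0 mh h01.
have mE : measurable_fun D0 (fun x : R => (expR (- q * x))%:E).
  by apply/measurable_EFinP; apply: measurable_funTS; exact: measurable_expRM.
apply: (@le_integrable _ _ _ _ _ mD0 _ (fun x => (expR (- q * x))%:E)).
- apply/measurable_EFinP; apply: measurable_funTS; apply: measurable_funM => //.
  exact: measurable_expRM.
- move=> x /=; rewrite in_itv/= andbT => x0.
  have /andP[h0 h1] := h01 _ x0.
  by rewrite lee_fin !ger0_norm ?mulr_ge0 ?expR_ge0// ler_piMr// expR_ge0.
- apply/integrableP; split => //.
  under eq_integral do rewrite /= ger0_norm ?expR_ge0//.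
  exact: fmu.
Qed.

Lemma finite_laplace_bounded mu b : finite_laplace mu ->
  mu (`]-oo, b]%classic `&` D0) < +oo.
Proof.
move=> fmu; have mA : measurable (`]-oo, b]%classic `&` D0).
  by apply: measurableI => //; exact: measurable_itv.
rewrite -[mu _]mul1e -integral_cst//.
apply: (@le_lt_trans _ _ (\int[mu]_(x in D0) ((expR b)%:E * (expR (- 1 * x))%:E))); last first.
  rewrite ge0_integralZl_EFin ?expR_ge0//.
  - by rewrite lte_mul_pinfty ?lee_fin ?expR_ge0// fmu.
  - by apply/measurable_EFinP; apply: measurable_funTS; exact: measurable_expRM.
apply: (@le_trans _ _ (\int[mu]_(x in `]-oo, b]%classic `&` D0) ((expR b)%:E * (expR (- 1 * x))%:E))).
  apply: ge0_le_integral => //.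
  - apply: measurable_funeM.
    by apply/measurable_EFinP; apply: measurable_funTS; exact: measurable_expRM.
  - move=> x; rewrite /= in_itv/= => -[xb _].
    by rewrite -EFinM lee_fin -expRD mulN1r -expR0 ler_expR subr_ge0.
apply: ge0_subset_integral => //; apply: measurable_funeM.
by apply/measurable_EFinP; apply: measurable_funTS; exact: measurable_expRM.
Qed.

Variables mu nu : {measure set R -> \bar R}.
Hypotheses (fmu : finite_laplace mu) (fnu : finite_laplace nu).
Hypothesis munu : forall q, (0 < q)%R ->
  \int[mu]_(x in D0) (expR (- q * x))%:E = \int[nu]_(x in D0) (expR (- q * x))%:E.

Let same (h : R -> R) := forall q, (0 < q)%R ->
  \int[mu]_(x in D0) (expR (- q * x) * h x)%:E =
  \int[nu]_(x in D0) (expR (- q * x) * h x)%:E.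

Let same_poly r m : (0 <= r)%R -> same (fun x => (1 - expR (- r * x)) ^+ m)%R.
Proof.
move=> r0; elim: m => [|m IH] q q0.
  by under eq_integral do rewrite expr0 mulr1;
     under [RHS]eq_integral do rewrite expr0 mulr1; exact: munu.
pose g q' x := (expR (- q' * x) * (1 - expR (- r * x)) ^+ m)%R.
have mg : measurable_fun [set: R] (fun x : R => (1 - expR (- r * x)) ^+ m)%R.
  apply: measurable_funX; apply: measurable_funB => //; exact: measurable_expRM.
have g01 x : (0 <= x)%R -> (0 <= (1 - expR (- r * x)) ^+ m <= 1)%R.
  move=> x0; have h : (0 <= 1 - expR (- r * x) <= 1)%R.
    by rewrite subr_ge0 gerBl expR_ge0 -[X in (_ <= X)%R]expR0 ler_expR mulNr oppr_le0 mulr_ge0.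
  by case/andP: h => h0 h1; rewrite exprn_ge0//= exprn_ile1.
have E (m' : {measure set R -> \bar R}) : finite_laplace m' ->
    \int[m']_(x in D0) (expR (- q * x) * (1 - expR (- r * x)) ^+ m.+1)%:E =
    \int[m']_(x in D0) (g q x)%:E - \int[m']_(x in D0) (g (q + r)%R x)%:E.
  move=> fm'; rewrite -integralB_EFin//; last 2 first.
  - exact: finite_laplace_integrable.
  - by apply: finite_laplace_integrable => //; rewrite ltr_pwDl.
  apply: eq_integral => x _; rewrite -EFinB /g opprD mulrDl expRD exprS; congr EFin.
  ring.
by rewrite !E//; congr (_ - _); apply: IH => //; rewrite ltr_pwDl.
Qed.

Let same_lim (h_ : nat -> R -> R) (h : R -> R) :
  (forall n, measurable_fun [set: R] (h_ n)) ->
  (forall n x, (0 <= x)%R -> (0 <= h_ n x <= 1)%R) ->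
  (forall x, (0 <= x)%R -> h_ ^~ x @ \oo --> h x) ->
  (forall n, same (h_ n)) -> same h.
Proof.
move=> mh h01 hh sh q q0.
have L (m' : {measure set R -> \bar R}) : finite_laplace m' ->
    \int[m']_(x in D0) (expR (- q * x) * h_ n x)%:E @[n --> \oo] -->
    \int[m']_(x in D0) (expR (- q * x) * h x)%:E.
  move=> fm'; apply: (@dominated_cvg _ _ _ _ _ mD0 _ _ (fun x => (expR (- q * x))%:E)).
  - move=> n; apply/measurable_EFinP; apply: measurable_funTS.
    by apply: measurable_funM => //; exact: measurable_expRM.
  - move=> x /=; rewrite in_itv/= andbT => x0.
    by apply: cvg_EFin; [exact: nearW|apply: cvgMr; exact: hh].
  - by [].
  - apply: (@eq_integrable _ _ _ _ _ mD0 (fun x => (expR (- q * x) * cst 1 x)%:E)).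
      by move=> x _; rewrite mulr1.
    by apply: finite_laplace_integrable => // x _ /=; rewrite ler01 lexx.
  - move=> n x /=; rewrite in_itv/= andbT => x0.
    have /andP[h0 h1] := h01 n _ x0.
    by rewrite lee_fin ger0_norm ?mulr_ge0 ?expR_ge0// ler_piMr// expR_ge0.
apply: (cvg_unique _ (L _ fmu)) => //.
have := L _ fnu; under [X in X @ _ --> _ -> _]eq_fun do rewrite -sh//.
exact.
Qed.

Let same_tail a : same (fun x => (a < x)%R%:R).
Proof.
have me r : measurable_fun [set: R] (fun x : R => 1 - expR (- r * x))%R.
  by apply: measurable_funB => //; exact: measurable_expRM.
have e01 r x : (0 <= r)%R -> (0 <= x)%R -> (0 <= 1 - expR (- r * x) <= 1)%R.
  move=> r0 x0.
  by rewrite subr_ge0 gerBl expR_ge0 -[X in (_ <= X)%R]expR0 ler_expR mulNr oppr_le0 mulr_ge0.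
have [a0|a0|->] := ltgtP a 0%R.
- move=> q q0.
  have E (m' : {measure set R -> \bar R}) :
    \int[m']_(x in D0) (expR (- q * x) * (a < x)%R%:R)%:E = \int[m']_(x in D0) (expR (- q * x))%:E.
    apply: eq_integral => x; rewrite inE /= in_itv/= andbT => x0.
    by rewrite (lt_le_trans a0 x0) mulr1.
  by rewrite !E; exact: munu.
- pose r := (ln 2 / a)%R; have r0 : (0 < r)%R by rewrite divr_gt0// ln_gt0// ltr1n.
  apply: (@same_lim (fun n x => (1 - expR (- (n.+1%:R * r) * x)) ^+ (n.+1 * 2 ^ n.+1))%R).
  + by move=> n; exact: measurable_funX.
  + move=> n x x0; have /andP[h0 h1] := e01 (n.+1%:R * r)%R x (mulr_ge0 (ler0n _ _) (ltW r0)) x0.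
    by rewrite exprn_ge0//= exprn_ile1.
  + move=> x x0; have -> : (a < x)%R = (expR (- r * x) < 2^-1)%R.
      rewrite -[X in _ = (_ < X)%R]lnK ?posrE ?invr_gt0// ltr_expR lnV ?posrE// mulNr ltrN2.
      by rewrite /r mulrAC ltr_pdivlMr// ltr_pM2l// ln_gt0// ltr1n.
    have -> : (fun n : nat => (1 - expR (- (n.+1%:R * r) * x)) ^+ (n.+1 * 2 ^ n.+1))%R
        = (fun n : nat => (1 - expR (- r * x) ^+ n.+1) ^+ (n.+1 * 2 ^ n.+1))%R.
      by apply/funext => n; rewrite -expRM_natl; congr ((1 - expR _) ^+ _)%R; ring.
    apply: threshold_cvg.
    by rewrite expR_ge0 -[X in (_ <= X)%R]expR0 ler_expR mulNr oppr_le0 mulr_ge0 ?(ltW r0).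
  + by move=> n; apply: same_poly; rewrite mulr_ge0// ltW.
- apply: (@same_lim (fun n x => (1 - expR (- (n.+1%:R) * x)) ^+ 1)%R).
  + by move=> n; exact: measurable_funX.
  + by move=> n x x0; rewrite expr1; apply: e01.
  + move=> x; rewrite le_eqVlt => /predU1P[<-|x0].
      under eq_fun do rewrite mulr0 expR0 subrr expr1.
      by rewrite ltxx; exact: cvg_cst.
    rewrite x0 -[X in _ --> X]subr0.
    under eq_fun do rewrite expr1.
    apply: cvgB; first exact: cvg_cst.
    have -> : (fun n : nat => expR (- n.+1%:R * x)) = (fun n : nat => expR (- x) * expR (- x) ^+ n)%R.
      by apply/funext => n; rewrite -exprS -expRM_natl; congr expR; ring.
    apply: cvg_geometric.
    by rewrite ger0_norm ?expR_ge0// -[X in (_ < X)%R]expR0 ltr_expR oppr_lt0.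
  + by move=> n; apply: same_poly.
Unshelve. all: by end_near. Qed.

Let same_itv a b : (a <= b)%R -> same (fun x => (a < x <= b)%R%:R).
Proof.
move=> ab q q0.
have mt c : measurable_fun [set: R] (fun x : R => (c < x)%R%:R : R).
  rewrite [X in measurable_fun _ X](_ : _ = \1_(`]c, +oo[%classic)); first exact: measurable_indic.
  by apply/funext => x; rewrite indicE mem_setE in_itv/= andbT.
have E (m' : {measure set R -> \bar R}) : finite_laplace m' ->
    \int[m']_(x in D0) (expR (- q * x) * (a < x <= b)%R%:R)%:E =
    \int[m']_(x in D0) (expR (- q * x) * (a < x)%R%:R)%:E -
    \int[m']_(x in D0) (expR (- q * x) * (b < x)%R%:R)%:E.
  move=> fm'; have tail01 (c x : R) : (0 <= x)%R -> (0 <= ((c < x)%R%:R : R) <= 1)%R.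
    by move=> _; case: (c < x)%R; rewrite /= ?lexx ?ler01.
  rewrite -integralB_EFin//; last 2 first.
  - by apply: finite_laplace_integrable => //; exact: tail01.
  - by apply: finite_laplace_integrable => //; exact: tail01.
  apply: eq_integral => x _; rewrite -EFinB -mulrBr; congr (_ * _)%:E.
  have [bx|bx] := ltP b x; last by rewrite andbT subr0.
  by rewrite (le_lt_trans ab bx) subrr.
by rewrite !E// !same_tail.
Qed.

Let same_measure_itv a b : (a <= b)%R ->
  mu (`]a, b]%classic `&` D0) = nu (`]a, b]%classic `&` D0).
Proof.
move=> ab; pose h q (x : R) := (expR (- q * x) * (a < x <= b)%R%:R)%R.
have L (m' : {measure set R -> \bar R}) :
    \int[m']_(x in D0) (h (harmonic n) x)%:E @[n --> \oo] --> m' (`]a, b]%classic `&` D0).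
  have -> : m' (`]a, b]%classic `&` D0) =
      \int[m']_(x in D0) (limn (fun n => (h (harmonic n) x)%:E)).
    rewrite -(integral_indic _ mD0)//; apply: eq_integral => x _.
    apply/esym/cvg_lim => //; apply: cvg_EFin; first exact: nearW.
    rewrite indicE mem_setE in_itv/= -[X in _ --> X]mul1r; apply: cvgMl.
    suff : expR (- harmonic n * x) @[n --> \oo] --> expR (- 0 * x) by rewrite oppr0 mul0r expR0.
    apply: (@cvg_comp _ _ _ (fun n => - harmonic n * x)%R expR _ (nbhs (- 0 * x)%R)); last first.
      exact: continuous_expR.
    by apply: cvgMl; apply: cvgN; exact: cvg_harmonic.
  apply: cvg_monotone_convergence => //.
  - move=> n; apply/measurable_EFinP; apply: measurable_funTS; apply: measurable_funM.
      exact: measurable_expRM.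
    rewrite [X in measurable_fun _ X](_ : _ = \1_(`]a, b]%classic)); first exact: measurable_indic.
    by apply/funext => x; rewrite indicE mem_setE in_itv.
  - by move=> n x _; rewrite lee_fin mulr_ge0// expR_ge0.
  - move=> x; rewrite /= in_itv/= andbT => x0 n m nm.
    rewrite lee_fin ler_wpM2r// ler_expR !mulNr lerN2 ler_wpM2r//.
    by rewrite lef_pV2 ?posrE// ler_nat.
apply: (cvg_unique _ (L mu)) => //.
have -> : (fun n => \int[mu]_(x in D0) (h (harmonic n) x)%:E) =
    (fun n => \int[nu]_(x in D0) (h (harmonic n) x)%:E).
  by apply/funext => n; apply: same_itv => //; exact: harmonic_gt0.
exact: L.
Qed.

(** Combinations of the functions $e^{-qx}$ approximate every
    $e^{-qx}1_{x>a}$ boundedly, through [threshold_cvg]; letting $q$ decrease to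
    $0$ on bounded intervals removes the weight. *)
Lemma laplace_unique A : measurable A -> A `<=` D0 -> mu A = nu A.
Proof.
move=> mA AD0.
suff : mrestr mu mD0 A = mrestr nu mD0 A by rewrite /mrestr (setIidl AD0).
pose G : set (set R) := @ocitv R.
apply: (measure_unique G (fun n => `]- n%:R, n%:R]%classic)%R) => //.
- exact: ocitvI.
- by move=> i; exact: is_ocitv.
- rewrite -subTset => x _ /=; exists (Num.truncn `|x|).+1 => //=; rewrite in_itv/=.
  by have := truncnS_gt `|x|; rewrite ltr_norml => /andP[-> /ltW ->].
- move=> _ [[a b] _ <-] /=; rewrite /mrestr; have [ab|ba] := leP a b.
    exact: same_measure_itv.
  by rewrite set_itv_ge ?bnd_simp -?leNgt ?(ltW ba)// set0I !measure0.
- move=> n; apply: le_lt_trans (finite_laplace_bounded n%:R fmu).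
  rewrite /= /mrestr; apply: le_measure; rewrite ?inE.
  - by apply: measurableI => //; exact: measurable_itv.
  - by apply: measurableI => //; exact: measurable_itv.
  by apply: setSI => x /=; rewrite !in_itv/= => /andP[].
Qed.

End laplace_uniqueness.

(** * Iterated integrals *)

Section indicator.
Context {R : realType}.

Definition indE (b : bool) : \bar R := (b%:R)%:E.

Lemma indE_ge0 b : (0 <= indE b)%E.
Proof. by rewrite lee_fin. Qed.

Lemma indE_le1 b : (indE b <= 1)%E.
Proof. by rewrite lee_fin lern1 leq_b1. Qed.

Lemma indE_and a b : indE (a && b) = (indE a * indE b)%E.
Proof. by case: a; case: b; rewrite /indE /= -EFinM ?mulr1 ?mulr0. Qed.

Lemma measurable_indE d (T : measurableType d) (D : set T) (b : T -> bool) :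
  measurable_fun D b -> measurable_fun D (fun x => indE (b x)).
Proof.
move=> mb; apply/measurable_EFinP.
by apply: (measurableT_comp (f := fun b : bool => b%:R : R)).
Qed.

Lemma integral_indE d (T : measurableType d) (mu : {measure set T -> \bar R})
  (b : T -> bool) : measurable_fun setT b ->
  (\int[mu]_x indE (b x) = mu [set x | b x])%E.
Proof.
move=> mb; rewrite -(setIT [set x | b x]) -integral_indic//; last first.
  by rewrite -[X in measurable X]setTI; exact: mb.
by apply: eq_integral => x _; rewrite indicE mem_setE.
Qed.

End indicator.
Arguments indE {R} b.

Section integration_tools.
Local Open Scope ereal_scope.

Lemma eq_integral_null d (T : measurableType d) (R : realType)
    (mu : {measure set T -> \bar R}) (N : set T) (f g : T -> \bar R) :
  measurable N -> mu N = 0 -> measurable_fun setT f -> measurable_fun setT g ->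
  (forall x, 0 <= f x) -> (forall x, 0 <= g x) ->
  (forall x, ~ N x -> f x = g x) -> \int[mu]_x f x = \int[mu]_x g x.
Proof.
move=> mN N0 mf mg f0 g0 fg; apply: ge0_ae_eq_integral => //.
exists N; split => // x /=; apply: contra_notP => /fg fgx _ //.
Qed.

Context d1 d2 (T1 : measurableType d1) (T2 : measurableType d2) (R : realType).
Variables (m1 : {sigma_finite_measure set T1 -> \bar R})
          (m2 : {sigma_finite_measure set T2 -> \bar R}).

Lemma measurable_integral_snd (f : T1 -> T2 -> \bar R) :
  measurable_fun setT (fun p : T1 * T2 => f p.1 p.2) ->
  (forall x y, 0 <= f x y) -> measurable_fun setT (fun x => \int[m2]_y f x y).
Proof.
move=> mf f0.
exact: (measurable_fun_fubini_tonelli_F (fun p : T1 * T2 => f p.1 p.2) mf (fun p => f0 p.1 p.2)).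
Qed.

Lemma integral_swap (f : T1 -> T2 -> \bar R) :
  measurable_fun setT (fun p : T1 * T2 => f p.1 p.2) ->
  (forall x y, 0 <= f x y) ->
  \int[m1]_x \int[m2]_y f x y = \int[m2]_y \int[m1]_x f x y.
Proof.
move=> mf f0.
exact: (fubini_tonelli (fun p : T1 * T2 => f p.1 p.2) mf (fun p => f0 p.1 p.2)).
Qed.

Lemma integral2D (F G : T1 -> T2 -> \bar R) :
  measurable_fun setT (fun p : T1 * T2 => F p.1 p.2) ->
  measurable_fun setT (fun p : T1 * T2 => G p.1 p.2) ->
  (forall x y, 0 <= F x y) -> (forall x y, 0 <= G x y) ->
  \int[m1]_x \int[m2]_y (F x y + G x y) =
  \int[m1]_x \int[m2]_y F x y + \int[m1]_x \int[m2]_y G x y.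
Proof.
move=> mF mG F0 G0; rewrite -ge0_integralD//.
- apply: eq_integral => z _; rewrite ge0_integralD//.
  + exact: (measurableT_comp mF (pair1_measurable z)).
  + exact: (measurableT_comp mG (pair1_measurable z)).
- by move=> z _; exact: integral_ge0.
- exact: measurable_integral_snd.
- by move=> z _; exact: integral_ge0.
- exact: measurable_integral_snd.
Qed.

Lemma integral2Z (k : R) (F : T1 -> T2 -> \bar R) : (0 <= k)%R ->
  measurable_fun setT (fun p : T1 * T2 => F p.1 p.2) ->
  (forall x y, 0 <= F x y) ->
  \int[m1]_x \int[m2]_y (k%:E * F x y) = k%:E * \int[m1]_x \int[m2]_y F x y.
Proof.
move=> k0 mF F0; rewrite -ge0_integralZl_EFin//.
- apply: eq_integral => z _; rewrite ge0_integralZl_EFin//.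
  exact: (measurableT_comp mF (pair1_measurable z)).
- by move=> z _; exact: integral_ge0.
- exact: measurable_integral_snd.
Qed.

Lemma le_integral2 (F G : T1 -> T2 -> \bar R) :
  measurable_fun setT (fun p : T1 * T2 => F p.1 p.2) ->
  measurable_fun setT (fun p : T1 * T2 => G p.1 p.2) ->
  (forall x y, 0 <= F x y) -> (forall x y, F x y <= G x y) ->
  \int[m1]_x \int[m2]_y F x y <= \int[m1]_x \int[m2]_y G x y.
Proof.
move=> mF mG F0 FG; have G0 x y : 0 <= G x y by exact: le_trans (FG x y).
apply: ge0_le_integral => //.
- by move=> z _; exact: integral_ge0.
- exact: measurable_integral_snd.
- exact: measurable_integral_snd.
move=> z _; apply: ge0_le_integral => //.
- exact: (measurableT_comp mF (pair1_measurable z)).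
- exact: (measurableT_comp mG (pair1_measurable z)).
Qed.

End integration_tools.

Lemma measurable_patch d (T : measurableType d) (R : realType) (D : set T)
    (f : T -> \bar R) :
  measurable D -> measurable_fun setT f -> measurable_fun setT (f \_ D).
Proof. by move=> mD mf; apply/(measurable_restrictT _ mD)/measurable_funTS. Qed.

Section image_measure.
Local Open Scope ereal_scope.
Context d1 d2 (T1 : measurableType d1) (T2 : measurableType d2) (R : realType).
Variables (m : {measure set T1 -> \bar R}) (f : T1 -> T2).

Definition image_measure (mf : measurable_fun setT f) : {measure set T2 -> \bar R} :=
  @Measure.clone _ _ _ (pushforward m f)
    (measure_function_pushforward__canonical__measure_function_Measure m mf).

Lemma integral_image_measure (mf : measurable_fun setT f) (g : T2 -> \bar R) :
  measurable_fun setT g -> (forall y, 0 <= g y) ->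
  \int[image_measure mf]_y g y = \int[m]_x g (f x).
Proof. by move=> mg g0; rewrite ge0_integral_pushforward. Qed.

End image_measure.

Section density.
Local Open Scope ereal_scope.
Context d (T : measurableType d) (R : realType) (mu : {measure set T -> \bar R}).

(** The proofs are arguments so that the measure structure can be attached to
    the name. *)
Definition density (g : T -> \bar R) (_ : measurable_fun setT g)
  (_ : forall x, 0 <= g x) (A : set T) : \bar R := \int[mu]_(x in A) g x.

Variables (g : T -> \bar R) (mg : measurable_fun setT g) (g0 : forall x, 0 <= g x).

Let density0 : density mg g0 set0 = 0. Proof. exact: integral_set0. Qed.

Let density_ge0 A : 0 <= density mg g0 A.
Proof. exact: integral_ge0. Qed.

Let density_sigma_additive : semi_sigma_additive (density mg g0).
Proof.
move=> F mF tF mUF; rewrite /density; apply: cvg_toP.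
  apply: ereal_nondecreasing_is_cvgn => m n mn.
  by apply: lee_sum_nneg_natr => // k _ _; exact: integral_ge0.
by rewrite ge0_integral_bigcup//; exact: measurable_funTS.
Qed.

HB.instance Definition _ := isMeasure.Build _ _ _ (density mg g0)
  density0 density_ge0 density_sigma_additive.

Import HBNNSimple.

Lemma integral_density (f : T -> \bar R) : measurable_fun setT f ->
  (forall x, 0 <= f x) -> \int[density mg g0]_x f x = \int[mu]_x (f x * g x).
Proof.
move=> mf f0; pose f_ := nnsfun_approx measurableT mf.
have f_f x : (f_ n x)%:E @[n --> \oo] --> f x.
  exact: cvg_nnsfun_approx.
have f_nd x m n : (m <= n)%N -> (f_ m x <= f_ n x)%R.
  by move=> mn; exact/lefP/nd_nnsfun_approx.
have f_le x n : (f_ n x)%:E <= f x.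
  rewrite -(cvg_lim _ (f_f x))//; apply: lime_ge.
    by apply/cvg_ex; exists (f x); exact: f_f.
  by exists n => // m /= nm; rewrite lee_fin f_nd.
have fg_fg x : ((f_ n x)%:E * g x) @[n --> \oo] --> f x * g x.
  have [gx|gx] := boolP (g x \is a fin_num); first exact: cvgeMr.
  have -> : g x = +oo by move: (g0 x) gx; case: (g x).
  have [fx|fx] := eqVneq (f x) 0.
    rewrite fx mul0e; rewrite (_ : (fun _ => _) = cst 0); first exact: cvg_cst.
    apply/funext => n; have := f_le x n.
    rewrite fx lee_fin => fn0; have -> : f_ n x = 0%R by apply/le_anti; rewrite fn0/=.
    by rewrite mul0e.
  have fx0 : 0 < f x by rewrite lt0e fx f0.
  rewrite gt0_muley//.
  have [n0 fn0] : exists n, (0 < f_ n x)%R.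
    apply/not_existsP => fn0; move/eqP : fx; apply.
    apply: (cvg_unique _ (f_f x)) => //.
    rewrite (_ : (fun _ => _) = cst 0); first exact: cvg_cst.
    apply/funext => n; congr EFin; apply/le_anti; rewrite fun_ge0 andbT leNgt.
    exact/negP/fn0.
  apply: cvg_near_cst; exists n0 => // n /= n0n.
  by rewrite gt0_muley// lte_fin (lt_le_trans fn0)// f_nd.
have mf_ n : measurable_fun setT (fun x => (f_ n x)%:E) by exact/measurable_EFinP.
transitivity (limn (fun n => \int[density mg g0]_x (f_ n x)%:E)).
  rewrite -monotone_convergence//.
  - by apply: eq_integral => y _; apply/esym/cvg_lim => //; exact: f_f.
  - by move=> n y _; rewrite lee_fin.
  - by move=> y _ m n mn; rewrite lee_fin f_nd.
transitivity (limn (fun n => \int[mu]_x ((f_ n x)%:E * g x))); last first.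
  rewrite -monotone_convergence//.
  - by apply: eq_integral => y _; apply/cvg_lim => //; exact: fg_fg.
  - by move=> n; apply: emeasurable_funM.
  - by move=> n y _; rewrite mule_ge0// lee_fin.
  - by move=> y _ m n mn; rewrite lee_wpmul2r// lee_fin f_nd.
congr (limn _); apply/funext => n.
under [LHS]eq_integral do rewrite fimfunE -fsumEFin//.
rewrite ge0_integral_fsum//; last 2 first.
- by move=> y; exact/measurable_EFinP/measurable_funM.
- by move=> y x _; rewrite nnfun_muleindic_ge0.
under [RHS]eq_integral => x _.
  rewrite fimfunE -fsumEFin// ge0_mule_fsuml; last by move=> r; rewrite nnfun_muleindic_ge0.
  over.
rewrite ge0_integral_fsum//; last 2 first.
- by move=> y; apply: emeasurable_funM => //; exact/measurable_EFinP/measurable_funM.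
- by move=> y x _; rewrite mule_ge0// nnfun_muleindic_ge0.
apply: eq_fsbigr => r _.
rewrite integralZl_indic_nnsfun// integral_indic// setIT.
have [r0|r0] := ltP r 0%R.
  rewrite preimage_nnfun0// measure0 mule0 integral0_eq// => x _.
  by rewrite indic0 mulr0 mul0e.
under eq_integral do rewrite EFinM -muleA.
rewrite ge0_integralZl_EFin//; last 2 first.
- by move=> x _; rewrite mule_ge0// lee_fin.
- by apply: emeasurable_funM => //; exact/measurable_EFinP.
congr (_ * _).
transitivity (\int[mu]_(x in f_ n @^-1` [set r]) g x); first by [].
rewrite integral_mkcond; apply: eq_integral => x _.
rewrite patchE indicE; case: ifP => xA; first by rewrite mul1e.
by rewrite mul0e.
Qed.

End density.

(** * Tails, overshoots and exponential integrals *)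

Section lebesgue_on_reals.
Context {R : realType}.
Local Open Scope ereal_scope.

(** [lebesgue_measure] lives on an alias of [R] with its own display; this
    copy lives on [R] itself, so that products with the other measures on [R]
    share one measurable structure. *)
Definition lebR (A : set R) : \bar R := @lebesgue_measure R A.
Let lebR0 : lebR set0 = 0. Proof. exact: measure0. Qed.
Let lebR_ge0 A : 0 <= lebR A. Proof. exact: measure_ge0. Qed.
Let lebR_sa : semi_sigma_additive lebR.
Proof. exact: (@measure_semi_sigma_additive _ _ _ (@lebesgue_measure R)). Qed.
HB.instance Definition _ := isMeasure.Build _ R R lebR lebR0 lebR_ge0 lebR_sa.
Let lebR_sf : sigma_finite setT lebR.
Proof. exact: (@sigma_finiteT _ _ _ (@lebesgue_measure R)). Qed.
HB.instance Definition _ := Measure_isSigmaFinite.Build _ _ _ lebR lebR_sf.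

Lemma integral_lebR (D : set R) (f : R -> \bar R) : measurable D ->
  measurable_fun D f -> (forall x, D x -> 0 <= f x) ->
  \int[lebR]_(x in D) f x = \int[lebesgue_measure]_(x in D) f x.
Proof.
move=> mD mf f0.
rewrite -(@ge0_integral_pushforward _ _ (measurableTypeR R) R R id) //.
by move=> x; rewrite inE; exact: f0.
Qed.
End lebesgue_on_reals.

Section exponential_integrals.
Context {R : realType}.
Local Open Scope ereal_scope.
Local Notation leb := (@lebesgue_measure R).
Local Notation D0 := (`[0%R, +oo[%classic : set R).
Implicit Types q z w : R.

Lemma derivable_expRM q (x : R) : derivable (fun y : R => expR (q * y)) x 1.
Proof. exact: ex_derive. Qed.

Lemma derive_expRM q (x : R) :
  derive1 (fun y : R => expR (q * y)) x = (q * expR (q * x))%R.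
Proof.
rewrite derive1_comp// derive1E; have /funeqP -> := @derive_expR R.
by rewrite derive1Ml// derive1_id mulr1 mulrC.
Qed.

Lemma continuous_expRM q : continuous (fun y : R => expR (q * y)).
Proof.
move=> z; apply: continuous_comp; last exact: continuous_expR.
by apply: (@continuousM _ R^o) => //; exact: cst_continuous.
Qed.

Lemma integral_expRM_itv q z w : (0 < q)%R -> (z <= w)%R ->
  \int[lebR]_a ((expR (- q * a))%:E * indE (z < a <= w)%R) =
  ((expR (- q * z) - expR (- q * w)) / q)%:E.
Proof.
move=> q0; rewrite integral_lebR//; last 2 first.
- apply: emeasurable_funM.
    by apply/measurable_EFinP; exact: measurable_expRM.
  apply: measurable_indE; apply: measurable_and; first exact: measurable_fun_ltr.
  exact: measurable_fun_ler.
- by move=> a _; rewrite mule_ge0 ?indE_ge0// lee_fin expR_ge0.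
rewrite le_eqVlt => /predU1P[->|zw].
  rewrite subrr mul0r integral0_eq// => a _.
  by have [wa|aw] := ltP w a; rewrite /indE/= mule0.
transitivity (\int[leb]_(a in `[z, w]) (expR (- q * a))%:E).
  rewrite -integral_itv_obnd_cbnd; last first.
    by apply/measurable_EFinP; apply: measurable_funTS; exact: measurable_expRM.
  rewrite [RHS]integral_mkcond; apply: eq_integral => a _.
  by rewrite patchE mem_setE in_itv/=; case: ifP => _; rewrite /indE ?mule1 ?mule0.
rewrite (@continuous_FTC2 _ _ (fun x => - q^-1 * expR (- q * x))%R)//.
- by rewrite -EFinB; congr EFin; field; rewrite gt_eqF.
- by apply: continuous_subspaceT; exact: continuous_expRM.
- split.
  + by move=> x _; apply: derivableM => //; exact: derivable_expRM.
  + by apply: cvg_at_right_filter; apply: cvgMr; exact: continuous_expRM.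
  + by apply: cvg_at_left_filter; apply: cvgMr; exact: continuous_expRM.
- move=> x _; rewrite derive1Ml ?derive_expRM; last exact: derivable_expRM.
  by field; rewrite gt_eqF.
Qed.

Lemma integral_expRM_infty q : (0 < q)%R ->
  \int[lebR]_(a in D0) (expR (- q * a))%:E = (q^-1)%:E.
Proof.
move=> q0; rewrite integral_lebR//; last first.
  by apply: measurable_funTS; apply/measurable_EFinP; exact: measurable_expRM.
have := integral_exponential_pdf q0.
rewrite (_ : \int[leb]_x _ = q%:E * \int[leb]_(a in D0) (expR (- q * a))%:E); last first.
  rewrite -ge0_integralZl_EFin//; last 2 first.
  - by apply/measurable_EFinP; apply: measurable_funTS; exact: measurable_expRM.
  - exact: ltW.
  rewrite [RHS]integral_mkcond; apply: eq_integral => x _.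
  by rewrite /exponential_pdf !patchE; case: ifP => // _; rewrite EFinM.
move=> /(congr1 (fun x => (q^-1)%:E * x)).
by rewrite muleA -EFinM mulVf ?gt_eqF// mul1e mule1.
Qed.

End exponential_integrals.

Section no_creeping.
Context {R : realType} (U Pi : {sigma_finite_measure set R -> \bar R}).
Local Open Scope ereal_scope.
Local Notation leb := (@lebR R).
Local Notation D0 := (`[0%R, +oo[%classic : set R).
Implicit Types (a b u v z y r q : R).

(** The mass of $[r,\infty[$, cut off at $r\le 0$ where it may be infinite. *)
Definition tail r := \int[Pi]_y indE (0 < r <= y)%R.

(** When [U] is the potential measure and [Pi] the Lévy measure of a
    subordinator, the probability that level $a$ is passed by a jump. *)
Definition overshoot a := \int[U]_z tail (a - z)%R.

Lemma measurable_bool_jump : measurable_fun [set: R * R]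
  (fun p => (0 < p.1 <= p.2)%R).
Proof.
by apply: measurable_and; [apply: measurable_fun_ltr|apply: measurable_fun_ler].
Qed.

Lemma tail_ge0 r : 0 <= tail r.
Proof. by apply: integral_ge0 => y _; exact: indE_ge0. Qed.

Lemma measurable_tail : measurable_fun setT tail.
Proof.
apply: (@measurable_integral_snd _ _ _ _ _ Pi (fun r y => indE (0 < r <= y)%R)); last first.
  by move=> r y; exact: indE_ge0.
apply: measurable_indE; exact: measurable_bool_jump.
Qed.

Lemma overshoot_ge0 a : 0 <= overshoot a.
Proof. by apply: integral_ge0 => y _; exact: tail_ge0. Qed.

Lemma measurable_overshoot : measurable_fun setT overshoot.
Proof.
apply: (@measurable_integral_snd _ _ _ _ _ U (fun a z => tail (a - z)%R)); last first.
  by move=> r y; exact: tail_ge0.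
by apply: measurableT_comp; [exact: measurable_tail|exact: measurable_funB].
Qed.

Lemma integral_overshoot (m : {sigma_finite_measure set R -> \bar R})
    (g : R -> \bar R) : measurable_fun setT g -> (forall a, 0 <= g a) ->
  \int[m]_a (g a * overshoot a) =
  \int[U]_z \int[Pi]_y \int[m]_a (g a * indE (z < a <= z + y)%R).
Proof.
move=> mg g0.
have mker (d : measure_display) (T : measurableType d) (A Z Y : T -> R) :
    measurable_fun setT A -> measurable_fun setT Z -> measurable_fun setT Y ->
    measurable_fun setT (fun t => g (A t) * indE (Z t < A t <= Z t + Y t)%R).
  move=> mA mZ mY; apply: emeasurable_funM; first exact: measurableT_comp.
  apply: measurable_indE; apply: measurable_and; first exact: measurable_fun_ltr.
  by apply: measurable_fun_ler => //; exact: measurable_funD.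
have ker0 a z y : 0 <= g a * indE (z < a <= z + y)%R.
  by rewrite mule_ge0// indE_ge0.
transitivity (\int[m]_a \int[U]_z \int[Pi]_y (g a * indE (z < a <= z + y)%R)).
  apply: eq_integral => a _; rewrite -ge0_integralZl//; last 2 first.
  - by apply: measurableT_comp; [exact: measurable_tail|exact: measurable_funB].
  - by move=> z _; exact: tail_ge0.
  apply: eq_integral => z _; rewrite -ge0_integralZl//; last 2 first.
  - apply: measurable_indE; apply: measurable_and => //.
    exact: measurable_fun_ler.
  - by move=> y _; exact: indE_ge0.
  by apply: eq_integral => y _; rewrite subr_gt0 lerBlDl.
rewrite integral_swap//; last 2 first.
- apply: (@measurable_integral_snd _ _ (R * R)%type R R Pi
      (fun p y => g p.1 * indE (p.2 < p.1 <= p.2 + y)%R)) => //=.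
  apply: (mker _ _ (fun t : R * R * R => t.1.1) (fun t => t.1.2) snd) => //.
  + exact: (measurableT_comp measurable_fst measurable_fst).
  + exact: (measurableT_comp measurable_snd measurable_fst).
- by move=> a z; exact: integral_ge0.
apply: eq_integral => z _; rewrite integral_swap//.
exact: (mker _ _ fst (cst z) snd).
Qed.

End no_creeping.

(** * Transform of the overshoot *)

Section no_creeping.
Context {R : realType} (U Pi : {sigma_finite_measure set R -> \bar R}).
Local Open Scope ereal_scope.
Local Notation leb := (@lebR R).
Local Notation D0 := (`[0%R, +oo[%classic : set R).
Implicit Types (a b u v z y r q : R).
Local Notation psi := (overshoot U Pi).
Local Notation N := (tail Pi).

Hypothesis U0 : U `]-oo, 0%R[%classic = 0.
Hypothesis Pi0 : Pi `]-oo, 0%R]%classic = 0.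

(** Two nonnegative functions of a position $z$ and a jump $y$ have the same
    integral as soon as they agree for $z\ge 0$ and $y>0$. *)
Lemma eq_integral_jump (F G : R -> R -> \bar R) :
  measurable_fun setT (fun p : R * R => F p.1 p.2) ->
  measurable_fun setT (fun p : R * R => G p.1 p.2) ->
  (forall z y, 0 <= F z y) -> (forall z y, 0 <= G z y) ->
  (forall z y, (0 <= z)%R -> (0 < y)%R -> F z y = G z y) ->
  \int[U]_z \int[Pi]_y F z y = \int[U]_z \int[Pi]_y G z y.
Proof.
move=> mF mG F0 G0 FG.
apply: (eq_integral_null _ U0) => //.
- exact: measurable_integral_snd.
- exact: measurable_integral_snd.
- by move=> z; exact: integral_ge0.
- by move=> z; exact: integral_ge0.
move=> z /= /negP; rewrite in_itv/= -leNgt => z0.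
apply: (eq_integral_null _ Pi0) => //.
- exact: (measurableT_comp mF (pair1_measurable z)).
- exact: (measurableT_comp mG (pair1_measurable z)).
move=> y /= /negP; rewrite in_itv/= -ltNge => y0; exact: FG.
Qed.

Definition laplace q := \int[U]_z (expR (- q * z))%:E.

Definition laplace_exponent q := \int[Pi]_y (1 - expR (- q * Num.max y 0))%:E.

Local Notation ell := laplace.
Local Notation Phi := laplace_exponent.

Hypothesis laplace_inv : forall q, (0 < q)%R -> ell q * Phi q = 1.

Lemma measurable_expRMe d (T : measurableType d) (f : T -> R) q :
  measurable_fun setT f -> measurable_fun setT (fun x => (expR (q * f x))%:E).
Proof.
move=> mf; apply/measurable_EFinP.
by apply: (measurableT_comp (measurable_expRM q)).
Qed.

Lemma exponent_integrand_ge0 q y : (0 < q)%R -> (0 <= 1 - expR (- q * Num.max y 0))%R.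
Proof.
move=> q0; rewrite subr_ge0 -[X in (_ <= X)%R]expR0 ler_expR mulNr oppr_le0.
by rewrite mulr_ge0 ?(ltW q0)// le_max lexx orbT.
Qed.

Lemma measurable_exponent_integrand d (T : measurableType d) (f : T -> R) q :
  measurable_fun setT f ->
  measurable_fun setT (fun x => (1 - expR (- q * Num.max (f x) 0))%:E).
Proof.
move=> mf; apply/measurable_EFinP; apply: measurable_funB => //.
apply: (measurableT_comp (measurable_expRM (- q))).
by apply: measurable_maxr => //; exact: measurable_cst.
Qed.

Lemma laplace_fin q : (0 < q)%R -> ell q \is a fin_num /\ Phi q \is a fin_num.
Proof.
move=> q0; have l0 : 0 <= ell q by apply: integral_ge0 => z _; rewrite lee_fin expR_ge0.
have p0 : 0 <= Phi q by apply: integral_ge0 => z _; rewrite lee_fin exponent_integrand_ge0.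
have := laplace_inv q0; move: (ell q) (Phi q) l0 p0 => [l| |] [p| |]//.
- rewrite lee_fin le_eqVlt => /predU1P[<-|l0] _; first by rewrite mul0e => /eqP; rewrite eqe eq_sym oner_eq0.
  by rewrite gt0_muley.
- rewrite lee_fin => _; rewrite le_eqVlt => /predU1P[<-|l0]; first by rewrite mule0 => /eqP; rewrite eqe eq_sym oner_eq0.
  by rewrite gt0_mulye.
Qed.

Lemma laplaceE q : ell q = \int[U]_(z in D0) (expR (- q * z))%:E.
Proof.
rewrite [RHS]integral_mkcond; apply: (eq_integral_null _ U0) => //.
- exact: measurable_expRMe.
- by apply: measurable_patch => //; exact: measurable_expRMe.
- by move=> x; rewrite patchE; case: ifP => // _; rewrite lee_fin expR_ge0.
- move=> z /= /negP; rewrite in_itv/= -leNgt => z0.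
  by rewrite patchE mem_setE in_itv/= z0.
Qed.

Lemma tail_noninc r r' : (0 < r)%R -> (r <= r')%R -> N r' <= N r.
Proof.
move=> r0 rr'; apply: ge0_le_integral => //.
- by move=> y _; exact: indE_ge0.
- by apply: measurable_indE; apply: measurable_and => //; exact: measurable_fun_ler.
- by apply: measurable_indE; apply: measurable_and => //; exact: measurable_fun_ler.
- move=> y _; have [r'y|_] := leP r' y; last by rewrite andbF indE_ge0.
  by rewrite r0 (le_trans rr' r'y)/= indE_le1.
Qed.

Lemma tail_le0 r : (r <= 0)%R -> N r = 0.
Proof.
by move=> r0; apply: integral0_eq => y _; rewrite ltNge r0.
Qed.

Lemma overshoot_le0 a : (a <= 0)%R -> psi a = 0.
Proof.
move=> a0; rewrite -[RHS](integral0 U setT); apply: (eq_integral_null _ U0) => //.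
- by apply: measurableT_comp; [exact: measurable_tail|exact: measurable_funB].
- by move=> x; exact: tail_ge0.
- move=> z /= /negP; rewrite in_itv/= -leNgt => z0.
  by rewrite tail_le0// subr_le0 (le_trans a0).
Qed.

Lemma integral_exponent_prod q (c : R) : (0 < q)%R -> (0 <= c)%R ->
  \int[U]_z \int[Pi]_y (c * (expR (- q * z) * (1 - expR (- q * Num.max y 0))))%:E
  = c%:E.
Proof.
move=> q0 c0; under eq_integral => z _.
  under eq_integral do rewrite mulrA EFinM.
  rewrite ge0_integralZl_EFin ?mulr_ge0 ?expR_ge0//; last 2 first.
  - by move=> y _; rewrite lee_fin exponent_integrand_ge0.
  - by apply: measurable_exponent_integrand.
  rewrite -/(Phi q) EFinM -muleA.
  over.
rewrite ge0_integralZl_EFin//; last 2 first.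
- move=> z _; rewrite mule_ge0 ?lee_fin ?expR_ge0//; apply: integral_ge0 => y _.
  by rewrite lee_fin exponent_integrand_ge0.
- by apply: emeasurable_funM; [exact: measurable_expRMe|exact: measurable_cst].
rewrite ge0_integralZr//.
- by rewrite laplace_inv// mule1.
- exact: measurable_expRMe.
- by apply: integral_ge0 => y _; rewrite lee_fin exponent_integrand_ge0.
Qed.

(** By Fubini's theorem the transform of [overshoot] is the product of
    [laplace] and [laplace_exponent], divided by $q$; the product is $1$. *)
Lemma laplace_overshoot q : (0 < q)%R ->
  \int[leb]_a (indE (0 <= a)%R * (expR (- q * a))%:E * psi a) = (q^-1)%:E.
Proof.
move=> q0; have mg : measurable_fun setT (fun a : R => indE (0 <= a)%R * (expR (- q * a))%:E).
  apply: emeasurable_funM; last exact: measurable_expRMe.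
  by apply: measurable_indE; exact: measurable_fun_ler.
have g0 a : 0 <= indE (0 <= a)%R * (expR (- q * a))%:E.
  by rewrite mule_ge0 ?indE_ge0// lee_fin expR_ge0.
rewrite (@integral_overshoot _ U Pi leb _ mg g0).
rewrite -[RHS](@integral_exponent_prod q)// ?invr_ge0 ?ltW//.
apply: (@eq_integral_jump (fun z y => \int[leb]_a
    (indE (0 <= a)%R * (expR (- q * a))%:E * indE (z < a <= z + y)%R))).
- apply: (@measurable_integral_snd _ _ (R * R)%type R R leb (fun p a =>
    indE (0 <= a)%R * (expR (- q * a))%:E * indE (p.1 < a <= p.1 + p.2)%R)) => /=.
    apply: emeasurable_funM.
      exact: (measurableT_comp mg measurable_snd).
    apply: measurable_indE; apply: measurable_and.
      apply: measurable_fun_ltr => //.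
      exact: (measurableT_comp measurable_fst measurable_fst).
    apply: measurable_fun_ler => //; apply: measurable_funD.
      exact: (measurableT_comp measurable_fst measurable_fst).
    exact: (measurableT_comp measurable_snd measurable_fst).
  by move=> p a; rewrite !mule_ge0 ?indE_ge0// lee_fin expR_ge0.
- apply/measurable_EFinP; apply: measurable_funM => //; apply: measurable_funM.
    by apply: (measurableT_comp (measurable_expRM (- q))).
  by apply/measurable_EFinP; exact: measurable_exponent_integrand.
- by move=> z y; apply: integral_ge0 => a _; rewrite !mule_ge0 ?indE_ge0// lee_fin expR_ge0.
- by move=> z y; rewrite lee_fin !mulr_ge0 ?invr_ge0 ?expR_ge0 ?(ltW q0)// exponent_integrand_ge0.
- move=> z y z0 y0.
  rewrite (_ : \int[leb]_a _ = \int[leb]_a ((expR (- q * a))%:E * indE (z < a <= z + y)%R)).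
    rewrite integral_expRM_itv//; last by rewrite lerDl ltW.
    by rewrite max_l ?ltW// mulrDr expRD; congr EFin; ring.
  apply: eq_integral => a _; have [za|az] := ltP z a; last by rewrite !mule0.
  by rewrite (le_trans z0 (ltW za)) mul1e.
Qed.

(** [overshoot] has the Laplace transform $1/q$ of the constant $1$; it thus
    equals $1$ almost everywhere, and what remains is to reach every level. *)
Lemma overshoot_integral_lebesgue A : measurable A -> A `<=` D0 ->
  \int[leb]_(a in A) psi a = leb A.
Proof.
move=> mA AD0; pose nu := density leb (measurable_overshoot U Pi) (overshoot_ge0 U Pi).
have nuE q : (0 < q)%R -> \int[nu]_(x in D0) (expR (- q * x))%:E = (q^-1)%:E.
  move=> q0; rewrite integral_mkcond integral_density//.
  - rewrite -laplace_overshoot//; apply: eq_integral => a _; congr (_ * _).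
    by rewrite patchE mem_setE in_itv/= andbT; case: ifP => _; rewrite ?mul1e ?mul0e.
  - by apply: measurable_patch => //; exact: measurable_expRMe.
  - by move=> x; rewrite patchE; case: ifP => // _; rewrite lee_fin expR_ge0.
apply/esym; apply: (@laplace_unique _ leb nu) => //.
- by move=> q q0; rewrite integral_expRM_infty// ltry.
- by move=> q q0; rewrite nuE// ltry.
- by move=> q q0; rewrite integral_expRM_infty// nuE.
Qed.

Lemma overshoot_integral_fun (f : R -> \bar R) : measurable_fun setT f ->
  (forall a, 0 <= f a) ->
  \int[leb]_(a in D0) (f a * psi a) = \int[leb]_(a in D0) f a.
Proof.
move=> mf f0; pose nu := density leb (measurable_overshoot U Pi) (overshoot_ge0 U Pi).
transitivity (\int[nu]_(a in D0) f a).
  rewrite [RHS]integral_mkcond integral_density.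
  - rewrite [LHS]integral_mkcond; apply: eq_integral => a _.
    by rewrite !patchE; case: ifP => // _; rewrite mul0e.
  - exact: measurable_patch.
  - by move=> a; rewrite patchE; case: ifP.
by apply: eq_measure_integral => A mA AD0; exact: overshoot_integral_lebesgue.
Qed.

End no_creeping.

Section renewal.
Context {R : realType} (U Pi : {sigma_finite_measure set R -> \bar R}).
Local Open Scope ereal_scope.
Local Notation leb := (@lebR R).
Local Notation D0 := (`[0%R, +oo[%classic : set R).
Implicit Types (a b c u v z y r q : R).
Local Notation psi := (overshoot U Pi).
Local Notation N := (tail Pi).
Local Notation ell := (laplace U).
Local Notation Phi := (laplace_exponent Pi).

Hypothesis U0 : U `]-oo, 0%R[%classic = 0.
Hypothesis Pi0 : Pi `]-oo, 0%R]%classic = 0.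
Hypothesis laplace_inv : forall q, (0 < q)%R -> ell q * Phi q = 1.

Definition overshoot_below b a := \int[U]_z (indE (z < b)%R * N (a - z)).

Let mN d (T : measurableType d) (f : T -> R) : measurable_fun setT f ->
  measurable_fun setT (fun x => N (f x)).
Proof. by move=> mf; apply: measurableT_comp => //; exact: measurable_tail. Qed.

Let mpart b a : measurable_fun setT (fun z : R => indE (z < b)%R * N (a - z)).
Proof.
apply: emeasurable_funM; first by apply: measurable_indE; exact: measurable_fun_ltr.
by apply: mN; exact: measurable_funB.
Qed.

Let part_ge0 b a z : 0 <= indE (z < b)%R * N (a - z).
Proof. by rewrite mule_ge0 ?indE_ge0 ?tail_ge0. Qed.

Lemma overshoot_below_le b a' a : (b <= a')%R -> (a' <= a)%R ->
  overshoot_below b a <= psi a'.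
Proof.
move=> ba' a'a; apply: ge0_le_integral => //.
- by apply: mN; exact: measurable_funB.
- move=> z _; have [zb|_] := ltP z b; last by rewrite mul0e tail_ge0.
  by rewrite mul1e tail_noninc// ?subr_gt0 ?(lt_le_trans zb)// lerB.
Qed.

Lemma overshoot_below_cvg a : overshoot_below (a - harmonic n)%R a @[n --> \oo] --> psi a.
Proof.
have -> : psi a = \int[U]_z limn (fun n => indE (z < a - harmonic n)%R * N (a - z)).
  apply: eq_integral => z _; apply/esym/cvg_lim => //.
  have [za|az] := ltP z a.
    apply: cvg_near_cst; near=> n.
    rewrite ltrBrDl -ltrBrDr (_ : (_ < _)%R) ?mul1e//.
    near: n; apply: (cvgr_lt 0); first exact: cvg_harmonic.
    by rewrite subr_gt0.
  rewrite tail_le0 ?subr_le0//; under eq_fun do rewrite mule0.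
  exact: cvg_cst.
apply: cvg_monotone_convergence => // z _ n m nm.
rewrite lee_wpmul2r ?tail_ge0// lee_fin ler_nat.
have [zn|//] := ltP z (a - harmonic n)%R.
rewrite (lt_le_trans zn)// lerB// lef_pV2 ?posrE// ler_nat//.
Unshelve. all: by end_near. Qed.

(** [overshoot] is lower semicontinuous from the left, because the tail of
    [Pi] is nonincreasing. *)
Lemma overshoot_lsc (c : \bar R) a :
  (forall b, (b < a)%R -> exists a', (b <= a' <= a)%R /\ psi a' <= c) ->
  psi a <= c.
Proof.
move=> H; rewrite -(cvg_lim _ (@overshoot_below_cvg a))//; apply: lime_le.
  by apply/cvg_ex; exists (psi a); exact: overshoot_below_cvg.
apply: nearW => n; have [|a' [/andP[ba' a'a] pa']] := H (a - harmonic n)%R.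
  by rewrite ltrBlDr ltrDl harmonic_gt0.
by apply: le_trans pa'; exact: overshoot_below_le.
Qed.

Lemma overshoot_itv a b : (0 <= b)%R -> (b <= a)%R ->
  \int[leb]_(x in `[b, a]) psi x = (a - b)%:E.
Proof.
move=> b0 ba; rewrite overshoot_integral_lebesgue//.
  by rewrite /lebR lebesgue_measure_itv/= lte_fin; case: ltgtP ba => // -> _; rewrite subrr.
by move=> x /=; rewrite !in_itv/= andbT => /andP[bx _]; exact: le_trans bx.
Qed.

(** On an interval where it exceeded $c>1$, [overshoot] would have a mean
    larger than $1$, against [overshoot_itv]. *)
Lemma overshoot_small c a b : (0 <= b)%R -> (b < a)%R -> (1 < c)%R ->
  exists a', (b <= a' <= a)%R /\ psi a' <= c%:E.
Proof.
move=> b0 ba c1; apply/not_existsP => H.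
have : \int[leb]_(x in `[b, a]) c%:E <= \int[leb]_(x in `[b, a]) psi x.
  apply: ge0_le_integral => //.
  - by move=> x _; rewrite lee_fin (le_trans ler01)// ltW.
  - by apply: measurable_funTS; exact: measurable_overshoot.
  - move=> x; rewrite /= in_itv/= => bxa; apply: ltW; rewrite ltNge.
    by apply/negP => px; apply: (H x).
rewrite overshoot_itv//; last exact: ltW.
have E : lebR `[b, a]%classic = (a - b)%:E.
  by rewrite /lebR lebesgue_measure_itv/= lte_fin ba.
rewrite integral_cst//= E -EFinM lee_fin.
by rewrite ger_pMl ?subr_gt0// leNgt c1.
Qed.

Lemma overshoot_le1 a : psi a <= 1.
Proof.
have [a0|a0] := leP a 0%R; first by rewrite (overshoot_le0 _ U0).
apply/lee_addgt0Pr => e e0; apply: overshoot_lsc => b ba.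
have [|||a' [/andP[ba' a'a] pa']] := @overshoot_small (1 + e)%R a (Num.max b 0%R).
- by rewrite le_max lexx orbT.
- by rewrite gt_max ba.
- by rewrite ltrDl.
exists a'; split; last by rewrite -EFinD.
by rewrite a'a (le_trans _ ba')// le_max lexx.
Qed.

End renewal.

(** * The renewal equation *)

Section renewal_equation.
Context {R : realType} (U Pi : {sigma_finite_measure set R -> \bar R}).
Local Open Scope ereal_scope.
Local Notation leb := (@lebR R).
Local Notation D0 := (`[0%R, +oo[%classic : set R).
Implicit Types (a b c u v z y r q w : R).
Local Notation psi := (overshoot U Pi).
Local Notation N := (tail Pi).
Local Notation ell := (laplace U).
Local Notation Phi := (laplace_exponent Pi).

Hypothesis U0 : U `]-oo, 0%R[%classic = 0.
Hypothesis Pi0 : Pi `]-oo, 0%R]%classic = 0.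
Hypothesis laplace_inv : forall q, (0 < q)%R -> ell q * Phi q = 1.

Variable u : R.
Hypothesis u0 : (0 < u)%R.

(** The probability that level $u$ is passed continuously. *)
Definition creep : R := (1 - fine (psi u))%R.

Lemma overshoot_fin a : psi a \is a fin_num.
Proof.
rewrite ge0_fin_numE ?overshoot_ge0//; apply: (@le_lt_trans _ _ 1) (ltry _).
exact: overshoot_le1.
Qed.

Lemma creep_ge0 : (0 <= creep)%R.
Proof.
by rewrite /creep subr_ge0 -lee_fin fineK ?overshoot_fin// overshoot_le1.
Qed.

Lemma creepE : psi u + creep%:E = 1.
Proof. by rewrite /creep -[psi u]fineK ?overshoot_fin//= -EFinD addrC subrK. Qed.

Let straddle (t : R * R) : \bar R := indE (t.1 < u <= t.1 + t.2)%R.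

Lemma measurable_straddle : measurable_fun [set: R * R] straddle.
Proof.
apply: measurable_indE; apply: measurable_and; first exact: measurable_fun_ltr.
by apply: measurable_fun_ler => //; exact: measurable_funD.
Qed.

Let straddle_ge0 t : 0 <= straddle t. Proof. exact: indE_ge0. Qed.

Let add2 (t : R * R) : R := (t.1 + t.2)%R.
Let madd2 : measurable_fun setT add2. Proof. exact: measurable_funD. Qed.

(** The law of the position after the passage above [u]: the passage occurs
    continuously with weight [creep], or by a jump. *)
Definition passage_law : set R -> \bar R := measure_add
  (mscale (NngNum creep_ge0) (dirac u))
  (image_measure (density (U \x Pi) measurable_straddle straddle_ge0) madd2).

HB.instance Definition _ := Measure.on passage_law.

Lemma integral_passage_law (f : R -> \bar R) : measurable_fun setT f ->
  (forall x, 0 <= f x) ->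
  \int[passage_law]_x f x = creep%:E * f u +
    \int[U]_z \int[Pi]_y (f (z + y)%R * indE (z < u <= z + y)%R).
Proof.
move=> mf f0; rewrite /passage_law ge0_integral_measure_add//; congr (_ + _).
  by rewrite ge0_integral_mscale// integral_dirac// diracT mul1e.
rewrite integral_image_measure// integral_density//; last first.
  exact: measurableT_comp.
rewrite (fubini_tonelli1 (fun t : R * R => f (add2 t) * straddle t))//.
  by apply: emeasurable_funM; [exact: measurableT_comp|exact: measurable_straddle].
by move=> t; rewrite mule_ge0.
Qed.

Lemma overshootE a : psi a = \int[U]_z \int[Pi]_y indE (z < a <= z + y)%R.
Proof.
apply: eq_integral => z _; apply: eq_integral => y _.
by rewrite subr_gt0 lerBlDl.
Qed.

Lemma passage_law_setT : passage_law setT = 1.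
Proof.
rewrite -[LHS](mul1e) -(integral_cst passage_law measurableT).
rewrite integral_passage_law//= mule1 addeC -[RHS]creepE overshootE; congr (_ + _).
by apply: eq_integral => z _; apply: eq_integral => y _; rewrite mul1e.
Qed.

Let passage_law_fin : fin_num_fun passage_law.
Proof.
move=> A mA; rewrite ge0_fin_numE ?measure_ge0//.
apply: (@le_lt_trans _ _ (passage_law setT)); last by rewrite passage_law_setT ltry.
by apply: le_measure; rewrite ?inE.
Qed.

HB.instance Definition _ := @Measure_isFinite.Build _ _ _ passage_law passage_law_fin.

Let mstraddle (f : R -> \bar R) : measurable_fun setT f ->
  measurable_fun setT (fun t : R * R => f (t.1 + t.2)%R * indE (t.1 < u <= t.1 + t.2)%R).
Proof.
move=> mf; apply: emeasurable_funM; last exact: measurable_straddle.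
exact: measurableT_comp.
Qed.

Let jump_laplace q := \int[U]_z \int[Pi]_y
  ((expR (- q * (z + y)))%:E * indE (z < u <= z + y)%R).

Let before_laplace q := \int[U]_z ((expR (- q * z))%:E * indE (z < u)%R).

Let after_laplace q := \int[U]_z ((expR (- q * z))%:E * indE (u <= z)%R).

Let expe_ge0 q x : 0 <= (expR (- q * x))%:E.
Proof. by rewrite lee_fin expR_ge0. Qed.

Let mexp q : measurable_fun setT (fun x : R => (expR (- q * x))%:E).
Proof. exact: measurable_expRMe. Qed.

Let mbefore q : measurable_fun setT (fun z : R => (expR (- q * z))%:E * indE (z < u)%R).
Proof. by apply: emeasurable_funM => //; apply: measurable_indE; exact: measurable_fun_ltr. Qed.

Let mafter q : measurable_fun setT (fun z : R => (expR (- q * z))%:E * indE (u <= z)%R).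
Proof. by apply: emeasurable_funM => //; apply: measurable_indE; exact: measurable_fun_ler. Qed.

Let before_after q : before_laplace q + after_laplace q = ell q.
Proof.
rewrite -ge0_integralD//; last 2 first.
- by move=> z _; rewrite mule_ge0 ?indE_ge0.
- by move=> z _; rewrite mule_ge0 ?indE_ge0.
apply: eq_integral => z _; rewrite -ge0_muleDr ?indE_ge0//.
by have [zu|uz] := ltP z u; rewrite /indE/= ?adde0 ?add0e mule1.
Qed.

Let integral_overshoot_exp q : (0 < q)%R ->
  \int[leb]_a (((expR (- q * a))%:E * indE (0 < a <= u)%R) * psi a) =
  ((1 - expR (- q * u)) / q)%:E.
Proof.
move=> q0.
have mg : measurable_fun setT (fun a : R => (expR (- q * a))%:E * indE (0 < a <= u)%R).
  apply: emeasurable_funM => //; apply: measurable_indE; apply: measurable_and.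
    exact: measurable_fun_ltr.
  exact: measurable_fun_ler.
have g0 a : 0 <= (expR (- q * a))%:E * indE (0 < a <= u)%R.
  by rewrite mule_ge0 ?indE_ge0.
have onD0 (h : R -> \bar R) :
    \int[leb]_(a in D0) ((expR (- q * a))%:E * indE (0 < a <= u)%R * h a) =
    \int[leb]_a ((expR (- q * a))%:E * indE (0 < a <= u)%R * h a).
  rewrite integral_mkcond; apply: eq_integral => a _.
  rewrite patchE mem_setE in_itv/= andbT; have [//|a0] := leP 0%R a.
  by rewrite ltNge (ltW a0)/= mule0 mul0e.
rewrite -onD0 overshoot_integral_fun//.
under eq_integral do rewrite -[_ * indE _]mule1.
rewrite (onD0 (cst 1)).
under eq_integral do rewrite mule1.
by rewrite integral_expRM_itv ?(ltW u0)// mulr0 expR0.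
Qed.

Let before_exponent q : (0 < q)%R -> before_laplace q * Phi q =
  \int[U]_z \int[Pi]_y ((expR (- q * z))%:E * indE (z < u)%R *
                        (1 - expR (- q * Num.max y 0))%:E).
Proof.
move=> q0; rewrite -ge0_integralZr//.
- apply: eq_integral => z _; rewrite ge0_integralZl//.
  + by apply: measurable_exponent_integrand.
  + by move=> y _; rewrite lee_fin exponent_integrand_ge0.
  + by rewrite mule_ge0 ?indE_ge0.
- by move=> z _; rewrite mule_ge0 ?indE_ge0.
- by apply: integral_ge0 => y _; rewrite lee_fin exponent_integrand_ge0.
Qed.

Let balance q : (0 < q)%R ->
  before_laplace q * Phi q + jump_laplace q + (creep * expR (- q * u))%:E = 1.
Proof.
move=> q0.
pose F1 z y := (expR (- q * z))%:E * indE (z < u)%R * (1 - expR (- q * Num.max y 0))%:E.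
pose F2 z y := (expR (- q * (z + y)))%:E * indE (z < u <= z + y)%R.
pose F3 z y := \int[leb]_a ((expR (- q * a))%:E * indE (0 < a <= u)%R *
  indE (z < a <= z + y)%R).
pose F4 z y : \bar R := indE (z < u <= z + y)%R.
have mg : measurable_fun setT (fun a : R => (expR (- q * a))%:E * indE (0 < a <= u)%R).
  apply: emeasurable_funM => //; apply: measurable_indE; apply: measurable_and.
    exact: measurable_fun_ltr.
  exact: measurable_fun_ler.
have mF1 : measurable_fun setT (fun p : R * R => F1 p.1 p.2).
  apply: emeasurable_funM; first exact: (measurableT_comp (mbefore q) measurable_fst).
  by apply: measurable_exponent_integrand.
have mF2 : measurable_fun setT (fun p : R * R => F2 p.1 p.2).
  exact: (mstraddle (mexp q)).
have mF3 : measurable_fun setT (fun p : R * R => F3 p.1 p.2).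
  apply: (@measurable_integral_snd _ _ (R * R)%type R R leb (fun p a =>
    (expR (- q * a))%:E * indE (0 < a <= u)%R * indE (p.1 < a <= p.1 + p.2)%R)).
    apply: emeasurable_funM; first exact: (measurableT_comp mg measurable_snd).
    apply: measurable_indE; apply: measurable_and.
      apply: measurable_fun_ltr => //.
      exact: (measurableT_comp measurable_fst measurable_fst).
    apply: measurable_fun_ler => //; apply: measurable_funD.
      exact: (measurableT_comp measurable_fst measurable_fst).
    exact: (measurableT_comp measurable_snd measurable_fst).
  by move=> p a; rewrite !mule_ge0 ?indE_ge0.
have mF4 : measurable_fun setT (fun p : R * R => F4 p.1 p.2) by exact: measurable_straddle.
have F10 z y : 0 <= F1 z y.
  by rewrite !mule_ge0 ?indE_ge0// lee_fin exponent_integrand_ge0.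
have F20 z y : 0 <= F2 z y by rewrite mule_ge0 ?indE_ge0.
have F30 z y : 0 <= F3 z y.
  by apply: integral_ge0 => a _; rewrite !mule_ge0 ?indE_ge0.
have F40 z y : 0 <= F4 z y by exact: indE_ge0.
have F3E z y : (0 <= z)%R -> (0 < y)%R -> F3 z y =
    indE (z < u)%R * ((expR (- q * z) - expR (- q * Num.min u (z + y)%R)) / q)%:E.
  move=> z0 y0; rewrite /F3; have [zu|uz] := ltP z u.
    rewrite mul1e -integral_expRM_itv//; last by rewrite le_min ltW//= lerDl ltW.
    apply: eq_integral => a _; rewrite -muleA -indE_and le_min.
    have [za|] := ltP z a; last by rewrite andbF.
    by rewrite (le_lt_trans z0 za).
  rewrite mul0e integral0_eq// => a _; rewrite -muleA -indE_and.
  have [za|] := ltP z a; last by rewrite andbF mule0.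
  by rewrite [(a <= u)%R]leNgt (le_lt_trans uz za) andbF mule0.
rewrite before_exponent// -/(jump_laplace q) -[\int[U]_z _ + _]integral2D//.
rewrite (@eq_integral_jump _ U Pi U0 Pi0 (fun z y => F1 z y + F2 z y)
  (fun z y => q%:E * F3 z y + (expR (- q * u))%:E * F4 z y)); first last.
- move=> z y z0 y0; rewrite F3E// /F1 /F2 /F4 max_l ?(ltW y0)//.
  have [zu|uz] := ltP z u; last by rewrite !mule0 !mul0e !mule0.
  rewrite mulrDr expRD /=; have [uzy|zyu] := leP u (z + y)%R.
    rewrite /indE/= !mule1 mul1e -!EFinM -!EFinD; congr EFin.
    by rewrite ?mulrDr ?expRD; field; rewrite gt_eqF.
  rewrite /indE/= !mule1 !mule0 !adde0 mul1e -!EFinM; congr EFin.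
  by rewrite ?mulrDr ?expRD; field; rewrite gt_eqF.
- by move=> z y; rewrite adde_ge0// mule_ge0// lee_fin ltW.
- by move=> z y; rewrite adde_ge0.
- by apply: emeasurable_funD; apply: emeasurable_funM.
- exact: emeasurable_funD.
rewrite integral2D//; last 4 first.
- exact: emeasurable_funM.
- exact: emeasurable_funM.
- by move=> z y; rewrite mule_ge0// lee_fin ltW.
- by move=> z y; rewrite mule_ge0.
rewrite !integral2Z ?expR_ge0 ?(ltW q0)// -overshootE -integral_overshoot//; last first.
  by move=> a; rewrite mule_ge0 ?indE_ge0.
rewrite integral_overshoot_exp// -EFinM mulrC divfK ?gt_eqF//.
rewrite -[psi u]fineK ?overshoot_fin// -EFinM -!EFinD; congr EFin.
by rewrite /creep; ring.
Qed.

Let after_laplaceE q : (0 < q)%R ->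
  after_laplace q = ell q * ((creep * expR (- q * u))%:E + jump_laplace q).
Proof.
move=> q0; have [lf pf] := laplace_fin laplace_inv q0.
have bp0 : 0 <= before_laplace q.
  by apply: integral_ge0 => z _; rewrite mule_ge0 ?indE_ge0.
have ap0 : 0 <= after_laplace q.
  by apply: integral_ge0 => z _; rewrite mule_ge0 ?indE_ge0.
have bf : before_laplace q \is a fin_num.
  rewrite ge0_fin_numE// (@le_lt_trans _ _ (ell q))//; last by rewrite ltey_eq lf.
  by rewrite -before_after leeDl.
have E : after_laplace q * Phi q = (creep * expR (- q * u))%:E + jump_laplace q.
  have H : after_laplace q * Phi q + before_laplace q * Phi q =
      (creep * expR (- q * u))%:E + jump_laplace q + before_laplace q * Phi q; last first.
    by rewrite -[LHS](@addeK _ (before_laplace q * Phi q)) ?fin_numM// H addeK ?fin_numM.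
  rewrite [LHS]addeC -ge0_muleDl// before_after laplace_inv// -(balance q0).
  by rewrite [RHS]addeC [RHS]addeA [RHS]addeAC.
by rewrite -E muleCA laplace_inv// mule1.
Qed.

Let mabove : measurable_fun [set: R] (fun z : R => indE (u <= z)%R : \bar R).
Proof. by apply: measurable_indE; exact: measurable_fun_ler. Qed.

Let above_ge0 (z : R) : 0 <= (indE (u <= z)%R : \bar R).
Proof. exact: indE_ge0. Qed.

Let after : {measure set R -> \bar R} := density U mabove above_ge0.

Let renewed : {measure set R -> \bar R} := image_measure (passage_law \x U) madd2.

Let integral_renewed (f : R -> \bar R) : measurable_fun setT f ->
  (forall x, 0 <= f x) ->
  \int[renewed]_x f x = \int[passage_law]_h \int[U]_w f (h + w)%R.
Proof.
move=> mf f0; rewrite /renewed integral_image_measure//.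
rewrite (fubini_tonelli1 (fun t : R * R => f (add2 t)))//.
exact: measurableT_comp.
Qed.

Let renewed_laplace q : (0 < q)%R ->
  \int[renewed]_(x in D0) (expR (- q * x))%:E = after_laplace q.
Proof.
move=> q0; pose f := (fun x : R => (expR (- q * x))%:E) \_ D0.
have mf : measurable_fun setT f by apply: measurable_patch.
have f0 x : 0 <= f x by rewrite /f patchE; case: ifP.
rewrite integral_mkcond -/f integral_renewed//.
have mF : measurable_fun [set: R] (fun h : R => \int[U]_w f (h + w)%R).
  apply: (@measurable_integral_snd _ _ R R R U (fun h w => f (h + w)%R)) => //.
  by apply: measurableT_comp => //; exact: measurable_funD.
rewrite integral_passage_law//; last by move=> h; exact: integral_ge0.
have F h : (u <= h)%R -> \int[U]_w f (h + w)%R = (expR (- q * h))%:E * ell q.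
  move=> uh; rewrite /laplace -ge0_integralZl_EFin ?expR_ge0//.
  apply: (eq_integral_null _ U0) => //.
  - by apply: measurableT_comp => //; exact: measurable_funD.
  - exact: emeasurable_funM.
  move=> w /= /negP; rewrite in_itv/= -leNgt => w0.
  rewrite /f patchE mem_setE in_itv/= andbT (addr_ge0 (le_trans (ltW u0) uh) w0).
  by rewrite mulrDr expRD EFinM.
rewrite F// muleA -EFinM after_laplaceE// [RHS]muleC ge0_muleDl; last 2 first.
- by rewrite lee_fin mulr_ge0 ?creep_ge0 ?expR_ge0.
- by apply: integral_ge0 => z _; apply: integral_ge0 => y _; rewrite mule_ge0 ?indE_ge0.
congr (_ + _); rewrite muleC -[ell q]fineK ?(laplace_fin laplace_inv q0).1//.
rewrite -integral2Z ?fine_ge0 ?integral_ge0//; last 2 first.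
- exact: (mstraddle (mexp q)).
- by move=> z y; rewrite mule_ge0 ?indE_ge0.
apply: eq_integral => z _; apply: eq_integral => y _.
have [/andP[zu uzy]|_] := boolP (z < u <= z + y)%R; last by rewrite !mule0.
by rewrite F// /indE !mule1 fineK ?(laplace_fin laplace_inv q0).1// muleC.
Qed.

(** The renewal equation: above [u], the potential measure is that of the
    process restarted from its position after the passage above [u]. *)
Lemma renewal (f : R -> \bar R) : measurable_fun setT f ->
  (forall x, 0 <= f x) -> (forall x, (x < 0)%R -> f x = 0) ->
  \int[U]_z (f z * indE (u <= z)%R) = \int[passage_law]_h \int[U]_w f (h + w)%R.
Proof.
move=> mf f0 fN; have fD0 : f \_ D0 = f.
  apply/funext => x; rewrite patchE mem_setE in_itv/= andbT.
  by have [//|x0] := leP 0%R x; rewrite fN.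
rewrite -integral_renewed// -fD0 -[RHS]integral_mkcond.
have EL q : (0 < q)%R -> \int[after]_(x in D0) (expR (- q * x))%:E = after_laplace q.
  move=> q0; rewrite integral_mkcond integral_density//.
  - apply: eq_integral => z _; have [uz|zu] := leP u z; last by rewrite !mule0.
    by rewrite patchE mem_setE in_itv/= andbT (le_trans (ltW u0) uz).
  - by apply: measurable_patch.
  - by move=> x; rewrite patchE; case: ifP.
have fin q : (0 < q)%R -> after_laplace q < +oo.
  move=> q0; apply: (@le_lt_trans _ _ (ell q)).
    rewrite -before_after leeDr//.
    by apply: integral_ge0 => z _; rewrite mule_ge0 ?indE_ge0.
  by rewrite ltey_eq (laplace_fin laplace_inv q0).1.
rewrite (eq_measure_integral after); last first.
  move=> A mA AD0; apply/esym; apply: laplace_unique => //.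
  - by move=> q q0; rewrite EL// fin.
  - by move=> q q0; rewrite renewed_laplace// fin.
  - by move=> q q0; rewrite EL// renewed_laplace.
rewrite integral_mkcond fD0 integral_density//.
Qed.

End renewal_equation.

Section no_creeping.
Context {R : realType} (U Pi : {sigma_finite_measure set R -> \bar R}).
Local Open Scope ereal_scope.
Local Notation leb := (@lebR R).
Implicit Types (a b c u v z y r q w x : R).
Local Notation psi := (overshoot U Pi).
Local Notation N := (tail Pi).
Local Notation p := (creep U Pi).

Hypothesis U0 : U `]-oo, 0%R[%classic = 0.
Hypothesis Pi0 : Pi `]-oo, 0%R]%classic = 0.
Hypothesis laplace_inv : forall q, (0 < q)%R -> laplace U q * laplace_exponent Pi q = 1.

Let psi_fin a : psi a \is a fin_num. Proof. exact: overshoot_fin. Qed.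
Let psi_le1 a : psi a <= 1. Proof. exact: overshoot_le1. Qed.
Let p_ge0 a : (0 <= p a)%R. Proof. exact: creep_ge0. Qed.
Let psiE a : psi a = (1 - p a)%:E.
Proof. by rewrite /creep opprB addrC subrK fineK. Qed.
Let p_le1 a : (p a <= 1)%R.
Proof. by rewrite -subr_ge0 -lee_fin -psiE overshoot_ge0. Qed.

Let mjump (f : R -> R -> \bar R) u :
  measurable_fun setT (fun t : R * R => f t.1 t.2) ->
  measurable_fun setT (fun t : R * R => f t.1 t.2 * indE (t.1 < u <= t.1 + t.2)%R).
Proof. by move=> mf; apply: emeasurable_funM => //; exact: measurable_straddle. Qed.

Let mjumpD x : measurable_fun setT (fun t : R * R =>
  indE (x <= t.1 + t.2)%R + psi (x - (t.1 + t.2))).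
Proof.
apply: emeasurable_funD.
  apply: measurable_indE; apply: measurable_fun_ler => //; exact: measurable_funD.
apply: measurableT_comp; first exact: measurable_overshoot.
by apply: measurable_funB => //; exact: measurable_funD.
Qed.

Lemma below_jump u v : (0 <= v)%R -> overshoot_below U Pi u (u + v) =
  \int[U]_z \int[Pi]_y (indE (u + v <= z + y)%R * indE (z < u <= z + y)%R).
Proof.
move=> v0; apply: eq_integral => z _; rewrite -ge0_integralZl//; last 3 first.
- apply: measurable_indE; apply: measurable_and => //; exact: measurable_fun_ler.
- by move=> y _; exact: indE_ge0.
- exact: indE_ge0.
apply: eq_integral => y _; rewrite -!indE_and subr_gt0 lerBlDl; congr indE.
have [zu|//] := ltP z u; rewrite ?andbF//= (lt_le_trans zu) ?lerDl//=.
have [uvzy|//] := leP (u + v)%R (z + y)%R.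
by rewrite (le_trans _ uvzy)// lerDl.
Qed.

(** The renewal equation for the tail of [Pi] seen from level $u+v$: that level
    is passed by the jump over $u$, or from the position reached after it. *)
Lemma overshootD u v : (0 < u)%R -> (0 < v)%R ->
  psi (u + v)%R = (p u)%:E * psi v + \int[U]_z \int[Pi]_y
    ((indE (u + v <= z + y)%R + psi (u + v - (z + y))%R) * indE (z < u <= z + y)%R).
Proof.
move=> u0 v0.
pose f z : \bar R := N (u + v - z)%R * indE (0 <= z)%R.
have mf : measurable_fun setT f.
  apply: emeasurable_funM; last by apply: measurable_indE; exact: measurable_fun_ler.
  by apply: measurableT_comp; [exact: measurable_tail|exact: measurable_funB].
have f0 x : 0 <= f x by rewrite mule_ge0 ?tail_ge0 ?indE_ge0.
have fN x : (x < 0)%R -> f x = 0 by move=> x0; rewrite /f leNgt x0 mule0.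
have mpsi : measurable_fun setT (fun t : R * R => psi (u + v - (t.1 + t.2))%R).
  apply: measurableT_comp; first exact: measurable_overshoot.
  by apply: measurable_funB => //; exact: measurable_funD.
have split : psi (u + v)%R = overshoot_below U Pi u (u + v) +
    \int[U]_z (f z * indE (u <= z)%R).
  rewrite -ge0_integralD//; last 4 first.
  - by move=> z _; rewrite mule_ge0 ?indE_ge0 ?tail_ge0.
  - apply: emeasurable_funM; first by apply: measurable_indE; exact: measurable_fun_ltr.
    by apply: measurableT_comp; [exact: measurable_tail|exact: measurable_funB].
  - by move=> z _; rewrite mule_ge0 ?indE_ge0.
  - by apply: emeasurable_funM => //; apply: measurable_indE; exact: measurable_fun_ler.
  apply: eq_integral => z _; rewrite /f; have [zu|uz] := ltP z u.
    by rewrite /indE/= mul1e mule0 adde0.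
  by rewrite (le_trans (ltW u0) uz) /indE/= mul0e add0e !mule1.
rewrite split (renewal U0 Pi0 laplace_inv u0 mf f0 fN).
have F h : (u <= h)%R -> \int[U]_w f (h + w)%R = psi (u + v - h)%R.
  move=> uh; apply: (eq_integral_null _ U0) => //.
  - by apply: measurableT_comp => //; exact: measurable_funD.
  - by apply: measurableT_comp; [exact: measurable_tail|exact: measurable_funB].
  - by move=> w; exact: tail_ge0.
  move=> w /= /negP; rewrite in_itv/= -leNgt => w0.
  by rewrite /f (addr_ge0 (le_trans (ltW u0) uh) w0) mule1 opprD addrA.
have mF : measurable_fun [set: R] (fun h : R => \int[U]_w f (h + w)%R).
  apply: (@measurable_integral_snd _ _ R R R U (fun h w => f (h + w)%R)) => //.
  by apply: measurableT_comp => //; exact: measurable_funD.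
rewrite integral_passage_law//; last by move=> h; exact: integral_ge0.
have uvu : (u + v - u = v)%R by ring.
rewrite F// uvu addeCA; congr (_ + _).
rewrite below_jump ?(ltW v0)//.
transitivity (\int[U]_z \int[Pi]_y (indE (u + v <= z + y)%R * indE (z < u <= z + y)%R) +
   \int[U]_z \int[Pi]_y (psi (u + v - (z + y))%R * indE (z < u <= z + y)%R)).
  apply: (congr1 (fun X => _ + X)); apply: eq_integral => z _; apply: eq_integral => y _.
  have [/andP[zu uzy]|_] := boolP (z < u <= z + y)%R; last by rewrite !mule0.
  by rewrite F.
rewrite -integral2D.
- apply: eq_integral => z _; apply: eq_integral => y _.
  by rewrite -ge0_muleDl ?indE_ge0 ?overshoot_ge0.
- apply: (mjump (f := fun z y => indE (u + v <= z + y)%R)).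
  by apply: measurable_indE; apply: measurable_fun_ler => //; exact: measurable_funD.
- exact: (mjump (f := fun z y => psi (u + v - (z + y))%R)).
- by move=> z y; rewrite mule_ge0 ?indE_ge0.
- by move=> z y; rewrite mule_ge0 ?indE_ge0 ?overshoot_ge0.
Qed.

End no_creeping.

(** * Kesten's theorem on creeping *)

Section jump_integral.
Context {R : realType} (U Pi : {sigma_finite_measure set R -> \bar R}).
Local Open Scope ereal_scope.
Implicit Types (u v z y r : R) (F G : R -> \bar R).

(** The integral of [F] over the position reached when level [u] is passed by a
    jump. *)
Definition jump_integral u F :=
  \int[U]_z \int[Pi]_y (F (z + y)%R * indE (z < u <= z + y)%R).

Lemma measurable_jump u F : measurable_fun setT F ->
  measurable_fun setT (fun t : R * R => F (t.1 + t.2)%R * indE (t.1 < u <= t.1 + t.2)%R).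
Proof.
move=> mF; apply: emeasurable_funM; last exact: measurable_straddle.
by apply: measurableT_comp => //; exact: measurable_funD.
Qed.

Lemma jump_integral_ge0 u F : (forall x, 0 <= F x) -> 0 <= jump_integral u F.
Proof.
move=> F0; apply: integral_ge0 => z _; apply: integral_ge0 => y _.
by rewrite mule_ge0 ?indE_ge0.
Qed.

Lemma jump_integral_le u F G :
  measurable_fun setT F -> measurable_fun setT G ->
  (forall x, 0 <= F x) -> (forall x, (u <= x)%R -> F x <= G x) ->
  jump_integral u F <= jump_integral u G.
Proof.
move=> mF mG F0 FG.
apply: (@le_integral2 _ _ _ _ _ U Pi (fun z y => F (z + y)%R * indE (z < u <= z + y)%R)
    (fun z y => G (z + y)%R * indE (z < u <= z + y)%R)).
- exact: measurable_jump.
- exact: measurable_jump.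
- by move=> z y; rewrite mule_ge0 ?indE_ge0.
- move=> z y; have [/andP[_ uzy]|_] := boolP (z < u <= z + y)%R; last by rewrite !mule0.
  by rewrite lee_wpmul2r ?indE_ge0// FG.
Qed.

Lemma jump_integral1 u : jump_integral u (cst 1) = overshoot U Pi u.
Proof.
rewrite overshootE; apply: eq_integral => z _; apply: eq_integral => y _.
by rewrite /= mul1e.
Qed.

Lemma jump_integral_affine u (c k : R) F : (0 <= c)%R -> (0 <= k)%R ->
  measurable_fun setT F -> (forall x, 0 <= F x) ->
  jump_integral u (fun h => c%:E + k%:E * F h) =
  c%:E * overshoot U Pi u + k%:E * jump_integral u F.
Proof.
move=> c0 k0 mF F0.
have mc : measurable_fun [set: R] (cst 1 : R -> \bar R) by [].
rewrite -(jump_integral1 u) /jump_integral.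
rewrite -(@integral2Z _ _ _ _ _ U Pi _ _ c0 (measurable_jump u mc)); last by move=> z y; rewrite mule_ge0 ?indE_ge0.
rewrite -(@integral2Z _ _ _ _ _ U Pi _ _ k0 (measurable_jump u mF)); last by move=> z y; rewrite mule_ge0 ?indE_ge0.
rewrite -integral2D.
- apply: eq_integral => z _; apply: eq_integral => y _ /=.
  by rewrite mul1e muleA -ge0_muleDl ?lee_fin// mule_ge0.
- by apply: emeasurable_funM => //; exact: (measurable_jump u mc).
- by apply: emeasurable_funM => //; exact: (measurable_jump u mF).
- by move=> z y; rewrite !mule_ge0 ?indE_ge0.
- by move=> z y; rewrite !mule_ge0 ?indE_ge0.
Qed.

End jump_integral.

Section dichotomy.
Context {R : realType} (p : R -> R).
Implicit Types (a b y : R).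

Hypothesis p01 : forall a, 0 <= p a <= 1.
Hypothesis pM : forall a b, 0 < a -> 0 < b -> p a * p b <= p (a + b).
Hypothesis p_le : forall a b, 0 < a -> 0 < b -> p (a + b) <= 1 - p a * (1 - p b).

Let dichotomy x0 y : 0 < y < x0 -> 9 / 10 < p x0 -> 1 / 8 < p y -> 7 / 8 <= p y.
Proof.
move=> /andP[y0 yx] px0 hy; rewrite leNgt; apply/negP => hy'.
have z0 : 0 < x0 - y by rewrite subr_gt0.
have := p_le y0 z0; have := p_le z0 y0.
rewrite subrK [y + _]addrC subrK.
have /andP[] := p01 (x0 - y).
move: (p (x0 - y)) => b b1 b0 h1 h2; nra.
Qed.

Let multiples x0 y m : 0 < y -> 9 / 10 < p x0 -> 9 / 10 < p y ->
  m.+1%:R * y < x0 -> 7 / 8 <= p (m.+1%:R * y).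
Proof.
move=> y0 px0 py; elim: m => [|m IH]; first by rewrite mul1r => _; lra.
move=> mx; have my0 : 0 < m.+1%:R * y by rewrite mulr_gt0.
have mE : m.+2%:R * y = m.+1%:R * y + y by rewrite -[m.+2]addn1 natrD mulrDl mul1r.
have mx' : m.+1%:R * y < x0 by move: mx; rewrite mE; lra.
apply: (@dichotomy x0) => //; first by rewrite mx mulr_gt0.
rewrite mE; apply: lt_le_trans (pM my0 y0).
have := IH mx'; nra.
Qed.

(** Below a level $x_0$ where [p] exceeds $9/10$, [p] avoids $]1/8,7/8[$, so it
    stays above $7/8$ along the multiples of any small level where it exceeds
    $9/10$. *)
Lemma dense_large x0 b c : 9 / 10 < p x0 -> b < x0 -> 0 < b -> c < b ->
  (forall e, 0 < e -> exists y, 0 < y <= e /\ 9 / 10 < p y) ->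
  exists a, c <= a <= b /\ 7 / 8 <= p a.
Proof.
move=> px0 bx b0 cb near0.
have e0 : 0 < Num.min (b - c) b by rewrite lt_min subr_gt0 cb.
have [y [/andP[y0]]] := near0 _ e0.
rewrite le_min => /andP[ybc yb] py.
have by0 : 0 <= b / y by rewrite divr_ge0// ltW.
have /andP[] := truncn_itv by0.
have : 1 <= b / y by rewrite ler_pdivlMr// mul1r.
rewrite -truncn_gt0; case: (Num.truncn _) => // m _.
rewrite ler_pdivlMr// ltr_pdivrMr// => mb bm.
exists (m.+1%:R * y); split.
  rewrite mb andbT; move: bm; rewrite -[m.+2]addn1 natrD mulrDl mul1r; lra.
by apply: (@multiples x0) => //; apply: le_lt_trans bx.
Qed.

End dichotomy.

Section no_creeping.
Context {R : realType} (U Pi : {sigma_finite_measure set R -> \bar R}).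
Local Open Scope ereal_scope.
Local Notation leb := (@lebR R).
Implicit Types (a b c u v z y r q w : R).
Local Notation psi := (overshoot U Pi).
Local Notation p := (creep U Pi).

Hypothesis U0 : U `]-oo, 0%R[%classic = 0.
Hypothesis Pi0 : Pi `]-oo, 0%R]%classic = 0.
Hypothesis laplace_inv : forall q, (0 < q)%R -> laplace U q * laplace_exponent Pi q = 1.

Lemma overshoot_creep a : psi a = (1 - p a)%:E.
Proof.
rewrite /creep opprB addrC subrK fineK//.
exact: (overshoot_fin U0 Pi0 laplace_inv).
Qed.

Lemma creep01 a : (0 <= p a <= 1)%R.
Proof.
rewrite (creep_ge0 U0 Pi0 laplace_inv)/=.
by rewrite -subr_ge0 -lee_fin -overshoot_creep overshoot_ge0.
Qed.

(** The value of [overshoot] at level $r$, with value $1$ when the level is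
    already passed. *)
Definition overshoot1 r : \bar R := indE (r <= 0)%R + psi r.

Lemma overshoot1_ge0 r : 0 <= overshoot1 r.
Proof. by apply: adde_ge0; [exact: indE_ge0|exact: overshoot_ge0]. Qed.

Lemma overshoot1_le1 r : overshoot1 r <= 1.
Proof.
rewrite /overshoot1; have [r0|r0] := leP r 0%R.
  by rewrite (overshoot_le0 _ U0 r0) adde0.
by rewrite add0e; exact: (overshoot_le1 U0 Pi0 laplace_inv).
Qed.

Lemma measurable_overshoot1 x : measurable_fun [set: R] (fun h : R => overshoot1 (x - h)).
Proof.
apply: emeasurable_funD.
  by apply: measurable_indE; apply: measurable_fun_ler => //; exact: measurable_funB.
apply: measurableT_comp; first exact: measurable_overshoot.
exact: measurable_funB.
Qed.

Lemma overshootD_jump u v : (0 < u)%R -> (0 < v)%R ->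
  psi (u + v)%R = (p u)%:E * psi v +
    jump_integral U Pi u (fun h => overshoot1 (u + v - h)).
Proof.
move=> u0 v0; rewrite (overshootD U0 Pi0 laplace_inv u0 v0).
apply: (congr1 (fun X => _ + X)).
by apply: eq_integral => z _; apply: eq_integral => y _; rewrite /overshoot1 subr_le0.
Qed.

(** Passing $u$ continuously and then $v$ more continuously. *)
Lemma creepM u v : (0 < u)%R -> (0 < v)%R -> (p u * p v <= p (u + v))%R.
Proof.
move=> u0 v0.
have : psi (u + v)%R <= (p u)%:E * psi v + psi u.
  rewrite (overshootD_jump u0 v0) -(jump_integral1 U Pi u).
  apply: leeD; first exact: lexx.
  apply: jump_integral_le; [exact: measurable_overshoot1|exact: measurable_cst| |].
  - by move=> h; exact: overshoot1_ge0.
  - by move=> h _; exact: overshoot1_le1.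
rewrite !overshoot_creep -EFinM -EFinD lee_fin.
by move: (p u) (p v) (p (u + v)%R) => a b c; lra.
Qed.

(** Passing $u$ continuously and then $v$ more by a jump makes $u+v$ be passed
    by a jump. *)
Lemma creep_le u v : (0 < u)%R -> (0 < v)%R -> (p (u + v) <= 1 - p u * (1 - p v))%R.
Proof.
move=> u0 v0.
have : (p u)%:E * psi v <= psi (u + v)%R.
  rewrite (overshootD_jump u0 v0) leeDl//.
  by apply: jump_integral_ge0 => h; exact: overshoot1_ge0.
rewrite !overshoot_creep -EFinM lee_fin.
by move: (p u) (p v) (p (u + v)%R) => a b c; lra.
Qed.

(** From $[x-v,x[$ the level $x$ is passed by a jump with probability at least
    $d$; it may also have been passed directly from below $x-v$. *)
Let step (d v0 x v : R) : (0 < d < 1)%R ->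
  (forall v, (0 < v <= v0)%R -> d%:E <= psi v) ->
  (0 < v <= v0)%R -> (v < x)%R ->
  d%:E + (1 - d)%:E * overshoot_below U Pi (x - v) x <= psi x.
Proof.
move=> /andP[d0 d1] H /andP[vp vv0] vx.
have d1' : (0 <= 1 - d)%R by rewrite subr_ge0 ltW.
have mi : measurable_fun [set: R] (fun h : R => indE (x <= h)%R : \bar R).
  by apply: measurable_indE; exact: measurable_fun_ler.
have i0 h : 0 <= (indE (x <= h)%R : \bar R) by exact: indE_ge0.
set u := (x - v)%R.
have u0 : (0 < u)%R by rewrite subr_gt0.
have xE : x = (u + v)%R by rewrite subrK.
have -> : overshoot_below U Pi u x = jump_integral U Pi u (fun h => indE (x <= h)%R).
  by rewrite {1}xE (below_jump _ _ _ (ltW vp)) -xE.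
rewrite [in leRHS]xE (overshootD_jump u0 vp) -xE.
apply: (@le_trans _ _ ((p u)%:E * d%:E +
    jump_integral U Pi u (fun h => d%:E + (1 - d)%:E * indE (x <= h)%R))).
  rewrite (jump_integral_affine U Pi u (ltW d0) d1' mi i0) addeA; apply: leeD; last exact: lexx.
  rewrite overshoot_creep -!EFinM -EFinD lee_fin.
  by move: (p u) => a; lra.
apply: leeD.
  apply: lee_wpmul2l; first by rewrite lee_fin; case/andP: (creep01 u).
  by apply: H; rewrite vp.
apply: jump_integral_le.
- by apply: emeasurable_funD => //; exact: emeasurable_funM.
- exact: measurable_overshoot1.
- by move=> h; rewrite adde_ge0// ?mule_ge0// lee_fin ltW.
- move=> h uh; rewrite /overshoot1 subr_le0; have [xh|hx] := leP x h.
    by rewrite /indE/= mule1 -EFinD addrC subrK leeDl// overshoot_ge0.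
  rewrite /indE/= mule0 adde0 add0e; apply: H.
  by rewrite subr_gt0 hx/= (le_trans _ vv0)// lerBlDr -lerBlDl.
Qed.

(** Letting $v$ vanish in [step] gives $d+(1-d)\psi(x)\le\psi(x)$ for
    [overshoot] $\psi$. *)
Lemma overshoot_small_levels (d v0 x : R) : (0 < d < 1)%R -> (0 < v0)%R ->
  (forall v, (0 < v <= v0)%R -> d%:E <= psi v) -> (0 < x)%R -> 1 <= psi x.
Proof.
move=> d01 v00 H x0.
have E : d%:E + (1 - d)%:E * psi x <= psi x.
  have L : d%:E + (1 - d)%:E * overshoot_below U Pi (x - harmonic n) x @[n --> \oo] -->
      d%:E + (1 - d)%:E * psi x.
    apply: cvgeD; first by rewrite fin_num_adde_defr.
      exact: cvg_cst.
    by apply: cvgeZl => //; exact: overshoot_below_cvg.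
  rewrite -(cvg_lim _ L)//; apply: lime_le; first by apply/cvg_ex; eexists; exact: L.
  near=> n; apply: (step d01 H).
    rewrite harmonic_gt0/=; apply: ltW; near: n.
    by apply: (cvgr_lt 0%R); [exact: cvg_harmonic|].
  by near: n; apply: (cvgr_lt 0%R); [exact: cvg_harmonic|].
move: E; rewrite overshoot_creep -EFinM -EFinD !lee_fin.
case/andP: d01 (creep01 x); move: (p x) => a d0 d1 /andP[a0 a1] E.
have : (d * a <= 0)%R by lra.
by rewrite pmulr_rle0//; lra.
Unshelve. all: by end_near. Qed.

(** If continuous passage is possible at all, then it is almost certain at
    arbitrarily small levels. *)
Lemma creep_near0 (x e : R) : (0 < p x)%R -> (0 < x)%R -> (0 < e)%R ->
  exists y, (0 < y <= e)%R /\ (9 / 10 < p y)%R.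
Proof.
move=> px x0 e0; apply/not_existsP => H.
have : 1 <= psi x.
  apply: (@overshoot_small_levels (1 / 10) e x) => //; first by apply/andP; split; lra.
  move=> v ve; have : ~ (9 / 10 < p v)%R by move=> pv; apply: (H v).
  rewrite overshoot_creep lee_fin => /negP; rewrite -leNgt.
  by move: (p v) => a; lra.
rewrite overshoot_creep lee_fin.
by move: (p x) px => a; lra.
Qed.

(** Kesten's theorem, by Bretagnolle's argument: if [creep] is positive
    somewhere, then the levels where it is at least $7/8$ are dense near $0$, by
    [dense_large], and left lower semicontinuity of [overshoot] makes it so on a
    whole interval $]0,x_0[$. This contradicts [overshoot_itv]. *)
Theorem no_creeping (a : R) : (0 < a)%R -> psi a = 1.
Proof.
move=> a0; apply/eqP; rewrite eq_le (overshoot_le1 U0 Pi0 laplace_inv)/=.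
rewrite overshoot_creep lee_fin lerBrDr gerDl leNgt; apply/negP => pa.
have [x0 [/andP[x00 _] px0]] := creep_near0 pa a0 ltr01.
have small b : (0 < b < x0)%R -> psi b <= (1 / 8)%:E.
  move=> /andP[b0 bx]; apply: (@overshoot_lsc _ U Pi) => c cb.
  have [|a' [ca pa']] := dense_large creep01 creepM creep_le px0 bx b0 cb.
    by move=> e; exact: creep_near0 pa a0.
  exists a'; split => //; rewrite overshoot_creep lee_fin.
  by move: (p a') pa' => t; lra.
have : \int[leb]_(y in `[0%R, (x0 / 2)%R]) psi y <= \int[leb]_(y in `[0%R, (x0 / 2)%R]) (1 / 8)%:E.
  apply: ge0_le_integral => //.
  - by move=> y _; exact: overshoot_ge0.
  - by apply: measurable_funTS; exact: measurable_overshoot.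
  move=> y; rewrite /= in_itv/= le_eqVlt => /andP[/predU1P[<-|y0] yx].
    by rewrite (overshoot_le0 _ U0)// lee_fin.
  by apply: small; rewrite y0/=; lra.
rewrite (overshoot_itv U0 Pi0 laplace_inv)//; last by lra.
have E : lebR `[0%R, (x0 / 2)%R]%classic = (x0 / 2)%:E.
  by rewrite /lebR lebesgue_measure_itv/= lte_fin divr_gt0// sube0.
by rewrite integral_cst//= E -EFinM lee_fin; lra.
Qed.

End no_creeping.

(** * Independence *)

Section independence.
Context d d' (T : measurableType d) (E : measurableType d') (R : realType).
Variable P : probability T R.
Local Open Scope ereal_scope.

(** Independence passes from a pi-system to the sigma-algebra it generates:
    both sides are finite measures in $A$. *)
Lemma indep_sigma (G : set (set T)) (B : set T) :
  G `<=` measurable -> setI_closed G -> G setT -> measurable B ->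
  (forall A, G A -> P (A `&` B) = P A * P B) ->
  forall A, <<s G >> A -> P (A `&` B) = P A * P B.
Proof.
move=> mG GI GT mB GB A sGA.
have PB : (0 <= fine (P B))%R by rewrite fine_ge0.
have PBE : (fine (P B))%:E = P B by rewrite fineK// fin_num_measure.
rewrite -PBE muleC -/(mscale (NngNum PB) P A) -/(mrestr P mB A).
apply: (g_sigma_algebra_measure_unique G mG (fun=> setT)) => //.
- by rewrite bigcup_const.
- by move=> C GC; rewrite /= /mrestr /mscale/= PBE muleC GB.
- move=> _; rewrite /= /mrestr setTI.
  by rewrite (le_lt_trans (probability_le1 _ _))// ltry.
Qed.

Definition generated_by (X : nat -> T -> E) (n : nat) : set (set T) :=
  [set A | exists i (B : set E), [/\ (i < n)%N, measurable B & A = X i @^-1` B]].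

Lemma mutually_independentS (X : nat -> T -> E) n :
  mutually_independent P (fun i : 'I_n.+1 => X i) ->
  mutually_independent P (fun i : 'I_n => X i).
Proof.
move=> HX A mA.
pose A' (i : 'I_n.+1) := if insub (val i) is Some j then A j else setT.
have A'W (i : 'I_n) : A' (widen_ord (leqnSn n) i) = A i.
  by rewrite /A'/= valK.
have A'M : A' ord_max = setT by rewrite /A'/= insubF// ltnn.
have mA' i : measurable (A' i) by rewrite /A'; case: insubP => // j _ _; exact: mA.
have := HX A' mA'; rewrite big_ord_recr/= A'M preimage_setT probability_setT mule1.
under eq_bigr do rewrite A'W.
move=> <-.
congr (P _); apply/seteqP; split => w /= H i _.
  rewrite /A'; case: insubP => [j _ ji|]; last by [].
  by rewrite -ji; exact: H.
by have := H (widen_ord (leqnSn n) i) Logic.I; rewrite A'W.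
Qed.

(** In a mutually independent family, the last member is independent of the
    sigma-algebra generated by the previous ones. *)
Lemma indep_last (X : nat -> T -> E) n :
  (forall i, (i <= n)%N -> measurable_fun setT (X i)) ->
  mutually_independent P (fun i : 'I_n.+1 => X i) ->
  forall A C, <<s generated_by X n >> A -> measurable C ->
    P (A `&` X n @^-1` C) = P A * P (X n @^-1` C).
Proof.
move=> mX HX A C sA mC.
pose G := [set A | exists2 B : 'I_n -> set E, (forall i, measurable (B i)) &
  A = \bigcap_(i in [set: 'I_n]) (X i @^-1` B i)].
have mpre i B : (i <= n)%N -> measurable B -> measurable (X i @^-1` B).
  by move=> ile mB; rewrite -[X in measurable X]setTI; exact: mX.
apply: (@indep_sigma G) => //.
- move=> _ [B mB ->]; apply: fin_bigcap_measurable => // i _.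
  by apply: mpre => //; exact: ltnW.
- move=> _ _ [B mB ->] [B' mB' ->]; exists (fun i => B i `&` B' i).
    by move=> i; exact: measurableI.
  by rewrite -bigcapI.
- by exists (fun=> setT) => //; apply/seteqP; split.
- exact: mpre.
- move=> _ [B mB ->]; rewrite (mutually_independentS HX)//.
  pose A' (i : 'I_n.+1) := if insub (val i) is Some j then B j else C.
  have A'W (i : 'I_n) : A' (widen_ord (leqnSn n) i) = B i by rewrite /A'/= valK.
  have A'M : A' ord_max = C by rewrite /A'/= insubF// ltnn.
  have mA' i : measurable (A' i) by rewrite /A'; case: insubP.
  have := HX A' mA'; rewrite big_ord_recr/= A'M.
  under eq_bigr do rewrite A'W.
  move=> <-.
  congr (P _); apply/seteqP; split => [w [/= H HC] i _|w /= H].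
    rewrite /=/A'; case: insubP => [j _ ji|].
      by rewrite -ji; exact: H.
    rewrite -leqNgt => ni; have -> : val i = n by apply/eqP; rewrite eqn_leq -ltnS ltn_ord.
    exact: HC.
  split=> [i _|]; last by have := H ord_max Logic.I; rewrite /= A'M.
  by have := H (widen_ord (leqnSn n) i) Logic.I; rewrite A'W.
- apply: smallest_sub sA; first exact: smallest_sigma_algebra.
  move=> _ [i [B [iltn mB ->]]]; apply: sub_sigma_algebra.
  exists (fun j => if j == Ordinal iltn then B else setT); first by move=> j; case: ifP.
  apply/seteqP; split => w /= Hw; last by have := Hw (Ordinal iltn) Logic.I; rewrite eqxx.
  by move=> j _ /=; case: eqP => // ->.
Qed.

End independence.

Section restricted_law.
Local Open Scope ereal_scope.
Context d (T : measurableType d) (R : realType) (P : probability T R).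

Lemma integral_mrestr (m : {measure set T -> \bar R}) (A : set T)
    (mA : measurable A) (f : T -> \bar R) :
  measurable_fun setT f -> (forall x, 0 <= f x) ->
  \int[mrestr m mA]_x f x = \int[m]_(x in A) f x.
Proof.
move=> mf f0; transitivity (\int[mrestr m mA]_(x in A) f x).
  rewrite (@ge0_negligible_integral _ _ _ (mrestr m mA) setT (~` A))//.
  - by rewrite setTD setCK.
  - exact: measurableC.
  - by rewrite /= /mrestr setICl measure0.
by apply: eq_measure_integral => B mB BA; rewrite /= /mrestr setIidl.
Qed.

Context d' (E : measurableType d').

(** The law of [X] on the event [A], a measure of total mass $P(A)$. *)
Definition law_on (A : set T) (mA : measurable A) (X : T -> E)
  (mX : measurable_fun setT X) : set E -> \bar R :=
  image_measure (mrestr P mA) mX.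

Variables (A : set T) (mA : measurable A) (X : T -> E) (mX : measurable_fun setT X).

Lemma law_onE B : law_on mA mX B = P (A `&` X @^-1` B).
Proof. by rewrite setIC. Qed.

HB.instance Definition _ := Measure.on (law_on mA mX).

Let law_on_fin : fin_num_fun (law_on mA mX).
Proof.
move=> B mB; have mXB : measurable (X @^-1` B `&` A).
  by apply: measurableI => //; rewrite -[X in measurable X]setTI; exact: mX.
by rewrite /law_on /image_measure /= /mrestr; exact: fin_num_measure.
Qed.

HB.instance Definition _ := @Measure_isFinite.Build _ _ _ (law_on mA mX) law_on_fin.

Lemma integral_law_on (f : E -> \bar R) : measurable_fun setT f ->
  (forall x, 0 <= f x) ->
  \int[law_on mA mX]_x f x = \int[P]_(w in A) f (X w).
Proof.
move=> mf f0; rewrite -integral_mrestr//; last exact: measurableT_comp.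
exact: integral_image_measure.
Qed.

End restricted_law.

Section independent_pair.
Local Open Scope ereal_scope.
Context d d1 d2 (T : measurableType d) (E1 : measurableType d1)
  (E2 : measurableType d2) (R : realType) (P : probability T R).

(** Disintegration along an independent pair, on an event. *)
Lemma indep_integral (A : set T) (X : T -> E1) (Y : T -> E2)
    (f : E1 -> E2 -> \bar R) :
  measurable A -> measurable_fun setT X -> measurable_fun setT Y ->
  (forall B C, measurable B -> measurable C ->
    P (A `&` X @^-1` B `&` Y @^-1` C) = P (A `&` X @^-1` B) * P (Y @^-1` C)) ->
  measurable_fun setT (fun t : E1 * E2 => f t.1 t.2) ->
  (forall x y, 0 <= f x y) ->
  \int[P]_(w in A) f (X w) (Y w) = \int[P]_(w in A) \int[P]_w' f (X w) (Y w').
Proof.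
move=> mA mX mY indep mf f0.
have mXY : measurable_fun setT (fun w => (X w, Y w)) by exact: measurable_fun_pair.
pose mu1 : {sigma_finite_measure set E1 -> \bar R} := law_on P mA mX.
pose mu2 : {sigma_finite_measure set E2 -> \bar R} := law_on P measurableT mY.
have mF : measurable_fun setT (fun x => \int[mu2]_y f x y).
  exact: measurable_integral_snd.
transitivity (\int[law_on P mA mXY]_t f t.1 t.2).
  by rewrite integral_law_on.
transitivity (\int[mu1 \x mu2]_t f t.1 t.2).
  apply: eq_measure_integral => Z mZ _; apply/esym.
  apply: product_measure_unique => // B C mB mC.
  transitivity (P (A `&` X @^-1` B `&` Y @^-1` C)); last first.
    by rewrite indep// [RHS](congr2 _ (law_onE _ _ _ _) (law_onE _ _ _ _)) setTI.
  by rewrite [LHS]law_onE; congr (P _); apply/seteqP; split => w /=; tauto.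
rewrite (fubini_tonelli1 (fun t : E1 * E2 => f t.1 t.2))//.
rewrite /fubini_F/= integral_law_on//; last by move=> x; exact: integral_ge0.
apply: eq_integral => w _; rewrite integral_law_on//.
exact: (measurableT_comp mf (pair1_measurable _)).
Qed.

End independent_pair.

Section product_expectation.
Local Open Scope ereal_scope.
Context d d' (T : measurableType d) (E : measurableType d') (R : realType).
Variable P : probability T R.

Lemma expectation_prod (X : nat -> T -> E) (g : nat -> E -> R) n :
  (forall i, (i < n)%N -> measurable_fun setT (X i)) ->
  (forall i, measurable_fun setT (g i)) -> (forall i x, 0 <= g i x)%R ->
  mutually_independent P (fun i : 'I_n => X i) ->
  \int[P]_w (\prod_(i < n) g i (X i w))%:E =
  \prod_(i < n) \int[P]_w (g i (X i w))%:E.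
Proof.
move=> + mg g0; elim: n => [|n IH] mX HX.
  rewrite big_ord0; under eq_integral do rewrite big_ord0.
  rewrite (integral_cst P measurableT 1).
  by rewrite mul1e; exact: probability_setT.
have mX' i : (i < n)%N -> measurable_fun setT (X i) by move=> ni; apply: mX; exact: ltnW.
rewrite big_ord_recr/= -IH//; last exact: mutually_independentS HX.
pose Z w := (\prod_(i < n) g i (X i w))%R.
have Z0 w : (0 <= Z w)%R by rewrite prodr_ge0.
have mgX i : (i <= n)%N -> measurable_fun setT (fun w => g i (X i w)).
  by move=> ni; apply: measurableT_comp => //; exact: mX.
have mZ : measurable_fun setT Z.
  apply: measurable_prod => i _; apply: mgX; exact: ltnW.
have sZ B : measurable B -> <<s generated_by X n >> (Z @^-1` B).
  move=> mB.
  have mXg i : (i < n)%N -> measurable_fun setT (X i : g_sigma_algebraType (generated_by X n) -> E).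
    move=> ni _ C mC; rewrite setTI; apply: sub_sigma_algebra.
    by exists i, C.
  have : measurable_fun setT (Z : g_sigma_algebraType (generated_by X n) -> R).
    apply: measurable_prod => i _; apply: measurableT_comp => //; exact: mXg.
  by move=> /(_ measurableT _ mB); rewrite setTI.
transitivity (\int[P]_w (`|Z w| * g n (X n w))%:E).
  by apply: eq_integral => w _; rewrite big_ord_recr/= ger0_norm.
transitivity (\int[P]_w \int[P]_w' (`|Z w| * g n (X n w'))%:E).
  apply: (@indep_integral _ _ _ T R E R P setT Z (X n) (fun z x => (`|z| * g n x)%:E)) => //.
  - exact: mX.
  - by move=> B C mB mC; rewrite setTI; apply: (@indep_last _ _ _ _ _ P X n) => //; exact: sZ.
  - apply/measurable_EFinP; apply: measurable_funM; last exact: measurableT_comp.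
    exact: (measurableT_comp (@normr_measurable R setT) measurable_fst).
  - by move=> z x; rewrite lee_fin mulr_ge0.
under eq_integral => w _.
  under eq_integral do rewrite ger0_norm// EFinM.
  rewrite ge0_integralZl_EFin//; last 2 first.
  + by move=> w' _; rewrite lee_fin.
  + by apply/measurable_EFinP; exact: mgX.
  over.
rewrite ge0_integralZr//.
+ exact/measurable_EFinP.
+ by move=> w _; rewrite lee_fin.
+ by apply: integral_ge0 => w _; rewrite lee_fin.
Qed.

End product_expectation.

(** * The Laplace transform of a subordinator *)

Section counting_sums.
Local Open Scope ereal_scope.
Context {R : realType} {I : choiceType}.

Lemma esum_cst (A : set I) (c : R) : (0 <= c)%R ->
  \esum_(i in A) c%:E = c%:E * counting A.
Proof.
move=> c0; rewrite /counting; case: asboolP => finA.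
  rewrite esum_fset// fsbig_finite//= big_const_seq count_predT.
  by elim: (size _) => [|n IH] /=; rewrite ?mule0// IH -!EFinM -EFinD -[n.+1]addn1 natrD mulrDr mulr1 addrC.
move: c0; rewrite le_eqVlt => /predU1P[<-|c0].
  by rewrite mul0e esum1.
rewrite gt0_muley//; apply/eqyP => M M0.
have [X XA cX] := infinite_set_fset (Num.truncn (M / c)).+1 finA.
apply: esum_ge; exists [set` X]; first by split.
rewrite fsbig_finite//= big_const_seq count_predT set_fsetK.
have -> n : iter n (+%R c%:E) 0 = (n%:R * c)%:E.
  by elim: n => [|n IH] /=; rewrite ?mul0r// IH -EFinD -[n.+1]addn1 natrD mulrDl mul1r addrC.
rewrite lee_fin -ler_pdivrMr// (le_trans (ltW (truncnS_gt _)))// ler_nat//.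
Qed.

End counting_sums.

Section poisson_laplace.
Local Open Scope ereal_scope.
Context d (T : measurableType d) (R : realType) (P : probability T R).

Lemma nneseries_expR (x : R) : (0 <= x)%R ->
  \sum_(n <oo) (x ^+ n / n`!%:R)%:E = (expR x)%:E.
Proof.
move=> x0; rewrite expRE -EFin_lim; last first.
  rewrite /pseries/=; under eq_fun do rewrite mulrC.
  exact: is_cvg_series_exp_coeff.
apply/congr_lim/funext => n/=; rewrite /pseries/= /series/= -sumEFin//.
by under eq_bigr do rewrite mulrC.
Qed.

(** The exponential series; the events $N=n$ exhaust the space since their
    probabilities sum to $1$. *)
Lemma integral_poisson (N : T -> \bar R) (r b : R) : (0 <= r)%R -> (0 <= b)%R ->
  measurable_fun setT N -> poisson_distributed P N r%:E ->
  \int[P]_w (expR (- b * fine (N w)))%:E = (expR (- (r * (1 - expR (- b)))))%:E.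
Proof.
move=> r0 b0 mN [/(_ _ erefl) HN _].
pose A n := [set w | N w = n%:R%:E].
have mA n : measurable (A n).
  rewrite (_ : A n = setT `&` N @^-1` [set n%:R%:E]); first exact: mN.
  by rewrite setTI.
have tA : trivIset setT A.
  apply/trivIsetP => i j _ _ ij; rewrite -subset0 => w [Ni Nj].
  by move: Ni; rewrite /A/= Nj => -[/eqP]; rewrite eqr_nat eq_sym (negbTE ij).
have mU : measurable (\bigcup_n A n) by exact: bigcupT_measurable.
have PU : P (\bigcup_n A n) = 1.
  rewrite measure_bigcup//=; under eq_eseriesr do rewrite HN EFinM muleC.
  rewrite nneseriesZl//=; last by move=> n _; rewrite lee_fin divr_ge0// exprn_ge0.
  rewrite (eq_eseriesl (Q := xpredT)); last by move=> i; rewrite in_setT.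
  by rewrite nneseries_expR// -EFinM expRN mulVf// gt_eqF// expR_gt0.
have mg : measurable_fun setT (fun w => (expR (- b * fine (N w)))%:E).
  apply: measurable_expRMe; apply: measurableT_comp => //; exact: fine_measurable.
transitivity (\int[P]_(w in \bigcup_n A n) (expR (- b * fine (N w)))%:E).
  rewrite (@ge0_negligible_integral _ _ _ P setT (~` \bigcup_n A n))//.
  - by rewrite setTD setCK.
  - exact: measurableC.
  - transitivity (1 - P (\bigcup_n A n)); first exact: probability_setC.
    by rewrite PU subee.
rewrite ge0_integral_bigcup//; last exact: measurable_funTS.
under eq_eseriesr => n _.
  rewrite (_ : \int[P]_(w in A n) _ = (expR (- r))%:E * ((r * expR (- b)) ^+ n / n`!%:R)%:E).
    over.
  transitivity ((expR (- b * n%:R))%:E * P (A n)).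
    rewrite -integral_cst//; apply: eq_integral => w.
    by rewrite inE /A/= => ->.
  rewrite HN -!EFinM exprMn -expRM_natr; congr EFin; ring.
rewrite nneseriesZl//=; last by move=> n _; rewrite lee_fin divr_ge0// exprn_ge0// mulr_ge0// expR_ge0.
rewrite nneseries_expR ?mulr_ge0 ?expR_ge0// -EFinM -expRD; congr (expR _)%:E; ring.
Qed.

End poisson_laplace.

Section positive_levy.
Local Open Scope ereal_scope.
Context {R : realType}.
Implicit Types (Pi : {measure set R -> \bar R}) (c : R).

Definition levy_integrable Pi :=
  \int[Pi]_(y in `]0%R, +oo[) (Num.min 1 y)%:E < +oo.

Lemma measurable_min1 : measurable_fun [set: R] (fun y : R => (Num.min 1 y)%:E).
Proof. by apply/measurable_EFinP; exact: measurable_minr. Qed.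

Lemma levy_tail_fin Pi c : levy_integrable Pi -> (0 < c)%R ->
  Pi `[c, +oo[%classic < +oo.
Proof.
move=> HPi c0; have m0 : (0 < Num.min 1 c)%R by rewrite lt_min ltr01.
have H : (Num.min 1 c)%:E * Pi `[c, +oo[%classic < +oo.
  rewrite -integral_cst//; apply: le_lt_trans HPi.
  apply: (@le_trans _ _ (\int[Pi]_(y in `[c, +oo[) (Num.min 1 y)%:E)).
    apply: ge0_le_integral => //.
    - by move=> y _; rewrite lee_fin ltW.
    - exact: measurable_funTS measurable_min1.
    - move=> y; rewrite /= in_itv/= andbT => cy.
      by rewrite lee_fin le_min !ge_min lexx cy orbT.
  apply: ge0_subset_integral => //.
  - exact: measurable_funTS measurable_min1.
  - by move=> y; rewrite /= in_itv/= andbT => y0; rewrite lee_fin le_min ler01 ltW.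
  - by move=> y; rewrite /= !in_itv/= !andbT; exact: lt_le_trans.
rewrite ltNge leye_eq; apply/negP => /eqP E; move: H.
by rewrite E gt0_muley// ltxx.
Qed.

(** Nothing is assumed on [Pi] outside $]0,\infty[$; the restriction is
    sigma-finite. *)
Definition positive_levy Pi (_ : levy_integrable Pi) : set R -> \bar R :=
  mrestr Pi (measurable_itv `]0%R, +oo[).

Variables (Pi : {measure set R -> \bar R}) (HPi : levy_integrable Pi).

HB.instance Definition _ := Measure.on (positive_levy HPi).

Let positive_levy_sigma_finite : sigma_finite setT (positive_levy HPi).
Proof.
exists (fun n => `]-oo, 0%R]%classic `|` `[n.+1%:R^-1%R, +oo[%classic).
  apply/esym; rewrite -subTset => y _; have [y0|y0] := leP y 0%R.
    by exists 0%N => //; left; rewrite /= in_itv.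
  exists (Num.truncn y^-1) => //; right; rewrite /= in_itv/= andbT.
  by rewrite invf_ple ?posrE// ltW// truncnS_gt.
move=> n; have mF : measurable (`]-oo, 0%R]%classic `|` `[n.+1%:R^-1%R, +oo[%classic : set R).
  by apply: measurableU; exact: measurable_itv.
split => //; apply: le_lt_trans (@levy_tail_fin Pi n.+1%:R^-1 HPi _); last by rewrite invr_gt0.
apply: le_measure; rewrite ?inE//; first exact: measurableI.
move=> y [/= [|]]; rewrite !in_itv/= !andbT => h // h0.
by move: h0; rewrite ltNge h.
Qed.

HB.instance Definition _ :=
  Measure_isSigmaFinite.Build _ _ _ (positive_levy HPi) positive_levy_sigma_finite.

Lemma positive_levy0 : positive_levy HPi `]-oo, 0%R]%classic = 0.
Proof.
rewrite /positive_levy /mrestr (_ : _ `&` _ = set0) ?measure0// -subset0 => y [/=].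
by rewrite !in_itv/= andbT => y0; rewrite ltNge y0.
Qed.

Lemma integral_positive_levy (f : R -> \bar R) : measurable_fun setT f ->
  (forall y, 0 <= f y) ->
  \int[positive_levy HPi]_y f y = \int[Pi]_(y in `]0%R, +oo[) f y.
Proof. exact: integral_mrestr. Qed.

(** The exponent integrand is at most a constant times $1\wedge y$. *)
Lemma exponent_integrand_le (q y : R) : (0 < q)%R -> (0 <= y)%R ->
  (1 - expR (- q * y) <= Num.max 1 q * Num.min 1 y)%R.
Proof.
move=> q0 y0; have e0 : (0 < expR (- q * y))%R by exact: expR_gt0.
have h1 : (1 - expR (- q * y) <= q * y)%R.
  by have := expR_ge1Dx (- q * y); lra.
have m1 : (1 <= Num.max 1 q)%R by rewrite le_max lexx.
have mq : (q <= Num.max 1 q)%R by rewrite le_max lexx orbT.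
have [y1|y1] := leP 1%R y; first by rewrite mulr1; lra.
by rewrite (le_trans h1)// ler_wpM2r.
Qed.

Lemma laplace_exponent_fin q : (0 < q)%R ->
  (positive_levy HPi).-integrable setT (fun y => (1 - expR (- q * Num.max y 0))%:E).
Proof.
move=> q0; apply/integrableP; split; first exact: measurable_exponent_integrand.
under eq_integral do rewrite gee0_abs ?lee_fin ?exponent_integrand_ge0//.
rewrite integral_positive_levy; last 2 first.
- by apply: measurable_exponent_integrand.
- by move=> y; rewrite lee_fin exponent_integrand_ge0.
apply: (@le_lt_trans _ _ ((Num.max 1 q)%:E * \int[Pi]_(y in `]0%R, +oo[) (Num.min 1 y)%:E)).
  rewrite -ge0_integralZl_EFin//; last 3 first.
  - by move=> y; rewrite /= in_itv/= andbT => y0; rewrite lee_fin le_min ler01 ltW.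
  - exact: measurable_funTS measurable_min1.
  - by rewrite le_max ler01.
  apply: ge0_le_integral => //.
  - by move=> y _; rewrite lee_fin exponent_integrand_ge0.
  - by apply: measurable_funTS; apply: measurable_exponent_integrand.
  - by apply: emeasurable_funM => //; exact: measurable_funTS measurable_min1.
  - move=> y; rewrite /= in_itv/= andbT => y0.
    by rewrite -EFinM lee_fin (max_l (ltW y0)) exponent_integrand_le// ltW.
by rewrite lte_mul_pinfty// lee_fin le_max ler01.
Qed.

End positive_levy.

Section discretization.
Context {R : realType}.
Implicit Types (n i j : nat) (y : R).

Definition level n j : R := j.+1%:R / n.+1%:R.

Definition in_band n j y := level n j <= y < level n j.+1.

(** Round $y$ down to a multiple of $1/(n+1)$; large $y$ are sent to $0$, so
    that finitely many values are taken. *)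
Definition round_down n y : R :=
  \sum_(j < n.+1 ^ 2) level n j * (in_band n j y)%:R.

Lemma level_gt0 n j : 0 < level n j.
Proof. by rewrite divr_gt0. Qed.

Lemma in_bandE n j y : in_band n j y = (j.+1%:R <= n.+1%:R * y < j.+2%:R).
Proof. by rewrite /in_band /level ler_pdivrMr// ltr_pdivlMr// mulrC. Qed.

Lemma in_band_inj n i j y : in_band n i y -> in_band n j y -> i = j.
Proof.
rewrite !in_bandE => hi hj.
by have := truncn_def hi; rewrite (truncn_def hj) => -[].
Qed.

Lemma round_downP n y (f : R -> R) : f 0 = 0 ->
  f (round_down n y) = \sum_(j < n.+1 ^ 2) f (level n j) * (in_band n j y)%:R.
Proof.
move=> f0; have [[j hj]|none] := pselect (exists j : 'I_(n.+1 ^ 2), in_band n j y).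
  have E (g : R -> R) : \sum_(j < n.+1 ^ 2) g (level n j) * (in_band n j y)%:R = g (level n j).
    rewrite (bigD1 j)//= hj mulr1 big1 ?addr0// => i ij.
    have [hi|] := boolP (in_band n i y); last by rewrite mulr0.
    by move: ij; rewrite -(inj_eq val_inj)/= (in_band_inj hi hj) eqxx.
  by rewrite E /round_down (E id).
have E (g : R -> R) : \sum_(j < n.+1 ^ 2) g (level n j) * (in_band n j y)%:R = 0.
  rewrite big1// => j _; have [hj|] := boolP (in_band n j y); last by rewrite mulr0.
  by exfalso; apply: none; exists j.
by rewrite E /round_down (E id).
Qed.

Lemma round_down_ge0 n y : 0 <= round_down n y.
Proof. by apply: sumr_ge0 => j _; rewrite mulr_ge0// ltW// level_gt0. Qed.

Lemma round_down_le n y : 0 <= y -> round_down n y <= y.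
Proof.
move=> y0; have [[j hj]|none] := pselect (exists j : 'I_(n.+1 ^ 2), in_band n j y).
  rewrite /round_down (bigD1 j)//= hj mulr1 big1 ?addr0//; first by case/andP: hj.
  move=> i ij; have [hi|] := boolP (in_band n i y); last by rewrite mulr0.
  by move: ij; rewrite -(inj_eq val_inj)/= (in_band_inj hi hj) eqxx.
rewrite /round_down big1// => j _; have [hj|] := boolP (in_band n j y); last by rewrite mulr0.
by exfalso; apply: none; exists j.
Qed.

Lemma round_down_neg n y : y < 0 -> round_down n y = 0.
Proof.
move=> y0; rewrite /round_down big1// => j _.
rewrite (_ : in_band n j y = false) ?mulr0//; apply/negbTE/negP => /andP[h _].
by have := lt_le_trans (level_gt0 n j) h; rewrite ltNge (ltW y0).
Qed.

Lemma round_down_near n y : 0 <= y -> y < n.+1%:R -> y - n.+1%:R^-1 <= round_down n y.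
Proof.
move=> y0 yn; have n0 : 0 < n.+1%:R :> R by [].
have ny0 : 0 <= n.+1%:R * y by rewrite mulr_ge0.
case/andP: (truncn_itv ny0); case E : (Num.truncn _) => [|j] jy yj.
  rewrite (le_trans _ (round_down_ge0 n y))// subr_le0 -[_^-1]mul1r ler_pdivlMr//.
  by rewrite mulrC ltW.
have hj : in_band n j y by rewrite in_bandE jy.
have jn : (j < n.+1 ^ 2)%N.
  rewrite -(ltr_nat R) natrX (@lt_trans _ _ j.+1%:R)// ?ltr_nat//.
  by rewrite (le_lt_trans jy)// expr2 ltr_pM2l.
rewrite /round_down (bigD1 (Ordinal jn))//= hj mulr1 ler_wpDr//.
  by apply: sumr_ge0 => i _; rewrite mulr_ge0// ltW// level_gt0.
rewrite lerBlDr /level -[X in _ + X]mul1r -mulrDl ler_pdivlMr// natr1 mulrC.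
exact: ltW.
Qed.

Lemma round_down_cvg y : 0 <= y -> round_down n y @[n --> \oo] --> y.
Proof.
move=> y0; apply: (@squeeze_cvgr _ _ _ _ (fun n => y - harmonic n) (cst y)).
- exists (Num.truncn y) => // n /= yn; rewrite round_down_le// andbT.
  apply: round_down_near => //.
  by rewrite (lt_le_trans (truncnS_gt _))// ler_nat.
- rewrite -[X in _ --> X]subr0; apply: cvgB; [exact: cvg_cst|exact: cvg_harmonic].
- exact: cvg_cst.
Qed.

Lemma measurable_in_band n j : measurable_fun [set: R] (in_band n j).
Proof. by apply: measurable_and; [exact: measurable_fun_ler|exact: measurable_fun_ltr]. Qed.

Lemma measurable_round_down n : measurable_fun [set: R] (round_down n).
Proof.
apply: measurable_sum => j; apply: measurable_funM => //.
by apply: (measurableT_comp (f := fun b : bool => b%:R : R)) => //; exact: measurable_in_band.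
Qed.

End discretization.

Section laplace_subordinator.
Local Open Scope ereal_scope.
Context d (T : measurableType d) (R : realType) (P : probability T R).
Variables (S : R -> T -> R) (Pi : {measure set R -> \bar R}).
Hypotheses (HS : driftless_subordinator P S)
  (HN : jumps_poisson_point_process P S Pi) (HPi : levy_integrable Pi).
Implicit Types (s t q : R) (w : T).

Lemma subordinator_nondecreasing s t w : (0 <= s)%R -> (s <= t)%R -> (S s w <= S t w)%R.
Proof.
move=> s0; rewrite le_eqVlt => /predU1P[->//|st].
by case: HS => _ _ _ [_ incS] _; rewrite ltW// incS.
Qed.

Lemma jump_ge0 s w : (0 < s)%R -> (0 <= jump S s w)%R.
Proof.
move=> s0; rewrite subr_ge0; apply: limr_le.
  have s20 : (0 < s / 2)%R by rewrite divr_gt0.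
  have s2s : (s / 2 < s)%R by rewrite ltr_pdivrMr// mulr_natr mulr2n ltrDl.
  apply: (@nondecreasing_at_left_is_cvgr _ (fun u => S u w)).
  - near=> x => y z; rewrite !in_itv/= => /andP[xy _] _ yz.
    apply: subordinator_nondecreasing => //.
    by rewrite (le_trans _ (ltW xy))//; near: x; apply: nbhs_left_ge.
  - near=> x; exists (S s w) => _ [y + <-]; rewrite /= in_itv/= => /andP[xy ys].
    apply: subordinator_nondecreasing; last exact: ltW.
    by rewrite (le_trans _ (ltW xy))//; near: x; apply: nbhs_left_ge.
near=> u; apply: subordinator_nondecreasing.
  by near: u; apply: nbhs_left_ge.
by near: u; apply: nbhs_left_le.
Unshelve. all: by end_near. Qed.

(** Rounding down the jump sizes turns $S_t$ into a finite combination of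
    independent Poisson variables. *)
Definition rounded_sum (n : nat) t w : \bar R :=
  \esum_(s in `]0%R, t]%classic) (round_down n (jump S s w))%:E.

Definition band (n j : nat) t : set (R * R) :=
  `]0%R, t]%classic `*` [set y | in_band n j y].

Lemma rounded_sumE n t w : rounded_sum n t w =
  \sum_(j < n.+1 ^ 2) (level n j)%:E * jump_count S (band n j t) w.
Proof.
rewrite /rounded_sum /round_down; under eq_esum do rewrite -sumEFin.
rewrite esum_sum; last first.
  by move=> s j _ _; rewrite lee_fin mulr_ge0// ltW// level_gt0.
apply: eq_bigr => j _; rewrite -esum_cst ?ltW ?level_gt0//.
rewrite /jump_count (_ : [set s | [/\ _, _ & _]] = `]0%R, t]%classic `&` [set s | in_band n j (jump S s w)]); last first.
  apply/seteqP; split => s /=; last first.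
    move=> [st hj].
    have := st; rewrite in_itv/= => /andP[s0 _]; split; [exact: s0| |split; [exact: st|exact: hj]].
    by apply: lt_le_trans (level_gt0 n j) _; case/andP: hj.
  by case=> _ _ [].
rewrite esum_mkcondr; apply: eq_esum => s _.
by rewrite (mem_setE (fun s => in_band n j (jump S s w))) /in_mem/=; case: (in_band _ _ _); rewrite ?mulr1 ?mulr0.
Qed.

Lemma rounded_sum_le n t w : (0 <= t)%R -> rounded_sum n t w <= (S t w)%:E.
Proof.
move=> t0; case: HS => _ _ _ _ /(_ w t t0) ->; apply: le_esum => s.
rewrite /= in_itv/= => /andP[s0 _].
by rewrite lee_fin round_down_le// jump_ge0.
Qed.

Lemma rounded_sum_ge0 n t w : 0 <= rounded_sum n t w.
Proof. by apply: esum_ge0 => s _; rewrite lee_fin round_down_ge0. Qed.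

Lemma rounded_sum_fin n t w : (0 <= t)%R -> rounded_sum n t w \is a fin_num.
Proof.
move=> t0; rewrite ge0_fin_numE ?rounded_sum_ge0//.
by rewrite (le_lt_trans (rounded_sum_le n w t0))// ltry.
Qed.

Lemma jump_count_ge0 B w : 0 <= jump_count S B w.
Proof. by rewrite /jump_count /counting; case: ifP => // _; rewrite ?lee_fin// leey. Qed.

Lemma jump_count_fin n (j : 'I_(n.+1 ^ 2)) t w : (0 <= t)%R ->
  jump_count S (band n j t) w \is a fin_num.
Proof.
move=> t0; have := rounded_sum_fin n w t0; rewrite rounded_sumE.
rewrite (bigD1 j)//= fin_numD => /andP[+ _].
move: (jump_count_ge0 (band n j t) w); case: (jump_count _ _ _) => //= _.
by rewrite gt0_muley// lte_fin level_gt0.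
Qed.

(** Finitely many jumps carry all of $S_t$ up to $\varepsilon$, and their
    rounded sizes converge. *)
Lemma rounded_sum_cvg t w : (0 <= t)%R ->
  fine (rounded_sum n t w) @[n --> \oo] --> S t w.
Proof.
move=> t0; apply/cvgrPdist_le => e e0.
have e20 : (0 < e / 2)%R by rewrite divr_gt0.
case: (HS) => _ _ _ _ /(_ w t t0) SE.
have fS : ereal_sup [set \sum_(s \in F) (jump S s w)%:E | F in fsets `]0%R, t]%classic] \is a fin_num.
  by rewrite -[X in X \is a _]SE.
have [_ [F [finF Ft] <-]] := ub_ereal_sup_adherent e20 fS.
rewrite -/(esum _ _) -SE => HF.
have jF s : s \in F -> (0 <= jump S s w)%R.
  by rewrite inE => /Ft; rewrite /= in_itv/= => /andP[/jump_ge0].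
have F0 s : s \in fset_set F -> s \in F by rewrite in_fset_set.
have cF : (\sum_(s <- fset_set F | s \in F) round_down n (jump S s w))%R @[n --> \oo] -->
    (\sum_(s <- fset_set F | s \in F) jump S s w)%R.
  apply: cvg_big => [|s /jF sF]; last exact: round_down_cvg.
  by move=> x; exact: add_continuous.
have FE (g : R -> R) : \sum_(s \in F) (g s)%:E = (\sum_(s <- fset_set F | s \in F) g s)%:E.
  by rewrite fsbig_finite// -sumEFin big_seq_cond [RHS]big_seq_cond; apply: eq_bigl => s;
    rewrite andbT; case: (boolP (s \in fset_set F)) => // /F0 ->.
move: HF; rewrite FE -EFinB lte_fin => HF.
have Xle n : (fine (rounded_sum n t w) <= S t w)%R.
  by rewrite -lee_fin fineK ?rounded_sum_fin// rounded_sum_le.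
have leX n : (\sum_(s <- fset_set F | s \in F) round_down n (jump S s w) <= fine (rounded_sum n t w))%R.
  rewrite -lee_fin fineK ?rounded_sum_fin// -FE.
  by apply: esum_ge; exists F.
move/cvgrPdist_le : cF => /(_ _ e20); apply: filterS => n.
move: (Xle n) (leX n); move: (fine _) (\sum_(s <- _ | _) round_down _ _)%R (\sum_(s <- _ | _) _)%R HF => x y z.
move=> h1 h2 h3; rewrite !ler_norml => /andP[h4 h5]; apply/andP; split; lra.
Qed.

Local Notation Pi0 := (positive_levy HPi).

Lemma measurable_band_set n j : measurable [set y : R | in_band n j y].
Proof. by rewrite -[X in measurable X]setTI; exact: measurable_in_band. Qed.

Lemma measurable_band n j t : measurable (band n j t).
Proof. by apply: measurableX => //; exact: measurable_band_set. Qed.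

Lemma band_fin n j : Pi0 [set y | in_band n j y] \is a fin_num.
Proof.
rewrite ge0_fin_numE//; apply: le_lt_trans (levy_tail_fin HPi (level_gt0 n j)).
apply: le_measure; rewrite ?inE//.
- by apply: measurableI => //; exact: measurable_band_set.
- by move=> y [/andP[jy _] _]; rewrite /= in_itv/= jy.
Qed.

Lemma jump_intensity_band n j t : (0 <= t)%R ->
  jump_intensity Pi (band n j t) = (t * fine (Pi0 [set y | in_band n j y]))%:E.
Proof.
move=> t0; rewrite EFinM fineK ?band_fin//.
transitivity (\int[lebesgue_measure]_(s in `]0%R, t]) Pi0 [set y | in_band n j y]); last first.
  rewrite -[Pi0 _](fineK (band_fin n j)) integral_cst// muleC; apply: (congr1 (fun z => z * _)).
  apply: (eq_trans (lebesgue_measure_itv `]0%R, t])).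
  rewrite /= lte_fin; have [_|t0'] := ltP 0%R t; first by rewrite oppr0 adde0.
  by have -> : t = 0%R by apply: le_anti; rewrite t0 t0'.
rewrite /jump_intensity [LHS]integral_mkcond [RHS]integral_mkcond.
apply: eq_integral => s _; rewrite !patchE !mem_setE !in_itv/= andbT.
have [s0|//] := ltP 0%R s; case: ifPn => [st|st] /=.
  congr (Pi _); apply/seteqP; split => y /=; rewrite in_itv/= andbT.
    by case=> y0 [_ hj].
  by case=> hj y0; split => //; split => //; rewrite /= in_itv/= s0.
rewrite (_ : [set y | _] = set0) ?measure0// -subset0 => y [_ [/=]].
by rewrite in_itv/= s0 (negbTE st).
Qed.

(** The counts over disjoint bands are independent Poisson variables. *)
Lemma laplace_rounded n t q : (0 <= t)%R -> (0 < q)%R ->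
  \int[P]_w (expR (- q * fine (rounded_sum n t w)))%:E =
  (expR (- (t * fine (\int[Pi0]_y (1 - expR (- q * Num.max (round_down n y) 0))%:E))))%:E.
Proof.
move=> t0 q0; case: HN => mN pN iN.
pose X j := jump_count S (band n j t).
pose g j (x : \bar R) := expR (- (q * level n j) * fine x).
have mg j : measurable_fun setT (g j).
  by apply: (measurableT_comp (measurable_expRM _)); exact: fine_measurable.
transitivity (\int[P]_w (\prod_(j < n.+1 ^ 2) g j (X j w))%:E).
  apply: eq_integral => w _; rewrite rounded_sumE -expR_sum; congr (expR _)%:E.
  rewrite -EFin_sum_fine/=; last by move=> j _; rewrite fin_numM// jump_count_fin.
  rewrite mulr_sumr; apply: eq_bigr => j _; rewrite fineM ?jump_count_fin//=.
  by rewrite mulrA mulNr.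
rewrite expectation_prod//; last 3 first.
- by move=> j _; apply: mN; exact: measurable_band.
- by move=> j x; exact: expR_ge0.
- apply: iN => [j|]; first exact: measurable_band.
  apply/trivIsetP => i j _ _ ij; rewrite -subset0 => -[s y] [[_ hi] [_ hj]].
  by move: ij; rewrite -(inj_eq val_inj)/= (in_band_inj hi hj) eqxx.
pose p j := fine (Pi0 [set y | in_band n j y]).
have p0 j : (0 <= p j)%R by rewrite fine_ge0.
transitivity (\prod_(j < n.+1 ^ 2) (expR (- (t * p j * (1 - expR (- (q * level n j))))))%:E).
  apply: eq_bigr => j _; apply: integral_poisson; first exact: mulr_ge0.
  - by rewrite mulr_ge0 ?ltW ?level_gt0.
  - by apply: mN; exact: measurable_band.
  - by rewrite -jump_intensity_band//; apply: pN; exact: measurable_band.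
rewrite prodEFin -expR_sum sumrN; congr (expR (- _))%:E.
under eq_bigr do rewrite -mulrA; rewrite -mulr_sumr; congr (t * _)%R.
under eq_integral => y _.
  rewrite max_l ?round_down_ge0//.
  rewrite (@round_downP _ n y (fun y => (1 - expR (- q * y))%R)); last by rewrite mulr0 expR0 subrr.
  rewrite -sumEFin; over.
have c0 j : (0 <= 1 - expR (- q * level n j))%R.
  by have := exponent_integrand_ge0 (level n j) q0; rewrite max_l// ltW// level_gt0.
rewrite ge0_integral_sum//; last 2 first.
- move=> j; apply/measurable_EFinP; apply: measurable_funM => //.
  by apply: (measurableT_comp (f := fun b : bool => b%:R : R)) => //; exact: measurable_in_band.
- by move=> j y _; rewrite lee_fin mulr_ge0.
rewrite -EFin_sum_fine/= => [|j _].
- apply: eq_bigr => j _; under eq_integral do rewrite EFinM.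
  rewrite ge0_integralZl_EFin//; last by apply: measurable_indE; exact: measurable_in_band.
  rewrite integral_indE; last exact: measurable_in_band.
  by rewrite fineM ?band_fin//= mulrC mulNr.
- under eq_integral do rewrite EFinM.
  rewrite ge0_integralZl_EFin//; last by apply: measurable_indE; exact: measurable_in_band.
  rewrite integral_indE; last exact: measurable_in_band.
  by rewrite fin_numM ?band_fin.
Qed.

(** The Lévy-Khintchine formula. *)
Lemma laplace_subordinator t q : (0 <= t)%R -> (0 < q)%R ->
  \int[P]_w (expR (- q * S t w))%:E =
  (expR (- (t * fine (laplace_exponent Pi0 q))))%:E.
Proof.
move=> t0 q0; case: (HN) => mN _ _.
have mX n : measurable_fun setT (rounded_sum n t).
  rewrite (_ : rounded_sum n t = fun w =>
    \sum_(j < n.+1 ^ 2) (level n j)%:E * jump_count S (band n j t) w); last first.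
    by apply/funext => w; exact: rounded_sumE.
  apply: emeasurable_sum => j; apply: emeasurable_funM => //.
  by apply: mN; exact: measurable_band.
have dom (x : R) : (0 <= x)%R -> (expR (- q * x) <= 1)%R.
  by move=> x0; rewrite -expR0 ler_expR mulNr oppr_le0 mulr_ge0// ltW.
have L : \int[P]_w (expR (- q * fine (rounded_sum n t w)))%:E @[n --> \oo] -->
    \int[P]_w (expR (- q * S t w))%:E.
  apply: (@dominated_cvg _ _ _ P setT measurableT _ _ (cst 1)) => //.
  - by move=> n; apply: measurable_expRMe; apply: measurableT_comp => //; exact: fine_measurable.
  - move=> w _; apply: cvg_EFin; first exact: nearW.
    by apply: (cvg_comp _ (fun x => expR (- q * x))); [exact: rounded_sum_cvg|exact: continuous_expRM].
  - exact: (finite_measure_integrable_cst P 1%R).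
  - move=> n w _; rewrite abse_EFin lee_fin ger0_norm ?expR_ge0// dom//.
    by rewrite fine_ge0// rounded_sum_ge0.
have rd0 n (y : R) : (0 <= round_down n y)%R by exact: round_down_ge0.
pose I n := \int[Pi0]_y (1 - expR (- q * Num.max (round_down n y) 0))%:E.
have LI : I n @[n --> \oo] --> laplace_exponent Pi0 q.
  apply: (@dominated_cvg _ _ _ Pi0 setT measurableT _ _ (fun y => (1 - expR (- q * Num.max y 0))%:E)) => //.
  - by move=> n; apply: measurable_exponent_integrand; exact: measurable_round_down.
  - move=> y _; apply: cvg_EFin; first exact: nearW.
    apply: cvgB; first exact: cvg_cst.
    apply: (cvg_comp (fun n => Num.max (round_down n y) 0%R) (fun x => expR (- q * x)));
      last exact: continuous_expRM.
    rewrite (_ : (fun n => Num.max (round_down n y) 0%R) = round_down^~ y); last first.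
      by apply/funext => n; apply: max_l; exact: rd0.
    have [y0|y0] := ltP y 0%R; last exact: round_down_cvg.
    rewrite (_ : round_down^~ y = cst 0%R); first exact: cvg_cst.
    by apply/funext => n; rewrite round_down_neg.
  - exact: laplace_exponent_fin.
  - move=> n y _; rewrite abse_EFin lee_fin ger0_norm ?exponent_integrand_ge0//.
    rewrite lerD2l lerN2 ler_expR !mulNr lerN2 ler_wpM2l ?(ltW q0)// [leLHS]max_l//.
    have [y0|y0] := ltP y 0%R; first by rewrite round_down_neg.
    exact: round_down_le.
have fPhi : laplace_exponent Pi0 q \is a fin_num.
  by apply: integrable_fin_num => //; exact: laplace_exponent_fin.
rewrite -(cvg_lim _ L)//; apply/cvg_lim => //.
rewrite (_ : (fun n => _) = fun n => (expR (- (t * fine (I n))))%:E); last first.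
  by apply/funext => n; exact: laplace_rounded.
apply: cvg_EFin; first exact: nearW.
apply: (cvg_comp (fun n => - (t * fine (I n)))%R expR); last exact: continuous_expR.
apply: cvgN; apply: cvgMr; move: LI.
by rewrite -{1}(fineK fPhi) => /fine_cvg.
Qed.

End laplace_subordinator.

(** * Joint measurability and translation *)

Section right_continuous.
Context d (T : measurableType d) (R : realType).
Variable Y : R -> T -> R.
Hypotheses (mY : forall s, 0 <= s -> measurable_fun setT (Y s))
  (Yr : forall s w, 0 <= s -> Y u w @[u --> s^'+] --> Y s w)
  (Y0 : forall s w, s <= 0 -> Y s w = Y 0 w).

Definition next_grid n (s : R) : R := (Num.truncn (n.+1%:R * s)).+1%:R / n.+1%:R.

(** Right-continuous paths are limits of step paths sampled at the next point
    of a grid, so that the process is jointly measurable. *)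
Lemma measurable_right_continuous : measurable_fun setT (fun p : R * T => Y p.1 p.2).
Proof.
apply: (@measurable_fun_cvg _ _ _ _ (fun n (p : R * T) => Y (next_grid n p.1) p.2)) => [n _ B mB|].
  rewrite setTI.
  pose E j := [set s : R | Num.truncn (n.+1%:R * s) = j].
  have mL j : measurable [set s : R | (Num.truncn (n.+1%:R * s) <= j)%N].
    rewrite (_ : [set s | _] = `]-oo, j.+1%:R / n.+1%:R[%classic)//.
    by apply/seteqP; split => s /=; rewrite truncn_le_nat in_itv/= ltr_pdivlMr// mulrC.
  have mE j : measurable (E j).
    case: j => [|j].
      rewrite (_ : E 0%N = [set s : R | (Num.truncn (n.+1%:R * s)%R <= 0)%N])//.
      by apply/seteqP; split => s; rewrite /E/= leqn0; [move=> ->|move/eqP].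
    rewrite (_ : E j.+1 = [set s : R | (Num.truncn (n.+1%:R * s)%R <= j.+1)%N] `\`
      [set s : R | (Num.truncn (n.+1%:R * s)%R <= j)%N]); first exact: measurableD.
    apply/seteqP; split => s; rewrite /E/=.
      by move=> ->; split => //; rewrite ltnn.
    by case=> h /negP; rewrite -ltnNge => h'; apply/eqP; rewrite eqn_leq h.
  rewrite (_ : _ @^-1` B = \bigcup_j (E j `*` (Y (j.+1%:R / n.+1%:R) @^-1` B))).
    apply: bigcupT_measurable => j; apply: measurableX => //.
    by rewrite -[X in measurable X]setTI; apply: mY.
  apply/seteqP; split => [[s w] /= h|[s w] [j _ [/= <-]]//].
  by exists (Num.truncn (n.+1%:R * s)).
move=> [s w] _ /=.
have [s0|s0] := leP 0 s; last first.
  rewrite Y0 ?(ltW s0)//.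
  have E n : next_grid n s = harmonic n.
    rewrite /next_grid (_ : Num.truncn _ = 0%N) ?mul1r//.
    by apply/eqP; rewrite -leqn0 truncn_le_nat (@lt_trans _ _ 0)// pmulr_rlt0.
  rewrite (_ : (fun n => _) = fun n => Y (harmonic n) w); last first.
    by apply/funext => n; rewrite E.
  apply: (@cvg_comp _ _ _ harmonic (Y ^~ w) _ (0^'+)); last exact: Yr.
  move=> A [e /= e0 eA]; have := @cvg_harmonic R => /cvgrPdist_lt /(_ _ e0).
  by apply: filterS => n /= h; apply: eA => //=; rewrite invr_gt0.
apply: (@cvg_comp _ _ _ (next_grid ^~ s) (Y ^~ w) _ (s^'+)); last exact: Yr.
move=> A [e /= e0 eA]; have := @cvg_harmonic R => /cvgrPdist_lt /(_ _ e0).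
apply: filterS => n /= h.
have ns0 : 0 <= n.+1%:R * s by rewrite mulr_ge0.
case/andP: (truncn_itv ns0) => h1 h2.
have h3 : s < next_grid n s by rewrite /next_grid ltr_pdivlMr// mulrC.
have h4 : next_grid n s <= s + harmonic n.
  by rewrite /next_grid /harmonic/= ler_pdivrMr// mulrDl mulVf// -natr1 lerD2r [leRHS]mulrC.
apply: eA => //=; rewrite distrC gtr0_norm ?subr_gt0//.
move: h; rewrite sub0r normrN ger0_norm ?invr_ge0//; apply: le_lt_trans.
by rewrite lerBlDl.
Qed.

End right_continuous.

Section translation.
Local Open Scope ereal_scope.
Context {R : realType}.

Lemma lebesgue_measure_shift (t : R) (A : set R) : measurable A ->
  pushforward lebesgue_measure (fun x : R => (x + t)%R : measurableTypeR R) A =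
  lebesgue_measure A.
Proof.
move=> mA; apply/esym.
have mt : measurable_fun setT (fun x : measurableTypeR R => (x + t)%R : measurableTypeR R).
  exact: measurable_funD.
apply: (@lebesgue_measure_unique _ (image_measure lebesgue_measure mt)) => //= _ [[a b]] _ <-.
rewrite /pushforward (_ : _ @^-1` _ = `](a - t)%R, (b - t)%R]%classic).
  rewrite !lebesgue_measure_itv/= !lte_fin ltrD2r; congr (if _ then _ else _).
  by rewrite -!EFinB; congr EFin; ring.
by apply/seteqP; split => x /=; rewrite !in_itv/= ltrBlDr lerBrDr.
Qed.

Lemma integral_lebR_shift (t : R) (f : R -> \bar R) : measurable_fun setT f ->
  (forall x, 0 <= f x) -> \int[lebR]_x f (x + t)%R = \int[lebR]_x f x.
Proof.
move=> mf f0.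
have mt : measurable_fun setT (fun x : R => (x + t)%R) by exact: measurable_funD.
rewrite -(integral_image_measure lebR mt)//; apply: eq_measure_integral => A mA _.
exact: lebesgue_measure_shift.
Qed.

End translation.

(** * The Markov property *)

Section markov_property.
Local Open Scope ereal_scope.
Context d (T : measurableType d) (R : realType) (P : probability T R).
Variables (S : R -> T -> R) (HS : driftless_subordinator P S).
Implicit Types (s t u r : R) (w : T) (l : seq R).

(** The generators of the sigma-algebra of the values at the times in [l]. *)
Definition sampled_at l : set (set T) :=
  [set A | exists s (B : set R), [/\ s \in l, measurable B & A = S s @^-1` B]].

Lemma measurable_process_preimage s B : (0 <= s)%R -> measurable B ->
  measurable (S s @^-1` B).
Proof.
move=> s0 mB; rewrite -[X in measurable X]setTI.
by case: HS => mS _ _ _ _; apply: mS.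
Qed.

(** The value at a point of a finite time grid is the sum of the previous
    increments, so it is independent of the next one. *)
Lemma sampled_indep l u r A C : (0 <= u)%R -> (0 <= r)%R ->
  {in l, forall s, 0 <= s <= u}%R -> <<s sampled_at l >> A -> measurable C ->
  P (A `&` (fun w => S (u + r) w - S u w)%R @^-1` C) =
  P A * P ((fun w => S (u + r) w - S u w)%R @^-1` C).
Proof.
move=> u0 r0 l0 sA mC.
case: (HS) => mS [_ S0] [indS _] _ _.
pose l' := sort <=%R [:: 0%R, u & l].
have memP s : (s \in l') = (s \in [:: 0%R, u & l]) by rewrite mem_sort.
have lu s : s \in l' -> (0 <= s <= u)%R.
  by rewrite memP !inE => /or3P[/eqP->|/eqP->|/l0//]; rewrite ?lexx ?u0.
have sl' : sorted <=%R l' by apply: sort_sorted; exact: le_total.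
pose n := (size l).+1.
have sz : size l' = n.+1 by rewrite size_sort.
pose tt i := if (i <= n)%N then nth 0%R l' i else (u + r)%R.
have tt_in i : (i <= n)%N -> tt i \in l'.
  by move=> ni; rewrite /tt ni mem_nth// sz ltnS.
have tt_le i j : (i <= j <= n)%N -> (tt i <= tt j)%R.
  case/andP => ij jn; rewrite /tt jn (leq_trans ij jn).
  by apply: (sorted_leq_nth le_trans le_refl) => //; rewrite inE sz ltnS// (leq_trans ij).
have tt_mem s : s \in l' -> exists2 j, (j <= n)%N & s = tt j.
  move=> sl; exists (index s l'); first by rewrite -ltnS -sz index_mem.
  by rewrite /tt -ltnS -sz index_mem sl nth_index.
have ttn : tt n = u.
  apply: le_anti; case/andP: (lu _ (tt_in n (leqnn n))) => _ ->/=.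
  have [|j jn ->] := tt_mem u; first by rewrite memP !inE eqxx orbT.
  by apply: tt_le; rewrite jn leqnn.
have tt0 : tt 0%N = 0%R.
  apply: le_anti; case/andP: (lu _ (tt_in 0%N isT)) => -> _; rewrite andbT.
  have [|j jn E] := tt_mem 0%R; first by rewrite memP !inE eqxx.
  by rewrite E; apply: tt_le; rewrite jn.
have ndtt : nondecreasing_seq tt.
  apply/nondecreasing_seqP => i; have [ni|ni] := ltnP i n; first by rewrite tt_le// leqnSn.
  rewrite {2}/tt leqNgt ltnS ni/=; have [E|ni'] := eqVneq i n.
    by rewrite E ttn lerDl.
  by rewrite /tt leqNgt ltn_neqAle eq_sym ni' ni.
have tt_ge0 i : (0 <= tt i)%R by rewrite -tt0; exact: ndtt.
pose D i w := (S (tt i.+1) w - S (tt i) w)%R.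
have SD j w : S (tt j) w = (\sum_(i < j) D i w)%R.
  rewrite -(big_mkord xpredT (D ^~ w)) /D (telescope_sumr (fun i => S (tt i) w))// tt0 S0.
  by rewrite subr0.
have mD i : measurable_fun setT (D i) by apply: measurable_funB; apply: mS.
have Dn : D n = (fun w => S (u + r) w - S u w)%R.
  by apply/funext => w; rewrite /D ttn /tt ltnn.
rewrite -Dn; apply: (@indep_last _ _ _ _ _ P D n) => //.
  by apply: indS => //; exact: tt_ge0.
apply: smallest_sub sA; first exact: smallest_sigma_algebra.
move=> _ [s [B [sl mB ->]]].
have [|j jn ->] := tt_mem s; first by rewrite memP !inE sl !orbT.
have : measurable_fun setT (S (tt j) : g_sigma_algebraType (generated_by D n) -> R).
  rewrite (_ : S (tt j) = fun w => (\sum_(i < j) D i w)%R); last by apply/funext.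
  apply: measurable_sum => i _ E mE; rewrite setTI; apply: sub_sigma_algebra.
  by exists i, E; split => //; apply: leq_trans jn.
by move=> /(_ measurableT _ mB); rewrite setTI.
Qed.

Lemma natural_filtration_measurable u A : natural_filtration S u A -> measurable A.
Proof.
apply: smallest_sub; first exact: sigma_algebra_measurable.
by move=> _ [s [B [s0 _ mB ->]]]; exact: measurable_process_preimage.
Qed.

(** Past events are independent of future increments. *)
Lemma increment_indep u r A C : (0 <= u)%R -> (0 <= r)%R ->
  natural_filtration S u A -> measurable C ->
  P (A `&` (fun w => S (u + r) w - S u w)%R @^-1` C) =
  P A * P ((fun w => S (u + r) w - S u w)%R @^-1` C).
Proof.
move=> u0 r0 sA mC; case: (HS) => mS _ _ _ _.
pose G := [set A | exists2 l, {in l, forall s, 0 <= s <= u}%R & <<s sampled_at l >> A].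
have sub l l' : {subset l <= l'} -> <<s sampled_at l >> `<=` <<s sampled_at l' >>.
  move=> ll'; apply: smallest_sub; first exact: smallest_sigma_algebra.
  move=> _ [s [B [sl mB ->]]]; apply: sub_sigma_algebra.
  by exists s, B; split => //; exact: ll'.
apply: (@indep_sigma _ _ _ P G) => //.
- move=> B [l l0]; apply: smallest_sub; first exact: sigma_algebra_measurable.
  by move=> _ [s [C' [/l0/andP[s0 _] mC' ->]]]; exact: measurable_process_preimage.
- move=> A1 A2 [l1 l10 sA1] [l2 l20 sA2]; exists (l1 ++ l2).
    by move=> s; rewrite mem_cat => /orP[/l10|/l20].
  apply: (@measurableI _ (g_sigma_algebraType (sampled_at (l1 ++ l2)))).
    by apply: sub sA1 => s sl; rewrite mem_cat sl.
  by apply: sub sA2 => s sl; rewrite mem_cat sl orbT.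
- exists [::] => //; exact: (@measurableT _ (g_sigma_algebraType (sampled_at [::]))).
- by rewrite -[X in measurable X]setTI; apply: measurable_funB; [apply: mS; rewrite addr_ge0|apply: mS| |].
- by move=> B [l l0 sB]; apply: sampled_indep sB mC.
- apply: smallest_sub sA; first exact: smallest_sigma_algebra.
  move=> _ [s [B [s0 su mB ->]]]; apply: sub_sigma_algebra.
  exists [:: s]; first by move=> x; rewrite inE => /eqP->; rewrite s0.
  by apply: sub_sigma_algebra; exists s, B; split => //; rewrite inE.
Qed.

(** The Markov property, integrated over a past event. *)
Lemma markov u r A (f : R -> R -> \bar R) : (0 <= u)%R -> (0 <= r)%R ->
  natural_filtration S u A ->
  measurable_fun setT (fun p : R * R => f p.1 p.2) -> (forall x y, 0 <= f x y) ->
  \int[P]_(w in A) f (S u w) (S (u + r) w - S u w)%R =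
  \int[P]_(w in A) \int[P]_w' f (S u w) (S r w').
Proof.
move=> u0 r0 nA mf f0; case: (HS) => mS _ [_ statS] _ _.
have mA := natural_filtration_measurable nA.
have mD : measurable_fun setT (fun w => S (u + r) w - S u w)%R.
  by apply: measurable_funB; apply: mS; rewrite ?addr_ge0.
rewrite (@indep_integral _ _ _ T R R R P A (S u) (fun w => S (u + r) w - S u w)%R)//.
- apply: eq_integral => w _.
  have mfw : measurable_fun setT (f (S u w)) by exact: (measurableT_comp mf (pair1_measurable _)).
  rewrite -(@integral_image_measure _ _ _ _ _ P _ mD (f (S u w)))//.
  rewrite -(@integral_image_measure _ _ _ _ _ P _ (mS _ r0) (f (S u w)))//.
  by apply: eq_measure_integral => B mB _; exact: statS.
- exact: mS.
- move=> B C mB mC; apply: increment_indep => //.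
  apply: (@measurableI _ (g_sigma_algebraType _)); first exact: nA.
  by apply: sub_sigma_algebra; exists u, B.
Qed.

End markov_property.

(** * The potential measure and the crossing of levels *)

Section time_measure.
Local Open Scope ereal_scope.
Context {R : realType}.

(** Lebesgue measure on $[0,\infty[$. *)
Definition time : set R -> \bar R := mrestr lebR (measurable_itv `[0%R, +oo[).

HB.instance Definition _ := Measure.on time.

Let time_sigma_finite : sigma_finite setT time.
Proof.
have [F FT mF] := sigma_finiteT (@lebR R); exists F => // n.
have [mFn Fn] := mF n; split => //; apply: le_lt_trans Fn.
by apply: le_measure; rewrite ?inE//; exact: measurableI.
Qed.

HB.instance Definition _ := Measure_isSigmaFinite.Build _ _ _ time time_sigma_finite.

Lemma integral_time (f : R -> \bar R) : measurable_fun setT f ->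
  (forall s, 0 <= f s) -> \int[time]_s f s = \int[lebR]_(s in `[0%R, +oo[) f s.
Proof. exact: integral_mrestr. Qed.

Lemma eq_integral_time (f g : R -> \bar R) :
  measurable_fun setT f -> measurable_fun setT g ->
  (forall s, 0 <= f s) -> (forall s, 0 <= g s) ->
  (forall s, (0 <= s)%R -> f s = g s) -> \int[time]_s f s = \int[time]_s g s.
Proof.
move=> mf mg f0 g0 fg; rewrite !integral_time//; apply: eq_integral => s.
by rewrite inE/= in_itv/= andbT => /fg.
Qed.

Lemma integral_time_shift t (g : R -> \bar R) : (0 <= t)%R ->
  measurable_fun setT g -> (forall s, 0 <= g s) ->
  \int[time]_s (indE (t <= s)%R * g s) = \int[time]_s g (s + t)%R.
Proof.
move=> t0 mg g0.
have mi (a : R) : measurable_fun setT (fun s : R => indE (a <= s)%R).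
  by apply: measurable_indE; exact: measurable_fun_ler.
rewrite integral_time; last 2 first.
- by apply: emeasurable_funM.
- by move=> s; rewrite mule_ge0 ?indE_ge0.
rewrite [RHS]integral_time//; last first.
  by apply: (measurableT_comp mg); exact: measurable_funD.
transitivity (\int[lebR]_s (indE (t <= s)%R * g s)).
  rewrite [LHS]integral_mkcond; apply: eq_integral => s _.
  rewrite patchE mem_setE in_itv/= andbT; case: leP => // s0.
  by rewrite leNgt (lt_le_trans s0)// /indE/= mul0e.
rewrite -(@integral_lebR_shift _ t)//; last first.
- by move=> s; rewrite mule_ge0 ?indE_ge0.
- by apply: emeasurable_funM.
rewrite [RHS]integral_mkcond; apply: eq_integral => s _.
rewrite patchE mem_setE in_itv/= andbT lerDr; case: leP => _; rewrite /indE/= ?mul1e ?mul0e//.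
Qed.

Lemma integral_time_expR c : (0 < c)%R ->
  \int[time]_s (expR (- c * s))%:E = (c^-1)%:E.
Proof.
move=> c0; rewrite integral_time ?integral_expRM_infty//.
by apply/measurable_EFinP; exact: measurable_expRM.
Qed.

End time_measure.

Section potential.
Local Open Scope ereal_scope.
Context d (T : measurableType d) (R : realType) (P : probability T R).
Variables (S : R -> T -> R) (Pi : {measure set R -> \bar R}).
Implicit Types (s t q a : R) (w : T).

(** The process, held at its initial value at negative times. *)
Definition forward s w := S (Num.max s 0%R) w.

Lemma forwardE s w : (0 <= s)%R -> forward s w = S s w.
Proof. by move=> s0; rewrite /forward max_l. Qed.

Lemma measurable_forward : driftless_subordinator P S ->
  measurable_fun setT (fun p : R * T => forward p.1 p.2).
Proof.
case=> mS _ _ [rS _] _; apply: measurable_right_continuous.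
- by move=> s s0; rewrite /forward max_l//; exact: mS.
- move=> s w s0; rewrite /forward max_l//.
  apply: (@cvg_trans _ (S u w @[u --> s^'+])); last exact: rS.
  apply: near_eq_cvg; near=> u.
  have su : (s <= u)%R by near: u; exact: nbhs_right_ge.
  by rewrite max_l// (le_trans s0).
- by move=> s w s0; rewrite /forward max_r// max_l.
Unshelve. all: by end_near. Qed.

(** The potential measure $U(A)=\int_0^\infty P(S_s\in A)\,ds$. *)
Definition potential (HS : driftless_subordinator P S)
    (HN : jumps_poisson_point_process P S Pi) (HPi : levy_integrable Pi) : set R -> \bar R :=
  image_measure (time \x P) (measurable_forward HS).

Variables (HS : driftless_subordinator P S)
  (HN : jumps_poisson_point_process P S Pi) (HPi : levy_integrable Pi).
Local Notation U := (potential HS HN HPi).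
Local Notation Pi0 := (positive_levy HPi).

HB.instance Definition _ := Measure.on U.

Lemma forward_ge0 s w : (0 <= forward s w)%R.
Proof. by case: HS => _ [S0 _] _ _ _; apply: S0; rewrite le_max lexx orbT. Qed.

Lemma measurable_forward_comp (g : R -> \bar R) : measurable_fun setT g ->
  measurable_fun setT (fun p : R * T => g (forward p.1 p.2)).
Proof. by move=> mg; apply: (measurableT_comp mg); exact: measurable_forward. Qed.

Lemma measurable_forward1 s : measurable_fun setT (forward s).
Proof. exact: (measurableT_comp (measurable_forward HS) (pair1_measurable s)). Qed.

Lemma integral_potential (g : R -> \bar R) : measurable_fun setT g ->
  (forall z, 0 <= g z) ->
  \int[U]_z g z = \int[time]_s \int[P]_w g (forward s w).
Proof.
move=> mg g0; rewrite [LHS](integral_image_measure (time \x P) (measurable_forward HS))//.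
by rewrite (fubini_tonelli1 (fun p : R * T => g (forward p.1 p.2)))//; exact: measurable_forward_comp.
Qed.

(** Otherwise $e^{-qS_1}$ would have expectation $1$, whereas $S_1>0$. *)
Lemma laplace_exponent_gt0 q : (0 < q)%R -> (0 < fine (laplace_exponent Pi0 q))%R.
Proof.
move=> q0; rewrite lt_neqAle fine_ge0 ?andbT; last first.
  by apply: integral_ge0 => y _; rewrite lee_fin exponent_integrand_ge0.
apply/eqP => E; have := laplace_subordinator HS HN HPi ler01 q0.
rewrite -E mulr0 oppr0 expR0 => L.
pose f w : \bar R := (1 - expR (- q * S 1 w))%:E.
case: (HS) => mS [_ S0] _ [_ incS] _.
have f0 w : 0 < f w.
  by rewrite lte_fin subr_gt0 -[X in (_ < X)%R]expR0 ltr_expR mulNr oppr_lt0 mulr_gt0// -(S0 w) incS.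
have mf : measurable_fun setT f.
  apply/measurable_EFinP; apply: measurable_funB => //.
  by apply: (measurableT_comp (measurable_expRM _)); exact: mS.
have me : measurable_fun setT (fun w => (expR (- q * S 1 w))%:E).
  by apply: measurable_expRMe; exact: mS.
have I1 : \int[P]_w f w + 1 = 1.
  rewrite -[X in _ + X]L -ge0_integralD//.
  - rewrite (_ : (fun w => _) = cst 1%:E).
      by rewrite integral_cst// mul1e; exact: probability_setT.
    by apply/funext => w; rewrite /f -EFinD subrK.
  - by move=> w _; rewrite ltW.
have If : \int[P]_w `|f w| = 0.
  under eq_integral do rewrite gee0_abs ?ltW//.
  have : 0 <= \int[P]_w f w by apply: integral_ge0 => w _; rewrite ltW.
  move: I1; case: (\int[P]_w f w) => [r| |]//= [] r1 _.
  by congr EFin; apply: (addIr 1%R); rewrite r1 add0r.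
have [N [mN N0 sub]] := (ae_eq_integral_abs P measurableT mf).1 If.
have : P setT <= 0.
  rewrite -N0; apply: le_measure; rewrite ?inE// => w _; apply: sub => /=.
  by move=> /(_ Logic.I) fw; have := f0 w; rewrite fw ltxx.
by rewrite probability_setT lee_fin ler10.
Qed.

Lemma laplace_potential q : (0 < q)%R ->
  \int[U]_z (expR (- q * z))%:E = ((fine (laplace_exponent Pi0 q))^-1)%:E.
Proof.
move=> q0; rewrite integral_potential; last 2 first.
- by apply: measurable_expRMe.
- by move=> z; rewrite lee_fin expR_ge0.
rewrite -integral_time_expR ?laplace_exponent_gt0//.
apply: eq_integral_time.
- apply: measurable_integral_snd; first by apply: measurable_expRMe; exact: measurable_forward.
  by move=> s w; rewrite lee_fin expR_ge0.
- by apply: measurable_expRMe.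
- by move=> s; apply: integral_ge0 => w _; rewrite lee_fin expR_ge0.
- by move=> s; rewrite lee_fin expR_ge0.
move=> s s0; under eq_integral do rewrite forwardE//.
by rewrite (laplace_subordinator HS HN HPi)// mulrC mulNr.
Qed.

Lemma potential0 : U `]-oo, 0%R[%classic = 0.
Proof.
rewrite -[LHS]/((time \x P) _) (_ : _ @^-1` _ = set0) ?measure0//.
rewrite -subset0 => p; rewrite /= in_itv/= ltNge.
by rewrite forward_ge0.
Qed.

Let potential_sigma_finite : sigma_finite setT U.
Proof.
exists (fun n => `]-oo, n%:R]%classic).
  apply/esym; rewrite -subTset => x _; exists (Num.truncn x).+1 => //=.
  by rewrite in_itv/= ltW// truncnS_gt.
move=> n; split => //.
have mD : measurable (`]-oo, n%:R] `&` `[0%R, +oo[ : set R)%classic by exact: measurableI.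
apply: (@le_lt_trans _ _ (U (`]-oo, 0%R[%classic `|` (`]-oo, n%:R] `&` `[0%R, +oo[)))).
  apply: le_measure; rewrite ?inE//; first exact: measurableU.
  move=> x /= xn; case: (ltP x 0%R) => x0; first by left; rewrite /= in_itv.
  by right; split => //; rewrite /= in_itv/= x0.
apply: (@le_lt_trans _ _ (U `]-oo, 0%R[%classic + U (`]-oo, n%:R] `&` `[0%R, +oo[)%classic)).
  by apply: measureU2; first exact: measurable_itv.
rewrite potential0 add0e; apply: finite_laplace_bounded => q q0.
apply: (@le_lt_trans _ _ (\int[U]_z (expR (- q * z))%:E)).
  by apply: ge0_subset_integral => //; apply: measurable_expRMe.
by rewrite laplace_potential// ltry.
Qed.

HB.instance Definition _ :=
  Measure_isSigmaFinite.Build _ _ _ U potential_sigma_finite.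

(** Kesten's theorem applies since the transform of the potential measure is
    $\int_0^\infty e^{-s\Phi(q)}\,ds=1/\Phi(q)$. *)
Lemma potential_overshoot a : (0 < a)%R -> overshoot U Pi0 a = 1.
Proof.
apply: no_creeping; [exact: potential0|exact: positive_levy0|].
move=> q q0; rewrite /laplace laplace_potential//.
have [_ fP] : True /\ laplace_exponent Pi0 q \is a fin_num.
  by split => //; apply: integrable_fin_num => //; exact: laplace_exponent_fin.
by rewrite -[X in _ * X](fineK fP) -EFinM mulVf// gt_eqF// laplace_exponent_gt0.
Qed.

End potential.

Section level_crossing.
Local Open Scope ereal_scope.
Context d (T : measurableType d) (R : realType) (P : probability T R).
Variables (S : R -> T -> R) (Pi : {measure set R -> \bar R}).
Variables (HS : driftless_subordinator P S)
  (HN : jumps_poisson_point_process P S Pi) (HPi : levy_integrable Pi).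
Local Notation U := (potential HS HN HPi).
Local Notation Pi0 := (positive_levy HPi).
Implicit Types (s t q a : R) (w : T).

Lemma measurable_tail_forward (a : R) :
  measurable_fun setT (fun p : R * T => tail Pi0 (a - forward S p.1 p.2)%R).
Proof.
apply: measurableT_comp; first exact: measurable_tail.
by apply: measurable_funB => //; exact: (measurable_forward HS).
Qed.

(** Splitting the potential measure at time $t$, by the Markov property at $t$. *)
Lemma potential_split t a : (0 <= t)%R ->
  overshoot U Pi0 a =
  \int[time]_s \int[P]_w (indE (s < t)%R * tail Pi0 (a - forward S s w)%R) +
  \int[P]_w overshoot U Pi0 (a - S t w)%R.
Proof.
move=> t0.
have mS s : (0 <= s)%R -> measurable_fun setT (S s) by case: (HS) => + _ _ _ _; apply.
pose g s := \int[P]_w tail Pi0 (a - forward S s w)%R.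
have mtf s : measurable_fun setT (fun w => tail Pi0 (a - forward S s w)%R).
  apply: measurableT_comp; first exact: measurable_tail.
  by apply: measurable_funB => //; exact: (measurable_forward1 HS).
have mg : measurable_fun setT g.
  apply: (@measurable_integral_snd _ _ R T R P (fun s w => tail Pi0 (a - forward S s w)%R)).
    exact: measurable_tail_forward.
  by move=> s w; exact: tail_ge0.
have g0 s : 0 <= g s by apply: integral_ge0 => w _; exact: tail_ge0.
have mlt (b : R) : measurable_fun setT (fun s : R => indE (s < b)%R).
  by apply: measurable_indE; exact: measurable_fun_ltr.
have mle (b : R) : measurable_fun setT (fun s : R => indE (b <= s)%R).
  by apply: measurable_indE; exact: measurable_fun_ler.
have -> : overshoot U Pi0 a = \int[time]_s g s.
  rewrite /overshoot integral_potential//.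
  - by apply: measurableT_comp; [exact: measurable_tail|exact: measurable_funB].
  - by move=> z; exact: tail_ge0.
have -> : \int[time]_s g s = \int[time]_s (indE (s < t)%R * g s) + \int[time]_s (indE (t <= s)%R * g s).
  rewrite -ge0_integralD//.
  - apply: eq_integral => s _; case: ltP => _; rewrite /indE/= ?mul1e ?mul0e ?adde0 ?add0e//.
  - by move=> s _; rewrite mule_ge0 ?indE_ge0.
  - by apply: emeasurable_funM.
  - by move=> s _; rewrite mule_ge0 ?indE_ge0.
  - by apply: emeasurable_funM.
congr (_ + _).
  apply: eq_integral => s _; rewrite ge0_integralZl_EFin//.
  by move=> w _; exact: tail_ge0.
rewrite integral_time_shift//.
have mf2 : measurable_fun setT (fun p : R * R => tail Pi0 (a - p.1 - p.2)%R).
  apply: measurableT_comp; first exact: measurable_tail.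
  by apply: measurable_funB => //; exact: measurable_funB.
have mf3 : measurable_fun setT (fun p : T * R * T =>
    tail Pi0 (a - S t p.1.1 - forward S p.1.2 p.2)%R).
  apply: measurableT_comp; first exact: measurable_tail.
  apply: measurable_funB.
    apply: measurable_funB => //; apply: measurableT_comp; first exact: mS.
    exact: (measurableT_comp measurable_fst measurable_fst).
  have mq : measurable_fun setT (fun p : T * R * T => (p.1.2, p.2)).
    by apply: measurable_fun_pair => //; exact: (measurableT_comp measurable_snd measurable_fst).
  exact: (measurableT_comp (measurable_forward HS) mq).
have mf4 : measurable_fun setT (fun p : T * R =>
    \int[P]_w' tail Pi0 (a - S t p.1 - forward S p.2 w')%R).
  apply: (@measurable_integral_snd _ _ (T * R)%type T R P
    (fun p w' => tail Pi0 (a - S t p.1 - forward S p.2 w')%R)) => //.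
  by move=> p w'; exact: tail_ge0.
transitivity (\int[time]_s \int[P]_w \int[P]_w' tail Pi0 (a - S t w - forward S s w')%R).
  apply: eq_integral_time.
  - by apply: (measurableT_comp mg); exact: measurable_funD.
  - apply: (@measurable_integral_snd _ _ R T R P
      (fun s w => \int[P]_w' tail Pi0 (a - S t w - forward S s w')%R)).
      exact: (measurableT_comp mf4 (@measurable_swap _ _ _ _)).
    by move=> s w; apply: integral_ge0 => w' _; exact: tail_ge0.
  - by move=> s; exact: g0.
  - by move=> s; apply: integral_ge0 => w _; apply: integral_ge0 => w' _; exact: tail_ge0.
  - move=> s s0.
    transitivity (\int[P]_w tail Pi0 (a - S t w - (S (t + s) w - S t w))%R).
      apply: eq_integral => w _; rewrite forwardE ?addr_ge0// (addrC s t); congr (tail _ _); ring.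
    transitivity (\int[P]_w \int[P]_w' tail Pi0 (a - S t w - S s w')%R).
      apply: (@markov _ _ _ _ _ HS t s setT (fun x y => tail Pi0 (a - x - y)%R)) => //.
      + exact: (@measurableT _ (g_sigma_algebraType _)).
      + by move=> x y; exact: tail_ge0.
    by apply: eq_integral => w _; apply: eq_integral => w' _; rewrite forwardE.
have nn w s : 0 <= \int[P]_w' tail Pi0 (a - S t w - forward S s w')%R.
  by apply: integral_ge0 => w' _; exact: tail_ge0.
rewrite -(@integral_swap _ _ _ _ _ P time _ mf4 nn).
apply: eq_integral => w _; rewrite /overshoot integral_potential//.
- by apply: measurableT_comp; [exact: measurable_tail|exact: measurable_funB].
- by move=> z; exact: tail_ge0.
Qed.

(** Since every level is crossed by a jump, the probability of having crossed
    the level $a$ by time $t$ is the expected number of crossing jumps. *)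
Lemma level_crossing t a : (0 <= t)%R -> (0 < a)%R ->
  P [set w | (a <= S t w)%R] =
  \int[time]_s \int[P]_w (indE (s < t)%R * tail Pi0 (a - forward S s w)%R).
Proof.
move=> t0 a0; have := potential_split a t0; rewrite potential_overshoot//.
have mS s : (0 <= s)%R -> measurable_fun setT (S s) by case: (HS) => + _ _ _ _; apply.
have mA : measurable [set w | (a <= S t w)%R].
  rewrite -[X in measurable X]setTI.
  by apply: (measurable_fun_ler (measurable_cst a) (mS _ t0)).
have -> : \int[P]_w overshoot U Pi0 (a - S t w)%R = P (~` [set w | (a <= S t w)%R]).
  rewrite -(setIT (~` _)) -integral_indic//; last exact: measurableC.
  apply: eq_integral => w _; rewrite indicE in_setC (mem_setE (fun w => (a <= S t w)%R)) /in_mem/=.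
  have [aS|Sa] := leP a (S t w).
    by rewrite (overshoot_le0 _ (potential0 HS HN HPi)) ?subr_le0.
  by rewrite potential_overshoot// subr_gt0.
rewrite [P (~` _)]probability_setC//.
have : 0 <= \int[time]_s \int[P]_w (indE (s < t)%R * tail Pi0 (a - forward S s w)%R).
  by apply: integral_ge0 => s _; apply: integral_ge0 => w _; rewrite mule_ge0 ?indE_ge0 ?tail_ge0.
have : P [set w | (a <= S t w)%R] \is a fin_num by exact: fin_num_measure.
case: (P _) => //= p _; case: (\int[time]_s _) => [r| |]//= _ [] E.
by congr EFin; move: E; lra.
Qed.

End level_crossing.

(** * Dynkin's formula for nondecreasing functions *)

Section stieltjes_measure.
Local Open Scope ereal_scope.
Context {R : realType} (k : cumulative R R).

(** A copy on [R] itself, as for [lebR]. *)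
Definition stieltjes (A : set R) : \bar R := @lebesgue_stieltjes_measure R k A.

Let stieltjes0 : stieltjes set0 = 0. Proof. exact: measure0. Qed.
Let stieltjes_ge0 A : 0 <= stieltjes A. Proof. exact: measure_ge0. Qed.
Let stieltjes_sa : semi_sigma_additive stieltjes.
Proof. exact: (@measure_semi_sigma_additive _ _ _ (lebesgue_stieltjes_measure k)). Qed.
HB.instance Definition _ := isMeasure.Build _ R R stieltjes stieltjes0 stieltjes_ge0 stieltjes_sa.
Let stieltjes_sf : sigma_finite setT stieltjes.
Proof. exact: (@sigma_finiteT _ _ _ (lebesgue_stieltjes_measure k)). Qed.
HB.instance Definition _ := Measure_isSigmaFinite.Build _ _ _ stieltjes stieltjes_sf.

Lemma stieltjes_itv a b : (a <= b)%R -> stieltjes `]a, b]%classic = (k b - k a)%:E.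
Proof.
move=> ab; rewrite -(wlength_itv_bnd k false false ab).
rewrite /stieltjes /lebesgue_stieltjes_measure/= /measure_extension/=.
by rewrite measurable_mu_extE//; exact: is_ocitv.
Qed.

Lemma integral_stieltjes_itv a b : (a <= b)%R ->
  \int[stieltjes]_x indE (a < x <= b)%R = (k b - k a)%:E.
Proof.
move=> ab; rewrite -stieltjes_itv// integral_indE//.
by apply: measurable_and; [exact: measurable_fun_ltr|exact: measurable_fun_ler].
Qed.

Lemma measurable_cumulative : measurable_fun setT (k : R -> R).
Proof.
by apply: nondecreasing_measurable => //; exact: cumulative_is_nondecreasing.
Qed.

End stieltjes_measure.

Section swap3.
Local Open Scope ereal_scope.
Context d1 d2 d3 (T1 : measurableType d1) (T2 : measurableType d2)
  (T3 : measurableType d3) (R : realType).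
Variables (m1 : {sigma_finite_measure set T1 -> \bar R})
  (m2 : {sigma_finite_measure set T2 -> \bar R})
  (m3 : {sigma_finite_measure set T3 -> \bar R}).

Lemma integral_swap3 (F : T1 -> T2 -> T3 -> \bar R) :
  measurable_fun setT (fun p : T1 * T2 * T3 => F p.1.1 p.1.2 p.2) ->
  (forall x y z, 0 <= F x y z) ->
  \int[m1]_x \int[m2]_y \int[m3]_z F x y z =
  \int[m2]_y \int[m3]_z \int[m1]_x F x y z.
Proof.
move=> mF F0.
have m12 : measurable_fun setT (fun p : T1 * T2 => \int[m3]_z F p.1 p.2 z).
  exact: (@measurable_integral_snd _ _ (T1 * T2)%type T3 R m3 (fun p z => F p.1 p.2 z)).
rewrite (@integral_swap _ _ _ _ _ m1 m2 (fun x y => \int[m3]_z F x y z))//; last first.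
  by move=> x y; exact: integral_ge0.
apply: eq_integral => y _; apply: integral_swap => //.
have mq : measurable_fun setT (fun p : T1 * T3 => ((p.1, y), p.2)).
  by apply: measurable_fun_pair => //; exact: measurable_fun_pair.
exact: (measurableT_comp mF mq).
Qed.

End swap3.

Section generator_formula.
Local Open Scope ereal_scope.
Context d (T : measurableType d) (R : realType) (P : probability T R).
Variables (S : R -> T -> R) (Pi : {measure set R -> \bar R}).
Variables (HS : driftless_subordinator P S)
  (HN : jumps_poisson_point_process P S Pi) (HPi : levy_integrable Pi).
Local Notation Pi0 := (positive_levy HPi).
Implicit Types (s t q a x z : R) (w : T) (k : cumulative R R).

(** The generator applied to a nondecreasing function, with values in
    $[0,\infty]$. *)
Definition jump_rate k z := \int[Pi0]_y (k (z + Num.max y 0)%R - k z)%:E.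

Lemma increment_ge0 k z y : (0 <= y)%R -> (0 <= k (z + y)%R - k z)%R.
Proof. by move=> y0; rewrite subr_ge0; apply: cumulative_is_nondecreasing; rewrite lerDl. Qed.

Lemma jump_rate_ge0 k z : 0 <= jump_rate k z.
Proof. by apply: integral_ge0 => y _; rewrite lee_fin increment_ge0// le_max lexx orbT. Qed.

Lemma measurable_jump_rate k : measurable_fun setT (jump_rate k).
Proof.
apply: (@measurable_integral_snd _ _ R R R Pi0 (fun z y => (k (z + Num.max y 0)%R - k z)%:E)).
  apply/measurable_EFinP; apply: measurable_funB.
    apply: measurableT_comp; first exact: measurable_cumulative.
    by apply: measurable_funD => //; apply: measurable_maxr.
  by apply: measurableT_comp => //; exact: measurable_cumulative.
by move=> z y; rewrite lee_fin increment_ge0// le_max lexx orbT.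
Qed.

(** Exchange the integrals: a jump $y$ from $z$ crosses the levels in
    $]z,z+y]$, which [stieltjes] weighs $k(z+y)-k(z)$. *)
Lemma integral_tail_stieltjes k z :
  \int[stieltjes k]_a tail Pi0 (a - z)%R = jump_rate k z.
Proof.
rewrite /tail (@integral_swap _ _ _ _ _ (stieltjes k) Pi0 (fun a y => indE (0 < a - z <= y)%R)).
- apply: eq_integral => y _; have [y0|y0] := leP 0%R y.
    rewrite -integral_stieltjes_itv; last by rewrite lerDl.
    by apply: eq_integral => a _; rewrite subr_gt0 lerBlDl.
  rewrite addr0 subrr; apply: integral0_eq => a _.
  by rewrite /indE; have [h|//] := ltP 0%R (a - z)%R; rewrite leNgt (lt_trans y0).
- apply: measurable_indE; apply: measurable_and.
    by apply: measurable_fun_ltr => //; exact: measurable_funB.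
  by apply: measurable_fun_ler => //; exact: measurable_funB.
- by move=> a y; exact: indE_ge0.
Qed.

(** Dynkin's formula for a monotone function, obtained by integrating
    [level_crossing] over the levels. *)
Lemma generator_formula k x t : (0 <= t)%R ->
  \int[P]_w (k (x + S t w)%R - k x)%:E =
  \int[time]_s \int[P]_w (indE (s < t)%R * jump_rate k (x + forward S s w)%R).
Proof.
move=> t0.
have mS s : (0 <= s)%R -> measurable_fun setT (S s) by case: (HS) => + _ _ _ _; apply.
have S0 w : (0 <= S t w)%R by case: HS => _ [+ _] _ _ _; apply.
pose m := stieltjes k.
transitivity (\int[m]_a \int[P]_w indE (x < a <= x + S t w)%R).
  rewrite -(@integral_swap _ _ _ _ _ P m (fun w a => indE (x < a <= x + S t w)%R)).
  - by apply: eq_integral => w _; rewrite integral_stieltjes_itv// lerDl.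
  - apply: measurable_indE; apply: measurable_and; first exact: measurable_fun_ltr.
    apply: measurable_fun_ler => //; apply: measurable_funD => //.
    by apply: measurableT_comp => //; exact: mS.
  - by move=> w a; exact: indE_ge0.
have mF : measurable_fun setT (fun p : R * R * T =>
    indE (p.1.2 < t)%R * tail Pi0 (p.1.1 - x - forward S p.1.2 p.2)%R).
  apply: emeasurable_funM.
    apply: measurable_indE; apply: measurable_fun_ltr => //.
    exact: (measurableT_comp measurable_snd measurable_fst).
  apply: measurableT_comp; first exact: measurable_tail.
  apply: measurable_funB.
    by apply: measurable_funB => //; exact: (measurableT_comp measurable_fst measurable_fst).
  have mq : measurable_fun setT (fun p : R * R * T => (p.1.2, p.2)).
    by apply: measurable_fun_pair => //; exact: (measurableT_comp measurable_snd measurable_fst).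
  exact: (measurableT_comp (measurable_forward HS) mq).
transitivity (\int[m]_a \int[time]_s \int[P]_w
    (indE (s < t)%R * tail Pi0 (a - x - forward S s w)%R)).
  apply: eq_integral => a _; have [xa|ax] := ltP x a.
    rewrite -(level_crossing HS HN)// ?subr_gt0//= -integral_indE.
      by apply: eq_integral => w _; rewrite lerBlDl.
    by apply: measurable_fun_ler => //; exact: mS.
  rewrite [LHS]integral0_eq// [RHS]integral0_eq// => s _.
  rewrite integral0_eq// => w _; rewrite tail_le0 ?mule0//.
  by have := forward_ge0 HS s w; lra.
have F0 a s w : 0 <= indE (s < t)%R * tail Pi0 (a - x - forward S s w)%R.
  by rewrite mule_ge0 ?indE_ge0 ?tail_ge0.
rewrite (@integral_swap3 _ _ _ _ _ _ _ m time P _ mF F0).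
apply: eq_integral => s _; apply: eq_integral => w _.
rewrite ge0_integralZl_EFin//; last 2 first.
- by move=> a _; exact: tail_ge0.
- by apply: measurableT_comp; [exact: measurable_tail|apply: measurable_funB => //; exact: measurable_funB].
rewrite -integral_tail_stieltjes; congr (_ * _).
by apply: eq_integral => a _; rewrite opprD addrA.
Qed.

End generator_formula.

(** * Conditional form of Dynkin's formula *)

Section compensator.
Local Open Scope ereal_scope.
Context d (T : measurableType d) (R : realType) (P : probability T R).
Variables (S : R -> T -> R) (Pi : {measure set R -> \bar R}).
Variables (HS : driftless_subordinator P S)
  (HN : jumps_poisson_point_process P S Pi) (HPi : levy_integrable Pi).
Variables (k : cumulative R R) (x : R).
Implicit Types (s t u : R) (w : T) (A : set T).
Local Notation rate := (jump_rate HPi k).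

(** The predictable growth of $k(x+S)$ on $[u,t[$. *)
Definition compensator u t w :=
  \int[time]_s (indE (u <= s < t)%R * rate (x + forward S s w)%R).

Lemma compensator_ge0 u t w : 0 <= compensator u t w.
Proof. by apply: integral_ge0 => s _; rewrite mule_ge0 ?indE_ge0 ?jump_rate_ge0. Qed.

Lemma measurable_rate_forward :
  measurable_fun setT (fun p : R * T => rate (x + forward S p.1 p.2)%R).
Proof.
apply: measurableT_comp; first exact: measurable_jump_rate.
by apply: measurable_funD => //; exact: (measurable_forward HS).
Qed.

Lemma measurable_itv_indE u t :
  measurable_fun setT (fun s : R => indE (u <= s < t)%R : \bar R).
Proof.
by apply: measurable_indE; apply: measurable_and; [exact: measurable_fun_ler|exact: measurable_fun_ltr].
Qed.

Lemma measurable_compensator_integrand u t : measurable_fun setT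
  (fun p : R * T => indE (u <= p.1 < t)%R * rate (x + forward S p.1 p.2)%R).
Proof.
apply: emeasurable_funM; last exact: measurable_rate_forward.
exact: (measurableT_comp (measurable_itv_indE u t) measurable_fst).
Qed.

Lemma measurable_compensator u t : measurable_fun setT (compensator u t).
Proof.
apply: (@measurable_integral_snd _ _ T R R time
  (fun w s => indE (u <= s < t)%R * rate (x + forward S s w)%R)).
  exact: (measurableT_comp (measurable_compensator_integrand u t) (@measurable_swap _ _ _ _)).
by move=> w s; rewrite mule_ge0 ?indE_ge0 ?jump_rate_ge0.
Qed.

Lemma compensatorD u v t w : (u <= v)%R -> (v <= t)%R ->
  compensator u t w = compensator u v w + compensator v t w.
Proof.
move=> uv vt.
have mrw : measurable_fun setT (fun s => rate (x + forward S s w)%R).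
  exact: (measurableT_comp measurable_rate_forward (pair2_measurable w)).
rewrite /compensator -ge0_integralD//.
- apply: eq_integral => s _.
  rewrite -ge0_muleDl ?indE_ge0//; congr (_ * _).
  have [us|su] := leP u s => /=; last first.
    by rewrite leNgt (lt_le_trans su uv) /indE/= adde0.
  have [vs|sv] := leP v s => /=; first by rewrite {2}/indE/= add0e.
  by rewrite (lt_le_trans sv vt) /indE/= adde0.
- by move=> s _; rewrite mule_ge0 ?indE_ge0 ?jump_rate_ge0.
- by apply: emeasurable_funM => //; exact: measurable_itv_indE.
- by move=> s _; rewrite mule_ge0 ?indE_ge0 ?jump_rate_ge0.
- by apply: emeasurable_funM => //; exact: measurable_itv_indE.
Qed.

Let mS s : (0 <= s)%R -> measurable_fun setT (S s).
Proof. by case: HS => + _ _ _ _; apply. Qed.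

Let mk s : (0 <= s)%R -> measurable_fun setT (fun w => k (x + S s w)%R).
Proof.
move=> s0; apply: measurableT_comp; first exact: measurable_cumulative.
by apply: measurable_funD => //; exact: mS.
Qed.

(** [generator_formula] started afresh at time $u$. *)
Lemma generator_formula_on u t A : (0 <= u)%R -> (u <= t)%R ->
  natural_filtration S u A ->
  \int[P]_(w in A) (k (x + S t w)%R - k (x + S u w)%R)%:E =
  \int[P]_(w in A) compensator u t w.
Proof.
move=> u0 ut nA; have mA := natural_filtration_measurable HS nA.
pose PA : {finite_measure set T -> \bar R} := law_on P mA (@measurable_id _ T setT).
have PAE (f : T -> \bar R) : measurable_fun setT f -> (forall w, 0 <= f w) ->
    \int[P]_(w in A) f w = \int[PA]_w f w.
  by move=> mf f0; rewrite integral_law_on.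
have r0 : (0 <= t - u)%R by rewrite subr_ge0.
have S0 s w : (0 <= s)%R -> (0 <= S s w)%R by case: HS => _ [+ _] _ _ _; apply.
pose G y s := \int[P]_w' (indE (s < t - u)%R * rate (x + y + forward S s w')%R).
have mF : measurable_fun setT (fun p : R * R * T =>
    indE (p.1.2 < t - u)%R * rate (x + p.1.1 + forward S p.1.2 p.2)%R).
  apply: emeasurable_funM.
    apply: measurable_indE; apply: measurable_fun_ltr => //.
    exact: (measurableT_comp measurable_snd measurable_fst).
  apply: measurableT_comp; first exact: measurable_jump_rate.
  apply: measurable_funD.
    by apply: measurable_funD => //; exact: (measurableT_comp measurable_fst measurable_fst).
  have mq : measurable_fun setT (fun p : R * R * T => (p.1.2, p.2)).
    by apply: measurable_fun_pair => //; exact: (measurableT_comp measurable_snd measurable_fst).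
  exact: (measurableT_comp (measurable_forward HS) mq).
have mG : measurable_fun setT (fun p : R * R => G p.1 p.2).
  apply: (@measurable_integral_snd _ _ (R * R)%type T R P
    (fun p w' => indE (p.2 < t - u)%R * rate (x + p.1 + forward S p.2 w')%R)) => //.
  by move=> p w'; rewrite mule_ge0 ?indE_ge0 ?jump_rate_ge0.
have G0 y s : 0 <= G y s.
  by apply: integral_ge0 => w' _; rewrite mule_ge0 ?indE_ge0 ?jump_rate_ge0.
have mGS : measurable_fun setT (fun p : R * T => G (S u p.2) p.1).
  have mq : measurable_fun setT (fun p : R * T => (S u p.2, p.1)).
    by apply: measurable_fun_pair => //; apply: measurableT_comp => //; exact: mS.
  exact: (measurableT_comp mG mq).
transitivity (\int[P]_(w in A) \int[time]_s G (S u w) s).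
  transitivity (\int[P]_(w in A) \int[P]_w' (k (x + S u w + Num.max (S (t - u) w') 0)%R - k (x + S u w)%R)%:E).
    rewrite -(@markov _ _ _ _ _ HS u (t - u) A (fun y z => (k (x + y + Num.max z 0)%R - k (x + y)%R)%:E))//.
    - apply: eq_integral => w _; rewrite [(u + _)%R]addrC subrK max_l ?subr_ge0.
        by congr (k _ - _)%:E; ring.
      exact: (subordinator_nondecreasing HS).
    - have md : measurable_fun setT (fun p : R * R => (x + p.1)%R) by exact: measurable_funD.
      apply/measurable_EFinP; apply: measurable_funB.
        apply: measurableT_comp; first exact: measurable_cumulative.
        by apply: measurable_funD => //; exact: measurable_maxr.
      by apply: measurableT_comp => //; exact: measurable_cumulative.
    - by move=> y z; rewrite lee_fin increment_ge0// le_max lexx orbT.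
  apply: eq_integral => w _; rewrite -(generator_formula HS HN)//.
  by apply: eq_integral => w' _; rewrite max_l// S0.
rewrite [RHS]PAE; last 2 first.
- exact: measurable_compensator.
- exact: compensator_ge0.
rewrite [LHS]PAE; last 2 first.
- apply: (@measurable_integral_snd _ _ T R R time (fun w s => G (S u w) s)) => //.
  exact: (measurableT_comp mGS (@measurable_swap _ _ _ _)).
- by move=> w; exact: integral_ge0.
rewrite (@integral_swap _ _ _ _ _ PA time (fun w s => G (S u w) s))//; last first.
  exact: (measurableT_comp mGS (@measurable_swap _ _ _ _)).
rewrite /compensator (@integral_swap _ _ _ _ _ PA time (fun w s =>
  indE (u <= s < t)%R * rate (x + forward S s w)%R)); last 2 first.
- exact: (measurableT_comp (measurable_compensator_integrand u t) (@measurable_swap _ _ _ _)).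
- by move=> w s; rewrite mule_ge0 ?indE_ge0 ?jump_rate_ge0.
pose H s := indE (s < t)%R * \int[PA]_w rate (x + forward S s w)%R.
have mH : measurable_fun setT H.
  apply: emeasurable_funM; first by apply: measurable_indE; exact: measurable_fun_ltr.
  apply: (@measurable_integral_snd _ _ R T R PA (fun s w => rate (x + forward S s w)%R)).
    exact: measurable_rate_forward.
  by move=> s w; exact: jump_rate_ge0.
have H0 s : 0 <= H s.
  by rewrite mule_ge0 ?indE_ge0//; apply: integral_ge0 => w _; exact: jump_rate_ge0.
have mrs s : measurable_fun setT (fun w => rate (x + forward S s w)%R).
  exact: (measurableT_comp measurable_rate_forward (pair1_measurable s)).
transitivity (\int[time]_s H (s + u)%R); last first.
  rewrite -integral_time_shift//; apply: eq_integral => s _.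
  rewrite ge0_integralZl_EFin//; last by move=> w _; exact: jump_rate_ge0.
  by rewrite /H muleA -indE_and.
apply: eq_integral_time.
- exact: (@measurable_integral_snd _ _ R T R PA (fun s w => G (S u w) s)).
- by apply: (measurableT_comp mH); exact: measurable_funD.
- by move=> s; exact: integral_ge0.
- by move=> s; exact: H0.
move=> s s0; rewrite /G /H.
transitivity (\int[PA]_w (indE (s < t - u)%R * \int[P]_w' rate (x + S u w + S s w')%R)).
  apply: eq_integral => w _; rewrite ge0_integralZl_EFin//; last 2 first.
  - by move=> w' _; exact: jump_rate_ge0.
  - apply: measurableT_comp; first exact: measurable_jump_rate.
    by apply: measurable_funD => //; exact: (measurable_forward1 HS).
  by congr (_ * _); apply: eq_integral => w' _; rewrite forwardE.
have mr : measurable_fun setT (fun p : R * R => rate (x + p.1 + p.2)%R).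
  apply: measurableT_comp; first exact: measurable_jump_rate.
  by apply: measurable_funD => //; exact: measurable_funD.
have mr' : measurable_fun setT (fun p : R * T => rate (x + p.1 + S s p.2)%R).
  have mq : measurable_fun setT (fun p : R * T => (p.1, S s p.2)).
    by apply: measurable_fun_pair => //; apply: measurableT_comp => //; exact: mS.
  exact: (measurableT_comp mr mq).
have mI : measurable_fun setT (fun w => \int[P]_w' rate (x + S u w + S s w')%R).
  have m : measurable_fun setT (fun y => \int[P]_w' rate (x + y + S s w')%R).
    apply: (@measurable_integral_snd _ _ R T R P (fun y w' => rate (x + y + S s w')%R)) => //.
    by move=> y w'; exact: jump_rate_ge0.
  exact: (measurableT_comp m (mS u0)).
rewrite ge0_integralZl_EFin//; last first.
  by move=> w _; apply: integral_ge0 => w' _; exact: jump_rate_ge0.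
rewrite ltrBrDr; congr (_ * _).
rewrite -PAE//; last by move=> w; exact: jump_rate_ge0.
rewrite -PAE//; last by move=> w; apply: integral_ge0 => w' _; exact: jump_rate_ge0.
rewrite -(@markov _ _ _ _ _ HS u s A (fun y z => rate (x + y + z)%R))//; last first.
  by move=> y z; exact: jump_rate_ge0.
apply: eq_integral => w _; rewrite forwardE ?addr_ge0// (addrC s u).
congr (rate _); ring.
Qed.

End compensator.

Section null_augmentation.
Local Open Scope ereal_scope.
Context d (T : measurableType d) (R : realType) (P : probability T R).

Definition null_event : set (set T) := [set A | measurable A /\ P A = 0].

(** The events that agree with an event of [G] off a null event form a
    sigma-algebra. *)
Lemma null_augmentation (G : set (set T)) (A : set T) : sigma_algebra setT G ->
  <<s G `|` null_event >> A ->
  exists A' N, [/\ G A', null_event N & A `\` N = A' `\` N].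
Proof.
move=> [G0 GC GU].
pose C := [set A | exists A' N, [/\ G A', null_event N & A `\` N = A' `\` N]].
suff sC : sigma_algebra setT C.
  move=> sA; apply: (smallest_sub sC _ sA) => B [GB|nB].
    by exists B, set0; split => //; split => //; rewrite measure0.
  by exists set0, B; split => //; rewrite setDv set0D.
split.
- by exists set0, set0; split => //; split => //; rewrite measure0.
- move=> B [B' [N [GB' nN E]]]; exists (setT `\` B'), N; split => //; first exact: GC.
  have EN w : ~ N w -> (B w <-> B' w).
    move=> Nw; split => h.
      by have [] : (B' `\` N) w by rewrite -E; split.
    by have [] : (B `\` N) w by rewrite E; split.
  by apply/seteqP; split => w [[_ h] Nw]; split => //; split => // /(EN _ Nw).
- move=> B CB.
  have [B' HB'] := choice CB; have [N HN] := choice HB'.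
  exists (\bigcup_i B' i), (\bigcup_i N i); split.
  + by apply: GU => i; case: (HN i).
  + have mN i : measurable (N i) by case: (HN i) => _ [].
    split; first exact: bigcupT_measurable.
    apply: measure_negligible; first exact: bigcupT_measurable.
    apply: negligible_bigcup => j; case: (HN j) => _ [mNi Ni] _.
    by exists (N j); split=> //; exact: subset_refl.
  + have EN i w : ~ N i w -> (B i w <-> B' i w).
      move=> Nw; case: (HN i) => _ _ E; split => h.
        by have [] : (B' i `\` N i) w by rewrite -E; split.
      by have [] : (B i `\` N i) w by rewrite E; split.
    apply/seteqP; split => w [[i _ h] Nw]; split => //; exists i => //.
      by apply/(EN i) => // Ni; apply: Nw; exists i.
    by apply/(EN i) => // Ni; apply: Nw; exists i.
Qed.

Lemma integral_mod_null (A A' N : set T) (f : T -> \bar R) :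
  measurable A -> measurable A' -> null_event N -> A `\` N = A' `\` N ->
  measurable_fun setT f -> (forall w, 0 <= f w) ->
  \int[P]_(w in A) f w = \int[P]_(w in A') f w.
Proof.
move=> mA mA' [mN N0] E mf f0; rewrite [LHS]integral_mkcond [RHS]integral_mkcond.
apply: (eq_integral_null mN N0).
- exact: measurable_patch.
- exact: measurable_patch.
- by move=> w; rewrite patchE; case: ifP.
- by move=> w; rewrite patchE; case: ifP.
move=> w Nw; rewrite !patchE; congr (if _ then _ else _).
apply/idP/idP; rewrite !inE => h.
  by have [] : (A' `\` N) w by rewrite -E; split.
by have [] : (A `\` N) w by rewrite E; split.
Qed.

End null_augmentation.

Section compensated_martingale.
Local Open Scope ereal_scope.
Context d (T : measurableType d) (R : realType) (P : probability T R).
Variables (S : R -> T -> R) (Pi : {measure set R -> \bar R}).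
Variables (HS : driftless_subordinator P S)
  (HN : jumps_poisson_point_process P S Pi) (HPi : levy_integrable Pi).
Variables (k : cumulative R R) (x M : R).
Hypothesis kM : forall z, (`|k z| <= M)%R.
Implicit Types (s t u : R) (w : T) (A : set T).
Local Notation comp := (compensator S HPi k x).

Lemma measurable_k_process s : (0 <= s)%R -> measurable_fun setT (fun w => k (x + S s w)%R).
Proof.
move=> s0; apply: measurableT_comp; first exact: measurable_cumulative.
by apply: measurable_funD => //; case: HS => + _ _ _ _; apply.
Qed.

Lemma measurable_k_increment s t : (0 <= s)%R -> (0 <= t)%R ->
  measurable_fun setT (fun w => (k (x + S t w) - k (x + S s w))%:E).
Proof.
move=> s0 t0; apply/measurable_EFinP.
by apply: measurable_funB; exact: measurable_k_process.
Qed.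

Lemma k_increment_ge0 s t w : (0 <= s)%R -> (s <= t)%R ->
  0 <= (k (x + S t w) - k (x + S s w))%:E.
Proof.
move=> s0 st; rewrite lee_fin subr_ge0; apply: cumulative_is_nondecreasing.
by rewrite lerD2l (subordinator_nondecreasing HS).
Qed.

Lemma augmented_measurable u A :
  <<s natural_filtration S u `|` null_event P >> A -> measurable A.
Proof.
apply: smallest_sub; first exact: sigma_algebra_measurable.
by move=> B [/(natural_filtration_measurable HS)//|[]].
Qed.

Lemma augmented_filtration_measurable s A : augmented_filtration P S s A -> measurable A.
Proof.
move=> FA; apply: (@augmented_measurable (s + 1)%R); apply: FA.
by rewrite /= in_itv/= andbT ltrDl.
Qed.

Lemma integrable_k s A : (0 <= s)%R -> measurable A ->
  P.-integrable A (fun w => (k (x + S s w))%:E).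
Proof.
move=> s0 mA; apply: (@integrableS _ _ _ P setT) => //.
apply: (@le_integrable _ _ _ P setT measurableT _ (cst M%:E)).
- by apply/measurable_EFinP; exact: measurable_k_process.
- by move=> w _; rewrite lee_fin (le_trans (kM _))// ler_norm.
- exact: (finite_measure_integrable_cst P M).
Qed.

Lemma generator_formula_augmented u t A : (0 <= u)%R -> (u <= t)%R ->
  <<s natural_filtration S u `|` null_event P >> A ->
  \int[P]_(w in A) (k (x + S t w)%R - k (x + S u w)%R)%:E = \int[P]_(w in A) comp u t w.
Proof.
move=> u0 ut FA; have mA := augmented_measurable FA.
have [A' [N [nA' N0 E]]] := null_augmentation (smallest_sigma_algebra _ _) FA.
have mA' := natural_filtration_measurable HS nA'.
rewrite (integral_mod_null mA mA' N0 E); last 2 first.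
- by apply: measurable_k_increment => //; exact: le_trans ut.
- by move=> w; exact: k_increment_ge0.
rewrite (integral_mod_null mA mA' N0 E); last 2 first.
- exact: (measurable_compensator HS).
- exact: compensator_ge0.
exact: (generator_formula_on HS HN).
Qed.

Lemma integral_k_increment_cvg s t : (0 <= s)%R -> (s < t)%R ->
  \int[P]_w (k (x + S (s + (t - s) / n.+1%:R) w) - k (x + S s w))%:E @[n --> \oo] --> 0.
Proof.
move=> s0 st; have ts0 : (0 < t - s)%R by rewrite subr_gt0.
have un n : (s < s + (t - s) / n.+1%:R)%R by rewrite ltrDl divr_gt0.
have cu : (s + (t - s) / n.+1%:R)%R @[n --> \oo] --> s^'+.
  move=> B [e /= e0 eB]; have := @cvg_harmonic R => /cvgrPdist_lt.
  have ets : (0 < e / (t - s))%R by rewrite divr_gt0.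
  move=> /(_ _ ets); apply: filterS => n /= h; apply: eB => //=.
  rewrite opprD addNKr normrN ger0_norm ?divr_ge0 ?ltW//.
  move: h; rewrite sub0r normrN ger0_norm ?invr_ge0// ltr_pdivlMr//.
  by rewrite mulrC.
rewrite -[X in _ --> X](integral0 P setT).
apply: (@dominated_cvg _ _ _ P setT measurableT _ _ (cst (M + M)%:E)) => //.
- by move=> n; apply: measurable_k_increment => //; rewrite (le_trans s0)// ltW.
- move=> w _; apply: cvg_EFin; first exact: nearW.
  rewrite -[X in _ --> X](subrr (k (x + S s w)%R)); apply: cvgB; last exact: cvg_cst.
  case: HS => _ _ _ [rS incS] _.
  apply: (@cvg_comp _ _ _ (fun n => (x + S (s + (t - s) / n.+1%:R) w)%R) k _ (at_right (x + S s w)%R)).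
    move=> B [e /= e0 eB].
    have : (S (s + (t - s) / n.+1%:R) w)%R @[n --> \oo] --> S s w.
      by apply: (@cvg_comp _ _ _ _ (S ^~ w) _ (s^'+) _ cu); exact: rS.
    move=> /cvgrPdist_lt /(_ _ e0); apply: filterS => n /= h; apply: eB => /=.
      by rewrite opprD addrACA subrr add0r.
    by rewrite ltrD2l incS.
  exact: cumulative_is_right_continuous.
- exact: (finite_measure_integrable_cst P (M + M)%R).
- move=> n w _; rewrite abse_EFin lee_fin (le_trans (ler_normB _ _))// lerD//.
Qed.

(** For events of the right-continuous filtration the formula holds from every
    time after $s$; by monotonicity the error made on $[s,u]$ is at most its
    expectation on the whole space, which vanishes as $u$ decreases to $s$. *)
Lemma generator_formula_right s t A : (0 <= s)%R -> (s <= t)%R ->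
  augmented_filtration P S s A ->
  \int[P]_(w in A) (k (x + S t w)%R - k (x + S s w)%R)%:E = \int[P]_(w in A) comp s t w.
Proof.
move=> s0; rewrite le_eqVlt => /predU1P[<- _|st FA].
  rewrite integral0_eq => [|w _]; last by rewrite subrr.
  rewrite integral0_eq// => w _; rewrite /compensator integral0_eq// => r _.
  by rewrite /indE; case: ltP => h; rewrite ?(andbF, mul0e)// leNgt h mul0e.
have mA := augmented_filtration_measurable FA.
pose u n := (s + (t - s) / n.+1%:R)%R.
have ts0 : (0 < t - s)%R by rewrite subr_gt0.
have su n : (s < u n)%R by rewrite ltrDl divr_gt0.
have su' n : (s <= u n)%R by exact: ltW.
have u0 n : (0 <= u n)%R by rewrite (le_trans s0).
have ut n : (u n <= t)%R.
  by rewrite -lerBrDl ler_pdivrMr// ler_pMr// ler1n.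
have t0 : (0 <= t)%R by rewrite (le_trans s0)// ltW.
pose e n := \int[P]_w (k (x + S (u n) w) - k (x + S s w))%:E.
have mc a b : measurable_fun setT (comp a b) by exact: (measurable_compensator HS).
have Ek n : \int[P]_(w in A) (k (x + S t w)%R - k (x + S s w)%R)%:E =
    \int[P]_(w in A) comp (u n) t w + \int[P]_(w in A) (k (x + S (u n) w)%R - k (x + S s w)%R)%:E.
  rewrite -generator_formula_augmented//; last by apply: FA; rewrite /= in_itv/= andbT su.
  rewrite -ge0_integralD//.
  - by apply: eq_integral => w _; rewrite -EFinD addrA subrK.
  - by move=> w _; exact: k_increment_ge0.
  - by apply: measurable_funTS; exact: measurable_k_increment.
  - by move=> w _; exact: k_increment_ge0.
  - by apply: measurable_funTS; exact: measurable_k_increment.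
have Ec n : \int[P]_(w in A) comp s t w =
    \int[P]_(w in A) comp (u n) t w + \int[P]_(w in A) comp s (u n) w.
  rewrite -ge0_integralD//.
  - by apply: eq_integral => w _; rewrite (compensatorD HS _ _ _ _ (su' n) (ut n)) addeC.
  - by move=> w _; exact: compensator_ge0.
  - exact: measurable_funTS.
  - by move=> w _; exact: compensator_ge0.
  - exact: measurable_funTS.
have ke n : \int[P]_(w in A) (k (x + S (u n) w)%R - k (x + S s w)%R)%:E <= e n.
  apply: ge0_subset_integral => //; first exact: measurable_k_increment.
  by move=> w _; exact: k_increment_ge0.
have ce n : \int[P]_(w in A) comp s (u n) w <= e n.
  rewrite /e (generator_formula_on HS HN)//; last exact: (@measurableT _ (g_sigma_algebraType _)).
  apply: ge0_subset_integral => //.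
  by move=> w _; exact: compensator_ge0.
have se (r : R) : (0 < r)%R -> exists n, e n <= r%:E.
  move=> r0; have /fine_cvgP[fe] := integral_k_increment_cvg s0 st.
  move=> /cvgrPdist_le /(_ _ r0) he; have [n _ /(_ n (leqnn n))] := filterI fe he.
  rewrite /= sub0r normrN => -[fn hn]; exists n.
  have fen : e n \is a fin_num by exact: fn.
  by rewrite -(fineK fen) lee_fin; exact: le_trans (ler_norm _) hn.
have key (p q c : \bar R) (r : R) : 0 <= c -> p <= r%:E -> q + p <= (q + c) + r%:E.
  by move=> c0 pr; rewrite -addeA; apply: leeD2l; apply: (le_trans pr); rewrite leeDr.
apply/eqP; rewrite eq_le; apply/andP; split; apply/lee_addgt0Pr => r r0;
  have [n en] := se r r0; rewrite (Ek n) (Ec n); apply: key.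
- by apply: integral_ge0 => w _; exact: compensator_ge0.
- exact: (le_trans (ke n) en).
- by apply: integral_ge0 => w _; exact: k_increment_ge0.
- exact: (le_trans (ce n) en).
Qed.

(** Its expectation is that of a bounded increment. *)
Lemma compensator_integrable u t A : (0 <= u)%R -> (u <= t)%R -> measurable A ->
  P.-integrable A (comp u t).
Proof.
move=> u0 ut mA; apply: (@integrableS _ _ _ P setT) => //.
apply/integrableP; split; first exact: (measurable_compensator HS).
under eq_integral do rewrite gee0_abs ?compensator_ge0//.
rewrite -(generator_formula_on HS HN)//; last exact: (@measurableT _ (g_sigma_algebraType _)).
have t0 := le_trans u0 ut.
have : P.-integrable setT (fun w => (k (x + S t w))%:E - (k (x + S u w))%:E).
  by apply: integrableB => //; exact: integrable_k.
move=> /integrableP[_]; under eq_integral => w _.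
  rewrite gee0_abs; last by rewrite -EFinB k_increment_ge0.
  over.
by under eq_integral do rewrite -EFinB.
Qed.

(** The martingale of a single nondecreasing function. *)
Definition compensated t w : \bar R := (k (x + S t w))%:E - comp 0 t w.

Lemma compensated_integrable t A : (0 <= t)%R -> measurable A ->
  P.-integrable A (compensated t).
Proof.
move=> t0 mA; apply: integrableB => //; first exact: integrable_k.
exact: compensator_integrable.
Qed.

Lemma integral_compensated s t A : (0 <= s)%R -> (s <= t)%R ->
  augmented_filtration P S s A ->
  \int[P]_(w in A) compensated t w = \int[P]_(w in A) compensated s w.
Proof.
move=> s0 st FA; have mA := augmented_filtration_measurable FA.
have t0 := le_trans s0 st.
have IB (f g : T -> \bar R) : P.-integrable A f -> P.-integrable A g ->
    \int[P]_(w in A) (f w - g w) = \int[P]_(w in A) f w - \int[P]_(w in A) g w.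
  by move=> fi gi; exact: integralB.
have it := integrable_k t0 mA; have is' := integrable_k s0 mA.
have ct := compensator_integrable (lexx 0%R) t0 mA.
have cs := compensator_integrable (lexx 0%R) s0 mA.
have cst' := compensator_integrable s0 st mA.
have E1 := generator_formula_right s0 st FA.
rewrite (IB _ _ it is') in E1.
have E2 : \int[P]_(w in A) comp 0 t w =
    \int[P]_(w in A) comp 0 s w + \int[P]_(w in A) comp s t w.
  have c0 u v w : A w -> 0 <= comp u v w by move=> _; exact: compensator_ge0.
  have mc u v : measurable_fun A (comp u v).
    by apply: measurable_funTS; exact: (measurable_compensator HS).
  rewrite -[RHS](ge0_integralD P mA (c0 0%R s) (mc _ _) (c0 s t) (mc _ _)).
  by apply: eq_integral => w _; rewrite (compensatorD HS _ _ _ _ s0 st).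
rewrite /compensated (IB _ _ it ct) (IB _ _ is' cs) E2 -E1.
have key (a b c : \bar R) : a \is a fin_num -> b \is a fin_num -> c \is a fin_num ->
    a - (c + (a - b)) = b - c.
  by case: a b c => [a| |]// [b| |]// [c| |]// _ _ _; congr EFin; lra.
by apply: key; [exact: integrable_fin_num it|exact: integrable_fin_num is'|exact: integrable_fin_num cs].
Qed.

End compensated_martingale.

(** * The generator on functions of bounded variation *)

Section drift.
Local Open Scope ereal_scope.
Context {R : realType} (Pi : {measure set R -> \bar R}) (HPi : levy_integrable Pi).
Variables k1 k2 : cumulative R R.
Local Notation Pi0 := (positive_levy HPi).
Implicit Types z y : R.

(** The increment of $k_1-k_2$ over a jump $y$ from $z$, zero for $y\le 0$. *)
Definition increment2 z y : R :=
  (k1 (z + Num.max y 0) - k1 z - (k2 (z + Num.max y 0) - k2 z))%R.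

Definition gain z := \int[Pi0]_y (Num.max (increment2 z y) 0)%:E.
Definition loss z := \int[Pi0]_y (Num.max (- increment2 z y) 0)%:E.

(** The value of the generator on $k_1-k_2$, extended to the whole line in $z$
    so as to be measurable there. *)
Definition drift z : \bar R :=
  if (gain z < +oo) || (loss z < +oo) then gain z - loss z else 0.

Lemma measurable_increment2 :
  measurable_fun setT (fun p : R * R => increment2 p.1 p.2).
Proof.
have m (k : cumulative R R) :
    measurable_fun setT (fun p : R * R => (k (p.1 + Num.max p.2 0) - k p.1)%R).
  apply: measurable_funB.
    apply: measurableT_comp; first exact: measurable_cumulative.
    by apply: measurable_funD => //; exact: measurable_maxr.
  by apply: measurableT_comp => //; exact: measurable_cumulative.
exact: measurable_funB.
Qed.

Lemma measurable_gain : measurable_fun setT gain.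
Proof.
apply: (@measurable_integral_snd _ _ R R R Pi0 (fun z y => (Num.max (increment2 z y) 0)%:E)).
  by apply/measurable_EFinP; apply: measurable_maxr => //; exact: measurable_increment2.
by move=> z y; rewrite lee_fin le_max lexx orbT.
Qed.

Lemma measurable_loss : measurable_fun setT loss.
Proof.
apply: (@measurable_integral_snd _ _ R R R Pi0 (fun z y => (Num.max (- increment2 z y) 0)%:E)).
  apply/measurable_EFinP; apply: measurable_maxr => //.
  by apply: measurableT_comp => //; exact: measurable_increment2.
by move=> z y; rewrite lee_fin le_max lexx orbT.
Qed.

Lemma measurable_drift : measurable_fun setT drift.
Proof.
apply: measurable_fun_ifT.
- apply: measurable_or; apply: measurable_fun_lte => //.
  + exact: measurable_gain.
  + exact: measurable_loss.
- by apply: emeasurable_funB; [exact: measurable_gain|exact: measurable_loss].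
- exact: measurable_cst.
Qed.

Lemma gain_ge0 z : 0 <= gain z.
Proof. by apply: integral_ge0 => y _; rewrite lee_fin le_max lexx orbT. Qed.

Lemma loss_ge0 z : 0 <= loss z.
Proof. by apply: integral_ge0 => y _; rewrite lee_fin le_max lexx orbT. Qed.

Let mi z : measurable_fun setT (increment2 z).
Proof. exact: (measurableT_comp measurable_increment2 (pair1_measurable z)). Qed.

Let mp z : measurable_fun setT (fun y => (Num.max (increment2 z y) 0)%:E).
Proof. by apply/measurable_EFinP; exact: measurable_maxr. Qed.

Let mn z : measurable_fun setT (fun y => (Num.max (- increment2 z y) 0)%:E).
Proof.
by apply/measurable_EFinP; apply: measurable_maxr => //; exact: measurableT_comp.
Qed.

Let mr (k : cumulative R R) z :
  measurable_fun setT (fun y => (k (z + Num.max y 0) - k z)%:E).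
Proof.
apply/measurable_EFinP; apply: measurable_funB => //.
apply: measurableT_comp; first exact: measurable_cumulative.
by apply: measurable_funD => //; exact: measurable_maxr.
Qed.

Let d0 (k : cumulative R R) z y : (0 <= k (z + Num.max y 0) - k z)%R.
Proof. by apply: increment_ge0; rewrite le_max lexx orbT. Qed.

Lemma gain_le z : gain z <= jump_rate HPi k1 z.
Proof.
apply: ge0_le_integral => //; first by move=> y _; rewrite lee_fin le_max lexx orbT.
by move=> y _; rewrite lee_fin ge_max d0 andbT gerBl d0.
Qed.

Lemma loss_le z : loss z <= jump_rate HPi k2 z.
Proof.
apply: ge0_le_integral => //; first by move=> y _; rewrite lee_fin le_max lexx orbT.
by move=> y _; rewrite lee_fin ge_max d0 andbT opprB gerBl d0.
Qed.

(** Both sides integrate the maximum of the increments of $k_1$ and $k_2$, by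
    $(a-b)^++b=(b-a)^++a$. *)
Lemma gain_loss z : gain z + jump_rate HPi k2 z = loss z + jump_rate HPi k1 z.
Proof.
have p0 (r : R) : 0 <= (Num.max r 0)%:E by rewrite lee_fin le_max lexx orbT.
rewrite /gain /loss /jump_rate -!ge0_integralD//; last 2 first.
- by move=> y _; rewrite lee_fin.
- by move=> y _; rewrite lee_fin.
apply: eq_integral => y _; rewrite -!EFinD; congr EFin.
rewrite /increment2; move: (k1 _ - _)%R (k2 _ - _)%R => a b; rewrite opprB.
by have [h|h] := leP (a - b)%R 0%R; have [h'|h'] := leP (b - a)%R 0%R; lra.
Qed.

Lemma drift_le z : `|drift z| <= jump_rate HPi k1 z + jump_rate HPi k2 z.
Proof.
apply: (@le_trans _ _ (gain z + loss z)); last by apply: leeD; [exact: gain_le|exact: loss_le].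
rewrite /drift; case: ifPn => [_|_]; last by rewrite abse0 adde_ge0 ?gain_ge0 ?loss_ge0.
apply: (le_trans (lee_abs_sub _ _)).
by rewrite !gee0_abs ?gain_ge0 ?loss_ge0.
Qed.

Lemma drift_fin z : jump_rate HPi k1 z \is a fin_num -> jump_rate HPi k2 z \is a fin_num ->
  drift z = jump_rate HPi k1 z - jump_rate HPi k2 z.
Proof.
move=> f1 f2; have := gain_loss z; rewrite /drift.
have := gain_le z; have := loss_le z; have := gain_ge0 z; have := loss_ge0 z.
move: f1 f2; case: (jump_rate _ k1 _) => [a| |]// _; case: (jump_rate _ k2 _) => [b| |]// _.
case: (gain z) => [p| |]//; case: (loss z) => [q| |]// _ _ _ _ [E].
by rewrite ltry/=; congr EFin; move: E; lra.
Qed.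

Lemma levy_generatorE (k : R -> R) z :
  (forall u, (0 <= u)%R -> k u = (k1 u - k2 u)%R) -> (0 <= z)%R ->
  levy_generator Pi k z = drift z.
Proof.
move=> kE z0; rewrite /levy_generator.
set f := fun y : R => (k (z + y) - k z)%:E.
have fE y : (`]0%R, +oo[ : set R)%classic y -> f y = (increment2 z y)%:E.
  rewrite /= in_itv/= andbT => y0; rewrite /f /increment2 (max_l (ltW y0)).
  by rewrite !kE ?addr_ge0 ?(ltW y0)//; congr EFin; ring.
have pE y : (`]0%R, +oo[ : set R)%classic y -> f^\+ y = (Num.max (increment2 z y) 0)%:E.
  by move=> y0; rewrite funeposE fE// EFin_max.
have nE y : (`]0%R, +oo[ : set R)%classic y -> f^\- y = (Num.max (- increment2 z y) 0)%:E.
  by move=> y0; rewrite funenegE fE// EFin_max.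
have p0 (r : R) : 0 <= (Num.max r 0)%:E by rewrite lee_fin le_max lexx orbT.
have Ip : \int[Pi]_(y in `]0%R, +oo[) f^\+ y = gain z.
  rewrite /gain integral_positive_levy//.
  by apply: eq_integral => y; rewrite inE => /pE.
have In : \int[Pi]_(y in `]0%R, +oo[) f^\- y = loss z.
  rewrite /loss integral_positive_levy//.
  by apply: eq_integral => y; rewrite inE => /nE.
have intp : Pi.-integrable `]0%R, +oo[%classic f^\+ <-> gain z < +oo.
  have m : measurable_fun (`]0%R, +oo[%classic : set R) f^\+.
    apply: (eq_measurable_fun (fun y => (Num.max (increment2 z y) 0)%:E)).
      by move=> y; rewrite inE => /pE.
    exact: measurable_funTS.
  have E : \int[Pi]_(y in `]0%R, +oo[) `|f^\+ y| = gain z.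
    by rewrite -Ip; apply: eq_integral => y _; rewrite gee0_abs.
  by split => [/integrableP[_]|h]; rewrite ?E//; apply/integrableP; split => //; rewrite E.
have intn : Pi.-integrable `]0%R, +oo[%classic f^\- <-> loss z < +oo.
  have m : measurable_fun (`]0%R, +oo[%classic : set R) f^\-.
    apply: (eq_measurable_fun (fun y => (Num.max (- increment2 z y) 0)%:E)).
      by move=> y; rewrite inE => /nE.
    exact: measurable_funTS.
  have E : \int[Pi]_(y in `]0%R, +oo[) `|f^\- y| = loss z.
    by rewrite -In; apply: eq_integral => y _; rewrite gee0_abs.
  by split => [/integrableP[_]|h]; rewrite ?E//; apply/integrableP; split => //; rewrite E.
rewrite /drift integralE Ip In; congr (if _ then _ else _).
by apply/asboolP/orP => -[/intp|/intn]; [left|right|left|right].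
Qed.

End drift.

Section extension.
Context {R : realType} (f : R -> R).

(** The extension of [f] by its value at $0$, a distribution function on [R]. *)
Definition extension (_ : bounded_nondecreasing_rc f) (x : R) : R := f (Num.max x 0).

Variable Hf : bounded_nondecreasing_rc f.

Lemma extensionE x : 0 <= x -> extension Hf x = f x.
Proof. by move=> x0; rewrite /extension max_l. Qed.

Let extension_nd : nondecreasing (extension Hf).
Proof.
move=> x y xy; have [_ ndf _] := Hf; apply: ndf; first by rewrite le_max lexx orbT.
by rewrite ge_max !le_max xy lexx orbT.
Qed.

Let extension_rc : right_continuous (extension Hf).
Proof.
move=> x; have [_ _ rcf] := Hf; have [x0|x0] := leP 0 x.
  rewrite /extension (max_l x0).
  apply: (@cvg_trans _ (f u @[u --> x^'+])); last exact: rcf.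
  apply: near_eq_cvg; near=> u.
  have xu : x <= u by near: u; exact: nbhs_right_ge.
  by rewrite max_l// (le_trans x0).
apply: (@cvg_trans _ (extension Hf x @[u --> x^'+])); last exact: cvg_cst.
apply: near_eq_cvg; near=> u.
have ux : u < 0 by near: u; exact: nbhs_right_lt.
by rewrite /extension !max_r// ltW.
Unshelve. all: by end_near. Qed.

HB.instance Definition _ := isCumulative.Build R _ R (extension Hf) extension_nd extension_rc.

Lemma extension_bounded : exists M, forall z, `|extension Hf z| <= M.
Proof.
have [[M [_ HM]] _ _] := Hf; exists (M + 1) => z.
by apply: (HM (M + 1)); rewrite ?ltrDl//= in_itv/= andbT le_max lexx orbT.
Qed.

End extension.

Section time_integrals.
Local Open Scope ereal_scope.
Context {R : realType}.

Lemma integral_time_itv (t : R) (f : R -> \bar R) : measurable_fun setT f ->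
  (forall s, 0 <= f s) ->
  \int[time]_s (indE (0 <= s < t)%R * f s) = \int[lebesgue_measure]_(s in `[0%R, t]) f s.
Proof.
move=> mf f0; rewrite -integral_itv_bndo_bndc; last exact: measurable_funTS.
rewrite -integral_lebR//; last exact: measurable_funTS.
rewrite integral_time; last 2 first.
- by apply: emeasurable_funM => //; exact: measurable_itv_indE.
- by move=> s; rewrite mule_ge0 ?indE_ge0.
rewrite [LHS]integral_mkcond [RHS]integral_mkcond; apply: eq_integral => s _.
rewrite !patchE !mem_setE !in_itv/= andbT; case: (0 <= s)%R => //=.
by case: (s < t)%R; rewrite /indE/= ?mul1e ?mul0e.
Qed.

End time_integrals.

Section drift_process.
Local Open Scope ereal_scope.
Context d (T : measurableType d) (R : realType) (P : probability T R).
Variables (S : R -> T -> R) (Pi : {measure set R -> \bar R}).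
Variables (HS : driftless_subordinator P S)
  (HN : jumps_poisson_point_process P S Pi) (HPi : levy_integrable Pi).
Variables (k1 k2 : cumulative R R) (M : R) (k : R -> R).
Hypotheses (k1M : forall z, (`|k1 z| <= M)%R) (k2M : forall z, (`|k2 z| <= M)%R).
Hypothesis kE : forall u, (0 <= u)%R -> k u = (k1 u - k2 u)%R.
Variable x : R.
Hypothesis x0 : (0 <= x)%R.
Implicit Types (s t : R) (w : T) (A : set T).
Local Notation leb := (@lebesgue_measure R).
Local Notation b := (levy_generator Pi k).
Local Notation b' := (drift HPi k1 k2).
Local Notation r1 := (jump_rate HPi k1).
Local Notation r2 := (jump_rate HPi k2).
Local Notation comp1 := (compensator S HPi k1 x 0).
Local Notation comp2 := (compensator S HPi k2 x 0).

Let mf w : measurable_fun setT (fun s => (x + forward S s w)%R).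
Proof.
apply: measurable_funD => //.
exact: (measurableT_comp (measurable_forward HS) (pair2_measurable w)).
Qed.

Let mb w : measurable_fun setT (fun s => b' (x + forward S s w)%R).
Proof. exact: (measurableT_comp (measurable_drift HPi k1 k2) (mf w)). Qed.

Let mr (k0 : cumulative R R) w :
  measurable_fun setT (fun s => jump_rate HPi k0 (x + forward S s w)%R).
Proof. exact: (measurableT_comp (measurable_jump_rate HPi k0) (mf w)). Qed.

Let pos s w : (0 <= s)%R -> (0 <= x + S s w)%R.
Proof. by move=> s0; rewrite addr_ge0//; case: HS => _ [+ _] _ _ _; apply. Qed.

Lemma levy_generator_forward s w : (0 <= s)%R ->
  b (x + S s w)%R = b' (x + forward S s w)%R.
Proof. by move=> s0; rewrite (levy_generatorE HPi kE) ?pos// forwardE. Qed.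

Lemma compensator_lebesgue (k0 : cumulative R R) t w :
  compensator S HPi k0 x 0 t w =
  \int[leb]_(s in `[0%R, t]) jump_rate HPi k0 (x + forward S s w)%R.
Proof. by apply: integral_time_itv => // s; exact: jump_rate_ge0. Qed.

Lemma drift_process_le t w :
  \int[leb]_(s in `[0%R, t]) `|b' (x + forward S s w)%R| <= comp1 t w + comp2 t w.
Proof.
rewrite !compensator_lebesgue -ge0_integralD//.
- apply: ge0_le_integral => //.
  + by apply: measurable_funTS; apply: measurableT_comp => //; exact: mb.
  + by apply: emeasurable_funD; apply: measurable_funTS; exact: mr.
  + by move=> s _; exact: drift_le.
- by move=> s _; exact: jump_rate_ge0.
- by apply: measurable_funTS; exact: mr.
- by move=> s _; exact: jump_rate_ge0.
- by apply: measurable_funTS; exact: mr.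
Qed.

(** A finite integral forces both rates to be finite at almost every time, and
    there the generator is their difference. *)
Lemma drift_processE t w : comp1 t w \is a fin_num -> comp2 t w \is a fin_num ->
  \int[leb]_(s in `[0%R, t]) b' (x + forward S s w)%R = comp1 t w - comp2 t w.
Proof.
rewrite !compensator_lebesgue => f1 f2.
have mI : measurable (`[0%R, t]%classic : set (measurableTypeR R)) by exact: measurable_itv.
have int (k0 : cumulative R R) :
    \int[leb]_(s in `[0%R, t]) jump_rate HPi k0 (x + forward S s w)%R \is a fin_num ->
    leb.-integrable `[0%R, t]%classic (fun s => jump_rate HPi k0 (x + forward S s w)%R).
  move=> fk; apply/integrableP; split; first by apply: measurable_funTS; exact: mr.
  under eq_integral do rewrite gee0_abs ?jump_rate_ge0//.
  by rewrite -ge0_fin_numE//; apply: integral_ge0 => s _; exact: jump_rate_ge0.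
rewrite -(integralB mI (int _ f1) (int _ f2)).
apply: ae_eq_integral => //.
- by apply: measurable_funTS; exact: mb.
- by apply: emeasurable_funB; apply: measurable_funTS; exact: mr.
have := integrable_ae mI (int _ f1); have := integrable_ae mI (int _ f2).
apply: filterS2 => s h2 h1 sI; exact: drift_fin (h1 sI) (h2 sI).
Qed.

(** The process claimed to be a martingale. *)
Definition dynkin t w : \bar R :=
  (k (x + S t w)%R)%:E - \int[leb]_(s in `[0%R, t]) b (x + S s w)%R.

Lemma dynkinE t w : (0 <= t)%R -> dynkin t w =
  (k1 (x + S t w) - k2 (x + S t w))%:E - \int[leb]_(s in `[0%R, t]) b' (x + forward S s w)%R.
Proof.
move=> t0; rewrite /dynkin kE ?pos//; congr (_ - _).
apply: eq_integral => s; rewrite inE /= in_itv/= => /andP[s0 _].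
exact: levy_generator_forward.
Qed.

Lemma compensator_fin t : (0 <= t)%R ->
  {ae P, forall w, comp1 t w \is a fin_num /\ comp2 t w \is a fin_num}.
Proof.
move=> t0.
have i1 := compensator_integrable HS HN HPi x k1M (lexx 0%R) t0 measurableT.
have i2 := compensator_integrable HS HN HPi x k2M (lexx 0%R) t0 measurableT.
have := integrable_ae measurableT i1; have := integrable_ae measurableT i2.
by apply: filterS2 => w h2 h1; split; [exact: h1|exact: h2].
Qed.

(** The compensators have finite expectation, hence are finite almost surely. *)
Lemma drift_process_fin t : (0 <= t)%R ->
  {ae P, forall w, \int[leb]_(s in `[0%R, t]) `|b (x + S s w)%R| < +oo}.
Proof.
move=> t0; apply: filterS (compensator_fin t0) => w [f1 f2].
rewrite (_ : \int[leb]_(s in _) _ = \int[leb]_(s in `[0%R, t]) `|b' (x + forward S s w)%R|).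
  apply: le_lt_trans (drift_process_le t w) _.
  rewrite -ge0_fin_numE; first by rewrite fin_numD f1.
  by apply: adde_ge0; exact: compensator_ge0.
apply: eq_integral => s; rewrite inE /= in_itv/= => /andP[s0 _].
by rewrite levy_generator_forward.
Qed.

(** Adaptedness: up to time $t$ the process is jointly measurable with
    respect to the past at time $t$. *)
Lemma dynkin_adapted t B : (0 <= t)%R -> measurable B ->
  natural_filtration S t (dynkin t @^-1` B).
Proof.
move=> t0 mB; rewrite /natural_filtration; set G := [set A | _].
pose T' := g_sigma_algebraType G.
have mSt s : (0 <= s)%R -> (s <= t)%R -> measurable_fun setT (S s : T' -> R).
  move=> s0 st _ C mC; rewrite setTI; apply: sub_sigma_algebra; by exists s, C.
pose Y s (w : T') := S (Num.min (Num.max s 0%R) t) w.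
have mY : measurable_fun setT (fun p : R * T' => Y p.1 p.2).
  case: HS => _ _ _ [rS _] _.
  apply: measurable_right_continuous.
  - move=> s s0; apply: mSt; first by rewrite le_min t0 le_max lexx orbT.
    by rewrite ge_min lexx orbT.
  - move=> s w s0; rewrite /Y (max_l s0); have [st|ts] := ltP s t.
      apply: (@cvg_trans _ (S u w @[u --> s^'+])); last exact: rS.
      apply: near_eq_cvg; near=> u.
      have su : (s <= u)%R by near: u; exact: nbhs_right_ge.
      have ut : (u <= t)%R by near: u; exact: nbhs_right_le.
      by rewrite max_l ?(le_trans s0)// min_l.
    apply: (@cvg_trans _ (S t w @[u --> s^'+])); last exact: cvg_cst.
    apply: near_eq_cvg; near=> u.
    have su : (s <= u)%R by near: u; exact: nbhs_right_ge.
    by rewrite max_l ?(le_trans s0)// min_r// (le_trans ts).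
  - by move=> s w s0; rewrite /Y (max_r s0) max_l.
have YE s w : (0 <= s < t)%R -> Y s w = forward S s w.
  by move=> /andP[s0 st]; rewrite /Y (max_l s0) min_l ?ltW// forwardE.
have mI (g : R -> \bar R) : measurable_fun setT g -> (forall z, 0 <= g z) ->
    measurable_fun setT (fun w : T' => \int[leb]_(s in `[0%R, t]) g (x + forward S s w)%R).
  move=> mg g0.
  rewrite (_ : (fun w => _) = fun w : T' => \int[time]_s (indE (0 <= s < t)%R * g (x + Y s w)%R)).
    apply: (@measurable_integral_snd _ _ T' R R time
      (fun w s => indE (0 <= s < t)%R * g (x + Y s w)%R)); last first.
      by move=> w s; rewrite mule_ge0 ?indE_ge0.
    apply: emeasurable_funM.
      exact: (measurableT_comp (measurable_itv_indE 0%R t) measurable_snd).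
    apply: measurableT_comp => //; apply: measurable_funD => //.
    exact: (measurableT_comp mY (@measurable_swap _ _ _ _)).
  apply/funext => w; rewrite -integral_time_itv//; last exact: (measurableT_comp mg (mf w)).
  apply: eq_integral => s _; case E : (0 <= s < t)%R; last by rewrite /indE/= !mul0e.
  by rewrite YE.
have : measurable_fun setT (dynkin t : T' -> \bar R).
  rewrite (_ : dynkin t = fun w => (k1 (x + S t w) - k2 (x + S t w))%:E -
     \int[leb]_(s in `[0%R, t]) b' (x + forward S s w)%R); last first.
    by apply/funext => w; exact: dynkinE.
  apply: emeasurable_funB.
    apply/measurable_EFinP; apply: measurable_funB; apply: measurableT_comp;
      try exact: measurable_cumulative; by apply: measurable_funD => //; exact: mSt.
  have mD := measurable_drift HPi k1 k2.
  rewrite (_ : (fun w => _) = fun w : T' =>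
      \int[leb]_(s in `[0%R, t]) b'^\+ (x + forward S s w)%R -
      \int[leb]_(s in `[0%R, t]) b'^\- (x + forward S s w)%R); last first.
    apply/funext => w; rewrite integralE; congr (_ - _); apply: eq_integral => s _.
      by rewrite !funeposE.
    by rewrite !funenegE.
  apply: emeasurable_funB; apply: mI => //.
    exact: measurable_funepos.
  exact: measurable_funeneg.
by move=> /(_ measurableT _ mB); rewrite setTI.
Unshelve. all: by end_near. Qed.

Lemma measurable_dynkin t : (0 <= t)%R -> measurable_fun setT (dynkin t).
Proof.
move=> t0 _ B mB; rewrite setTI.
by apply: (natural_filtration_measurable HS); apply: dynkin_adapted.
Qed.

End drift_process.

Section dynkin_martingale.
Local Open Scope ereal_scope.
Context d (T : measurableType d) (R : realType) (P : probability T R).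
Variables (S : R -> T -> R) (Pi : {measure set R -> \bar R}).
Variables (HS : driftless_subordinator P S)
  (HN : jumps_poisson_point_process P S Pi) (HPi : levy_integrable Pi).
Variables (k1 k2 : cumulative R R) (M : R) (k : R -> R).
Hypotheses (k1M : forall z, (`|k1 z| <= M)%R) (k2M : forall z, (`|k2 z| <= M)%R).
Hypothesis kE : forall u, (0 <= u)%R -> k u = (k1 u - k2 u)%R.
Variable x : R.
Hypothesis x0 : (0 <= x)%R.
Implicit Types (s t : R) (w : T) (A : set T).
Local Notation M1 := (compensated S HPi k1 x).
Local Notation M2 := (compensated S HPi k2 x).
Local Notation M0 := (dynkin S Pi k x).

Let mM t : (0 <= t)%R -> measurable_fun setT (M0 t).
Proof. exact: (measurable_dynkin HS HPi kE x0). Qed.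

Lemma dynkin_ae t : (0 <= t)%R ->
  {ae P, forall w, setT w -> M0 t w = M1 t w - M2 t w}.
Proof.
move=> t0; apply: filterS (compensator_fin HS HN HPi k1M k2M x t0) => w [f1 f2] _.
rewrite (dynkinE HS HPi kE x0 w t0) (drift_processE HS f1 f2) /compensated.
move: f1 f2; case: (compensator _ _ k1 _ _ _ _) => [a| |]// _.
case: (compensator _ _ k2 _ _ _ _) => [b| |]// _.
by congr EFin; lra.
Qed.

Lemma dynkin_integrable t A : (0 <= t)%R -> measurable A -> P.-integrable A (M0 t).
Proof.
move=> t0 mA; apply: (@integrableS _ _ _ P setT) => //.
have i1 := compensated_integrable HS HN HPi x k1M t0 measurableT.
have i2 := compensated_integrable HS HN HPi x k2M t0 measurableT.
have /integrableP[mD iD] := integrableB measurableT i1 i2.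
apply/integrableP; split; first exact: mM.
rewrite (ae_eq_integral (fun w => `|M1 t w - M2 t w|))//.
- by apply: measurableT_comp => //; exact: mM.
- by apply: measurableT_comp.
- by apply: filterS (dynkin_ae t0) => w h /h ->.
Qed.

Lemma integral_dynkin t A : (0 <= t)%R -> measurable A ->
  \int[P]_(w in A) M0 t w = \int[P]_(w in A) M1 t w - \int[P]_(w in A) M2 t w.
Proof.
move=> t0 mA.
have i1 := compensated_integrable HS HN HPi x k1M t0 mA.
have i2 := compensated_integrable HS HN HPi x k2M t0 mA.
have i12 := integrableB mA i1 i2.
rewrite -[RHS](integralB mA i1 i2); apply: ae_eq_integral => //.
- exact: measurable_funTS (mM t0).
- exact: measurable_int i12.
- by apply: filterS (dynkin_ae t0) => w h _; exact: h.
Qed.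

Lemma natural_augmented s A : natural_filtration S s A -> augmented_filtration P S s A.
Proof.
move=> nA u; rewrite /= in_itv/= andbT => su; apply: sub_sigma_algebra; left.
move: nA; apply: smallest_sub; first exact: smallest_sigma_algebra.
move=> _ [r [B [r0 rs mB ->]]]; apply: sub_sigma_algebra.
by exists r, B; split => //; rewrite (le_trans rs)// ltW.
Qed.

Lemma dynkin_martingale : martingale P (augmented_filtration P S) M0.
Proof.
move=> s t s0 st; have t0 := le_trans s0 st; split.
- by move=> B mB; apply: natural_augmented; exact: (dynkin_adapted HS HPi kE x0 s0 mB).
- exact: dynkin_integrable.
- exact: dynkin_integrable.
- move=> A FA; have mA := augmented_filtration_measurable HS FA.
  have e1 := integral_compensated HS HN HPi x k1M s0 st FA.
  have e2 := integral_compensated HS HN HPi x k2M s0 st FA.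
  apply: (eq_trans (integral_dynkin s0 mA)); rewrite -e1 -e2.
  exact: esym (integral_dynkin t0 mA).
Qed.

End dynkin_martingale.

Lemma levy_generator_extended (R : realType) (d : measure_display)
    (T : measurableType d) (P : probability T R) (S : R -> T -> R)
    (Pi : {measure set R -> \bar R}) (k : R -> R) :
  driftless_subordinator P S -> levy_measure_of P S Pi -> bounded_variations k ->
  extended_generator P S k (levy_generator Pi k).
Proof.
move=> HS [HN HPi] [k1 [k2 [H1 H2 kE]]].
have [m1 b1] := extension_bounded H1; have [m2 b2] := extension_bounded H2.
have E u : 0 <= u -> k u = extension H1 u - extension H2 u.
  by move=> u0; rewrite !extensionE// kE.
have c1 z : `|extension H1 z| <= Num.max m1 m2 by rewrite le_max b1.
have c2 z : `|extension H2 z| <= Num.max m1 m2 by rewrite le_max b2 orbT.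
split.
- apply: (eq_measurable_fun (drift HPi (extension H1) (extension H2))).
    move=> z; rewrite inE/= in_itv/= andbT => z0.
    by rewrite -(levy_generatorE HPi E z0).
  by apply: measurable_funTS; exact: measurable_drift.
- by move=> x t x0 t0; exact: (drift_process_fin HS HN HPi c1 c2 E x0 t0).
- by move=> x x0; exact: (dynkin_martingale HS HN HPi c1 c2 E x0).
Qed.

Theorem mainTheorem5 (R : realType) (d : measure_display)
    (T : measurableType d) (P : probability T R) (S : R -> T -> R)
    (Pi : {measure set R -> \bar R}) (k : R -> R) :
  driftless_subordinator P S ->
  levy_measure_of P S Pi ->
  Pi `]0, +oo[%classic = +oo%E ->
  bounded_variations k ->
  extended_domain P S k /\ extended_generator P S k (levy_generator Pi k).
Proof.
move=> HS HPi _ Hk; have Gk := levy_generator_extended HS HPi Hk.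
split=> //; split; last by exists (levy_generator Pi k).
have [k1 [k2 [H1 H2 kE]]] := Hk.
apply: (eq_measurable_fun (fun u => extension H1 u - extension H2 u)).
  by move=> u; rewrite inE/= in_itv/= andbT => u0; rewrite !extensionE// kE.
by apply: measurable_funTS; apply: measurable_funB; exact: measurable_cumulative.
Qed.
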